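(* Consider the thinned stochastic volatility model $X_{it}^{(n)}=\sigma_{it}^{(n)}Z_{it}$ described in the context, and let $\mathbf X=\mathbf X_n=(X^{(n)}_{it})_{i=1,\ldots,p;\,t=1,\ldots,n}$ and $\mathbf S=\mathbf X\mathbf X'$. Assume the following. (1) For some $\alpha\in(0,2)\cup(2,4)$, constants $q_+,q_-\ge 0$ with $q_++q_-=1$ and a slowly varying function $L$, one has $\mathbb P(Z>x)\sim q_+L(x)x^{-\alpha}$ and $\mathbb P(Z<-x)\sim q_-L(x)x^{-\alpha}$ as $x\to\infty$; moreover $\mathbb E[Z]=0$ if $\mathbb E[|Z|]<\infty$. (2) $p=p_n\to\infty$ is an integer sequence of the form $p_n=n^{\beta}\ell(n)$, $n\ge 1$, where $\ell$ is a slowly varying function and $\beta\in(0,1]$. (3) For given $m\ge1$ and $0=s_0<s_1<\cdots<s_m<\infty$, $\mathbb P(\sigma^{(n)}=s_i)=q_i^{(n)}$ for $i=0,\ldots,m$ and $n\ge1$ (with $\sum_{i=0}^mq_i^{(n)}=1$), $\lim_{n\to\infty}q_0^{(n)}=1$, and the limits $\lim_{n\to\infty}n\,q_i^{(n)}>0$, $i=1,\ldots,m$, exist (finite or infinite). Then $$b_n^{-2}\,\|\mathbf S-\operatorname{diag}(\mathbf S)\|_2\stackrel{\mathbb P}{\rightarrow}0,\qquad n\to\infty.$$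
   Context: Thinned stochastic volatility model: $(Z_{it})_{i,t\ge1}$ is a field of iid real random variables with generic element $Z$; for each $n\ge1$, $(\sigma^{(n)}_{it})_{i,t\ge1}$ is a field of iid non-negative random variables with generic element $\sigma^{(n)}$, independent of $(Z_{it})$; and $X_{it}^{(n)}=\sigma_{it}^{(n)}Z_{it}$. $(b_n)$ is a sequence of positive numbers such that $n\,p\,\mathbb E[(\sigma^{(n)})^\alpha]\,\mathbb P(|Z|>b_n)\to1$ as $n\to\infty$. $\|\mathbf C\|_2$ denotes the spectral norm of a matrix $\mathbf C$; $\operatorname{diag}(\mathbf C)$ denotes the diagonal matrix with the same diagonal as $\mathbf C$. *)

(* Defs.v *)
From HB Require Import structures.
From mathcomp Require Import all_boot all_order all_algebra.
From mathcomp Require Import all_classical all_reals all_analysis.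
Import Order.TTheory GRing.Theory Num.Theory.
Import numFieldNormedType.Exports.

Set Implicit Arguments.
Unset Strict Implicit.
Unset Printing Implicit Defensive.

Local Open Scope classical_set_scope.
Local Open Scope ring_scope.

(* Only the behaviour near +oo is constrained: L may take junk
   values on ]-oo, a[. *)
Definition slowly_varying (R : realType) (L : R -> R) : Prop :=
  (exists a : R, measurable_fun `[a, +oo[ L /\ forall x, a <= x -> 0 < L x) /\
  (forall c : R, 0 < c -> L (c * x) / L x @[x --> +oo] --> (1 : R)).

(* F x ~ q L(x) x^(-alpha) as x --> +oo, read as convergence of the ratio
   F x / (L(x) x^(-alpha)) to q, so that for q = 0 it says
   F x = o(L(x) x^(-alpha)). *)
Definition tail_equiv (R : realType) (F : R -> R) (q alpha : R) (L : R -> R)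
  : Prop := F x / (L x * x `^ (- alpha)) @[x --> +oo] --> q.

Section probability.
Context d (T : measurableType d) (R : realType) (P : probability T R).
Local Open Scope ereal_scope.

Definition mutually_independent (I : eqType) (X : I -> {RV P >-> R}) : Prop :=
  forall (J : seq I) (A : I -> set R), uniq J -> (forall j, measurable (A j)) ->
  P (\big[setI/setT]_(j <- J) (X j @^-1` A j)) =
  \prod_(j <- J) P (X j @^-1` A j).

Definition iid (I : eqType) (X : I -> {RV P >-> R}) (X0 : {RV P >-> R})
  : Prop :=
  mutually_independent X /\
  forall (i : I) (A : set R), measurable A ->
    distribution P (X i) A = distribution P X0 A.

Definition sigma_of_family (I : Type) (X : I -> {RV P >-> R})
  : set (set T) :=
  <<s \bigcup_(i in [set: I]) preimage_set_system setT (X i) measurable >>.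

Definition independent_families (I J : Type) (X : I -> {RV P >-> R})
    (Y : J -> {RV P >-> R}) : Prop :=
  forall A B : set T, sigma_of_family X A -> sigma_of_family Y B ->
  P (A `&` B) = P A * P B.

Definition cvg_in_probability (Y : nat -> T -> R) (y : R) : Prop :=
  forall eps : R, (0 < eps)%R ->
  P [set w | (eps < `|Y n w - y|)%R] @[n --> \oo] --> 0.

End probability.

Definition norm2 (R : realType) (n : nat) (x : 'cV[R]_n) : R :=
  Num.sqrt (\sum_i x i ord0 ^+ 2).

(* Operator norm induced by the Euclidean norms. Taking the closed unit ball
   rather than the unit sphere makes the norm of a matrix without columns 0. *)
Definition spectral_norm (R : realType) (m n : nat) (C : 'M[R]_(m, n)) : R :=
  sup [set norm2 (C *m x) | x in [set x : 'cV[R]_n | norm2 x <= 1]].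

Definition diag_of (R : realType) (n : nat) (C : 'M[R]_n) : 'M[R]_n :=
  diag_mx (\row_i C i i).

(* The fields are indexed from 0 instead of 1. *)
Definition data_matrix (T : Type) (R : realType)
    (sigma Z : nat * nat -> T -> R) (p n : nat) (w : T) : 'M[R]_(p, n) :=
  \matrix_(i < p, t < n)
    (sigma (i : nat, t : nat) w * Z (i : nat, t : nat) w).

Definition sample_cov (R : realType) (p n : nat) (X : 'M[R]_(p, n)) : 'M[R]_p :=
  X *m X^T.

(* Main.v *)
Require Import Defs.
From mathcomp Require Import all_boot all_order all_algebra.
From mathcomp Require Import all_classical all_reals all_analysis.
From mathcomp Require Import measurable_realfun.
From mathcomp Require Import ring lra.
Import Order.TTheory GRing.Theory Num.Theory.
Import numFieldNormedType.Exports.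

Set Implicit Arguments.
Unset Strict Implicit.
Unset Printing Implicit Defensive.

Local Open Scope classical_set_scope.
Local Open Scope ring_scope.

(** Let [q] be the probability that a volatility is nonzero. There are about
    [n p q] nonzero entries, and by the normalization [b ^ alpha] has that order,
    up to factors smaller than any power of [b]. The noise is cut at the levels
    [tau = b ^ (1 - delta)] and [K = b ^ (1 + delta)]: with high probability no
    entry has noise above [K], so the data matrix is [B + A] with small entries
    in [B] and large ones in [A], and the off-diagonal part of the sample
    covariance is the sum of

      off (B B^T),   cross A B,   cross B A,   off (A A^T),

    where [cross A B] is the off-diagonal part of [A B^T].

    The last three involve the few entries of [A] and are controlled by the mean
    of their squared Frobenius norm (mean_frob2_cross). For the first one the
    Frobenius norm is too large when [alpha] exceeds two; instead the spectral
    norm of the symmetric matrix is bounded by the trace of a high power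
    (sqnorm_pow2_le_frob, frob2_pow_trace). The mean of the trace of the power
    [h] is a sum over walks alternating between rows and columns in which
    consecutive rows differ. With [D = sqrt (max n p * p)], each distinct edge
    of the walk contributes a moment of an entry, which is at most [D^-1] times
    a power of a multiple of [tau] (small_entry_moment), while the number of
    walks with a given set of coincidences is compensated by the factors [D^-1]
    (walk_step_sum). Hence the mean is at most a constant times
    [p * tau ^ (2 h)] (mean_trace_pow). Since [tau = b ^ (1 - delta)], dividing
    by [b ^ (2 h)] gains [b ^ (- 2 h delta)], and a large [h] beats the factor
    [p <= b ^ (alpha + 1)].

    The moment bound for the edges rests on [D q <= b ^ (alpha / 2)], up to a
    small power of [b], which is where [p <= n] up to a slowly varying factor is
    used. It gives [D q <= tau ^ k] as soon as [k > alpha / 2]. For [k >= 2]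
    this is [alpha < 4]; for [k = 1] it is [alpha < 2], and when [alpha > 2]
    the centering of the noise is used instead.

    Regular variation enters only through powers: a slowly varying function lies
    between two arbitrarily small powers (slowly_varying_power_bounds), so that
    absolute moments of the noise of order [gamma < alpha] are finite
    (truncated_moment_bounded), and all truncated moments follow from these. All
    sizes are then powers of [b] (asymptotic_regime), and the exceptional
    probabilities are at most a negative power of [b] (error_terms_le). *)

(** * Means of bounded measurable functions *)
Section BoundedExpectation.
Context d (T : measurableType d) (R : realType) (P : probability T R).
Implicit Types (f g : T -> R) (A : set T).

(** All the random quantities whose means are taken below are truncated, hence
    bounded; on this class the mean is a finite linear functional and no
    integrability condition has to be carried along. *)
Definition bounded_mfun f :=
  measurable_fun setT f /\ exists M : R, forall w, `|f w| <= M.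

Definition mean f : R := \int[P]_w f w.

Lemma bmf_integrable f : bounded_mfun f -> P.-integrable setT (EFin \o f).
Proof.
move=> [mf [M fM]]; apply: measurable_bounded_integrable => //.
  by rewrite (le_lt_trans (probability_le1 P measurableT))// ltry.
exists M; split; first exact: num_real.
by move=> x Mx w _ /=; apply: (le_trans (fM w)); exact: ltW.
Qed.

Lemma bmf_cst c : bounded_mfun (cst c).
Proof. by split; [exact: measurable_cst|exists `|c|]. Qed.

Lemma bmfD f g : bounded_mfun f -> bounded_mfun g ->
  bounded_mfun (fun w => f w + g w).
Proof.
move=> [mf [M fM]] [mg [N gN]]; split; first exact: measurable_funD.
by exists (M + N) => w; rewrite (le_trans (ler_normD _ _))// lerD.
Qed.

Lemma bmfM f g : bounded_mfun f -> bounded_mfun g ->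
  bounded_mfun (fun w => f w * g w).
Proof.
move=> [mf [M fM]] [mg [N gN]]; split; first exact: measurable_funM.
by exists (M * N) => w; rewrite normrM ler_pM.
Qed.

Lemma bmfZ c f : bounded_mfun f -> bounded_mfun (fun w => c * f w).
Proof. by move=> bf; apply: (bmfM (bmf_cst c)). Qed.

Lemma bmf_abs f : bounded_mfun f -> bounded_mfun (fun w => `|f w|).
Proof.
move=> [mf [M fM]]; split; first exact: measurableT_comp.
by exists M => w; rewrite normr_id.
Qed.

Lemma bmfX f k : bounded_mfun f -> bounded_mfun (fun w => f w ^+ k).
Proof.
move=> bf; elim: k => [|k IH].
  by under eq_fun do rewrite expr0; exact: bmf_cst.
by under eq_fun do rewrite exprS; exact: bmfM.
Qed.

Lemma bmf_sum I (s : seq I) (Q : pred I) (F : I -> T -> R) :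
  (forall i, Q i -> bounded_mfun (F i)) ->
  bounded_mfun (fun w => \sum_(i <- s | Q i) F i w).
Proof.
move=> bF; elim: s => [|a s IH].
  by under eq_fun do rewrite big_nil; exact: bmf_cst.
have [Qa|/negbTE Qa] := boolP (Q a); under eq_fun do rewrite big_cons Qa.
  by apply: bmfD => //; exact: bF.
exact: IH.
Qed.

Lemma bmf_prod I (s : seq I) (F : I -> T -> R) :
  (forall i, bounded_mfun (F i)) ->
  bounded_mfun (fun w => \prod_(i <- s) F i w).
Proof.
move=> bF; elim: s => [|a s IH].
  by under eq_fun do rewrite big_nil; exact: bmf_cst.
by under eq_fun do rewrite big_cons; exact: bmfM.
Qed.

Lemma bmf_indic A : measurable A -> bounded_mfun \1_A.
Proof.
move=> mA; split; first exact: measurable_indic.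
by exists 1 => w; rewrite indicE; case: (w \in A); rewrite ?normr1 ?normr0.
Qed.

Lemma bmf_comp (X : T -> R) (h : R -> R) : measurable_fun setT X ->
  measurable_fun setT h -> (exists M : R, forall x, `|h x| <= M) ->
  bounded_mfun (h \o X).
Proof.
move=> mX mh [M hM]; split; first exact: measurableT_comp.
by exists M => w; exact: hM.
Qed.

Lemma mean_cst c : mean (cst c) = c.
Proof.
rewrite /mean Rintegral_cst// (_ : fine _ = 1) ?mulr1//.
by rewrite -[RHS]/(fine 1%E); congr fine; exact: probability_setT.
Qed.

Lemma meanD f g : bounded_mfun f -> bounded_mfun g ->
  mean (fun w => f w + g w) = mean f + mean g.
Proof. by move=> bf bg; rewrite /mean RintegralD//; exact: bmf_integrable. Qed.

Lemma meanZ c f : bounded_mfun f -> mean (fun w => c * f w) = c * mean f.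
Proof. by move=> bf; rewrite /mean RintegralZl//; exact: bmf_integrable. Qed.

Lemma mean_sum I (s : seq I) (Q : pred I) (F : I -> T -> R) :
  (forall i, Q i -> bounded_mfun (F i)) ->
  mean (fun w => \sum_(i <- s | Q i) F i w) = \sum_(i <- s | Q i) mean (F i).
Proof.
move=> bF; elim: s => [|a s IH].
  by rewrite big_nil -[RHS](mean_cst 0); congr mean; apply/funext => w; rewrite big_nil.
rewrite big_cons.
have [Qa|/negbTE Qa] := boolP (Q a); under eq_fun do rewrite big_cons Qa.
  by rewrite meanD ?IH//; [exact: bF|exact: bmf_sum].
exact: IH.
Qed.

Lemma le_mean f g : bounded_mfun f -> bounded_mfun g ->
  (forall w, f w <= g w) -> mean f <= mean g.
Proof.
move=> bf bg fg; apply: le_Rintegral => //; exact: bmf_integrable.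
Qed.

Lemma mean_ge0 f : (forall w, 0 <= f w) -> 0 <= mean f.
Proof. by move=> f0; apply: Rintegral_ge0. Qed.

Lemma norm_mean_le f : bounded_mfun f -> `|mean f| <= mean (fun w => `|f w|).
Proof. by move=> bf; apply: le_normr_Rintegral => //; exact: bmf_integrable. Qed.

Lemma mean_indic A : measurable A -> mean \1_A = fine (P A).
Proof.
by move=> mA; rewrite /mean /Rintegral integral_indic// setIT.
Qed.

Lemma prob_fineK A : measurable A -> P A = (fine (P A))%:E.
Proof. by move=> mA; rewrite fineK// fin_num_measure. Qed.

Lemma markov_mean f c : bounded_mfun f -> (forall w, 0 <= f w) -> 0 < c ->
  (P [set w | (c < f w)%R] <= (mean f / c)%:E)%E.
Proof.
move=> bf f0 c0.
have mA : measurable [set w | (c < f w)%R].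
  by rewrite -[X in measurable X]setTI; apply: measurable_fun_ltr => //; case: bf.
rewrite prob_fineK// lee_fin -mean_indic// ler_pdivlMr// mulrC -meanZ//; last exact: bmf_indic.
apply: le_mean => //; first exact: bmfZ (bmf_indic mA).
move=> w; rewrite indicE; case: (boolP (w \in _)) => [|_]; last by rewrite mulr0.
by rewrite inE/= mulr1 => /ltW.
Qed.

End BoundedExpectation.

(** * Product rule for independent families *)
Section ProductRule.
Context d (T : measurableType d) (R : realType) (P : probability T R).

(** The sum counts the positive multiples of [delta] that do not exceed [y],
    so it misses [y] by less than one step. *)
Lemma staircase_approx (delta y : R) (n : nat) :
  0 < delta -> 0 <= y < delta * n.+1%:R ->
  let st := \sum_(k < n) (if delta * k.+1%:R <= y then delta else 0) in
  st <= y <= st + delta.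
Proof.
move=> d0 /=; elim: n => [|n IH] /andP[y0 yn].
  by rewrite big_ord0 y0 add0r /= ltW// -[ltRHS]mulr1.
rewrite big_ord_recr /=; case: (leP (delta * n.+1%:R) y) => [ny|yn1].
  rewrite (eq_bigr (fun=> delta)); last first.
    move=> k _; rewrite ifT// (le_trans _ ny)// ler_pM2l// ler_nat.
    by rewrite ltnS ltnW.
  rewrite sumr_const card_ord -mulr_natr.
  move: ny yn; rewrite -!natr1 => ny yn.
  by apply/andP; split; nra.
by rewrite addr0 IH// y0.
Qed.

(** Both sides are linear and uniformly continuous in [h], and agree on
    indicators; a bounded [h] is a uniform limit of step functions. *)
Lemma mean_ext_indic (X X0 V : T -> R) (c : R) (h : R -> R) :
  measurable_fun setT X -> measurable_fun setT X0 -> bounded_mfun V ->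
  (forall A : set R, measurable A ->
    mean P (fun w => \1_A (X w) * V w) = c * fine (P (X0 @^-1` A))) ->
  measurable_fun setT h -> (exists M : R, forall x, `|h x| <= M) ->
  mean P (fun w => h (X w) * V w) = c * mean P (h \o X0).
Proof.
move=> mX mX0 bV HA mh [M hM].
have HA' A : measurable A ->
    mean P (fun w => \1_A (X w) * V w) = c * mean P (\1_A \o X0).
  move=> mA; rewrite HA// -mean_indic; last first.
    by rewrite -[X in measurable X]setTI; exact: mX0.
  by congr (_ * mean _ _); apply/funext => w; rewrite /= !indicE.
have bh (Y : T -> R) : measurable_fun setT Y -> bounded_mfun (h \o Y).
  by move=> mY; apply: bmf_comp => //; exists M.
have [_ [K VK]] := bV.
have K0 : 0 <= K by rewrite (le_trans _ (VK point)).
have M0 : 0 <= M by rewrite (le_trans _ (hM 0)).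
apply/eqP; rewrite -subr_eq0 -normr_le0; apply/ler_addgt0Pr => e e0; rewrite add0r.
pose delta := e / (K + `|c| + 1).
have KC : 0 < K + `|c| + 1 by rewrite ltr_wpDl// addr_ge0.
have d0 : 0 < delta by rewrite divr_gt0.
have [n Hn] : exists n : nat, 2 * M < delta * n.+1%:R.
  exists (Num.truncn (2 * M / delta)).
  by rewrite [ltRHS]mulrC -ltr_pdivrMr// truncnS_gt.
pose A k := [set x | delta * k.+1%:R <= h x + M].
have mA k : measurable (A k).
  rewrite -[X in measurable X]setTI; apply: measurable_fun_ler => //.
  by apply: measurable_funD.
pose st x := \sum_(k < n) delta * \1_(A k) x - M.
have Hst x : st x <= h x <= st x + delta.
  have := @staircase_approx delta (h x + M) n d0.
  have := hM x; rewrite ler_norml => /andP[h1 h2].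
  have -> : 0 <= h x + M < delta * n.+1%:R.
    apply/andP; split; first lra.
    by apply: le_lt_trans Hn; lra.
  move=> /(_ isT) /=.
  rewrite /st (eq_bigr (fun k : 'I_n => delta * \1_(A k) x)); last first.
    move=> k _; rewrite indicE; case: ifPn => [hx|/negP hx].
      by rewrite mem_set ?mulr1.
    by rewrite memNset ?mulr0.
  lra.
have bA (Y : T -> R) k : measurable_fun setT Y -> bounded_mfun (\1_(A k) \o Y : T -> R).
  move=> mY; split; first by apply: measurableT_comp => //; exact: measurable_indic.
  by exists 1 => w /=; rewrite indicE; case: (_ \in _); rewrite ?normr1 ?normr0.
have bst (Y : T -> R) : measurable_fun setT Y -> bounded_mfun (st \o Y).
  move=> mY; apply: bmfD; last exact: bmf_cst.
  by apply: bmf_sum => k _; apply: bmfZ; exact: bA.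
have Est : mean P (fun w => st (X w) * V w) = c * mean P (st \o X0).
  have -> : (fun w => st (X w) * V w) = (fun w =>
      \sum_(k < n) delta * ((\1_(A k) \o X) w * V w) + (- M) * V w).
    apply/funext => w; rewrite /st mulrDl mulr_suml; congr (_ + _).
    by apply: eq_bigr => k _; rewrite mulrA.
  rewrite meanD; last 2 first.
    apply: bmf_sum => k _; apply: bmfZ; apply: bmfM => //; exact: bA.
    exact: bmfZ bV.
  rewrite mean_sum; last first.
    move=> k _; apply: bmfZ; apply: bmfM => //; exact: bA.
  rewrite /st /comp meanD; last 2 first.
    by apply: bmf_sum => k _; apply: bmfZ; exact: bA.
    exact: bmf_cst.
  rewrite mean_sum; last by move=> k _; apply: bmfZ; exact: bA.
  rewrite mulrDr mulr_sumr; congr (_ + _).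
    apply: eq_bigr => k _.
    rewrite !meanZ ?HA'//; [by rewrite mulrCA|exact: bA|].
    by apply: bmfM => //; exact: bA.
  rewrite meanZ// (_ : mean P (fun=> - M) = - M); last exact: mean_cst.
  have := HA' setT measurableT.
  rewrite (_ : (fun w => _) = V); last by apply/funext=> w; rewrite indicE in_setT mul1r.
  rewrite (_ : _ \o _ = cst 1); last by apply/funext=> w; rewrite /= indicE in_setT.
  by rewrite mean_cst mulr1 => ->; rewrite mulrC.
pose D1 w := (h (X w) - st (X w)) * V w.
pose D2 w := h (X0 w) - st (X0 w).
have bD (Y : T -> R) : measurable_fun setT Y -> bounded_mfun (fun w => h (Y w) - st (Y w)).
  move=> mY; have := bmfD (bh _ mY) (bmfZ (-1) (bst _ mY)).
  by under eq_fun do rewrite /= mulN1r.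
have bD1 : bounded_mfun D1 by apply: bmfM => //; exact: bD.
have bD2 : bounded_mfun D2 by exact: bD.
have -> : mean P (fun w => h (X w) * V w) = mean P D1 + mean P (fun w => st (X w) * V w).
  rewrite -meanD//; last by apply: bmfM => //; exact: bst.
  by congr mean; apply/funext => w; rewrite /D1 -mulrDl subrK.
have -> : mean P (h \o X0) = mean P D2 + mean P (st \o X0).
  rewrite -meanD//; last exact: bst.
  by congr mean; apply/funext => w; rewrite /D2 /= subrK.
rewrite Est mulrDr opprD addrACA subrr addr0.
have absD x : `|h x - st x| <= delta.
  by have /andP[h1 h2] := Hst x; rewrite ger0_norm; lra.
have B1 : `|mean P D1| <= delta * K.
  rewrite (le_trans (norm_mean_le P bD1))// -[leRHS](mean_cst P).
  apply: le_mean; [exact: bmf_abs|exact: bmf_cst|move=> w].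
  by rewrite normrM ler_pM.
have B2 : `|mean P D2| <= delta.
  rewrite (le_trans (norm_mean_le P bD2))// -[leRHS](mean_cst P).
  by apply: le_mean; [exact: bmf_abs|exact: bmf_cst|move=> w; exact: absD].
rewrite (le_trans (ler_normB _ _))// normrM.
apply: (@le_trans _ _ (delta * K + `|c| * delta)).
  by apply: lerD => //; apply: ler_wpM2l.
rewrite (_ : _ + _ = delta * (K + `|c|)); last by ring.
rewrite -[leRHS](divfK (lt0r_neq0 KC)) -/delta ler_pM2l//; lra.
Qed.

Variables (I : eqType) (X X0 : I -> T -> R).
Hypothesis mX : forall i, measurable_fun setT (X i).
Hypothesis mX0 : forall i, measurable_fun setT (X0 i).
Hypothesis indepX : forall (J : seq I) (A : I -> set R), uniq J ->
  (forall j, measurable (A j)) ->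
  fine (P (\big[setI/setT]_(j <- J) (X j @^-1` A j))) =
  \prod_(j <- J) fine (P (X0 j @^-1` A j)).

(** Independence is a statement about events, that is, about indicators. They
    are traded for arbitrary bounded functions one index at a time: [J1] lists
    the indices where this has been done, [J2] those that are still events. *)
Lemma mean_prod_indic (J1 J2 : seq I) (h : I -> R -> R) (A : I -> set R) :
  uniq (J1 ++ J2) -> (forall j, measurable (A j)) ->
  (forall j, measurable_fun setT (h j)) ->
  (forall j, exists M : R, forall x, `|h j x| <= M) ->
  mean P (fun w => (\prod_(j <- J1) h j (X j w)) * \prod_(j <- J2) \1_(A j) (X j w))
  = (\prod_(j <- J1) mean P (h j \o X0 j)) *
    \prod_(j <- J2) fine (P (X0 j @^-1` A j)).
Proof.
move=> + + mh bh; elim: J1 J2 A => [|j J1 IH] J2 A uJ mA.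
  rewrite big_nil mul1r -indepX// -mean_indic; last first.
    elim: J2 {uJ} => [|a J2 IH]; first by rewrite big_nil; exact: measurableT.
    rewrite big_cons; apply: measurableI => //.
    by rewrite -[X in measurable X]setTI; exact: mX.
  congr mean; apply/funext => w; rewrite big_nil mul1r.
  elim: J2 {uJ} => [|a J2 IH]; first by rewrite !big_nil indicE in_setT.
  rewrite !big_cons IH !indicE in_setI -natrM mulnb.
  congr ((_ && _)%:R); apply/idP/idP; rewrite !inE//.
have bX j' : bounded_mfun (fun w => h j' (X j' w)) by exact: bmf_comp.
have bI j' : bounded_mfun (fun w => \1_(A j') (X j' w)).
  rewrite -/(\1_(A j') \o X j' : T -> R); split.
    by apply: measurableT_comp => //; exact: measurable_indic.
  by exists 1 => w; rewrite indicE; case: (_ \in _); rewrite ?normr1 ?normr0.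
pose V w := (\prod_(j <- J1) h j (X j w)) * \prod_(j <- J2) \1_(A j) (X j w).
have bV : bounded_mfun V by apply: bmfM; exact: bmf_prod.
rewrite (_ : (fun w => _) = fun w => h j (X j w) * V w); last first.
  by apply/funext => w; rewrite big_cons mulrA.
rewrite big_cons -mulrA mulrC; apply: mean_ext_indic => // A0 mA0.
pose A' i := if i == j then A0 else A i.
have jJ2 : j \notin J2 by move: uJ => /= /andP[]; rewrite mem_cat negb_or => /andP[].
have := IH (j :: J2) A'.
rewrite -cat1s uniq_catCA cat1s => /(_ uJ).
have mA' i : measurable (A' i) by rewrite /A'; case: eqP.
have A'E i : i \in J2 -> A' i = A i.
  by rewrite /A'; case: eqP => // ->; rewrite (negbTE jJ2).
move=> /(_ mA'); rewrite [in RHS]big_cons {2}/A' eqxx.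
have -> : \prod_(j <- J2) fine (P (X0 j @^-1` A' j)) =
    \prod_(j <- J2) fine (P (X0 j @^-1` A j)).
  by apply: eq_big_seq => i iJ; rewrite A'E.
rewrite [RHS]mulrCA [in RHS]mulrC => <-.
congr mean; apply/funext => w; rewrite big_cons {1}/A' eqxx /V mulrCA.
by congr (_ * (_ * _)); apply: eq_big_seq => i iJ; rewrite A'E.
Qed.

Lemma mean_prod (J : seq I) (h : I -> R -> R) : uniq J ->
  (forall j, measurable_fun setT (h j)) ->
  (forall j, exists M : R, forall x, `|h j x| <= M) ->
  mean P (fun w => \prod_(j <- J) h j (X j w)) =
  \prod_(j <- J) mean P (h j \o X0 j).
Proof.
move=> uJ mh bh; have := @mean_prod_indic J [::] h (fun=> setT).
rewrite cats0 big_nil mulr1 => <- //.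
by congr mean; apply/funext => w; rewrite big_nil mulr1.
Qed.

End ProductRule.

Section IndependentFields.
Context d (T : measurableType d) (R : realType) (P : probability T R).
Variables (I : eqType) (X Y : I -> {RV P >-> R}) (X0 Y0 : {RV P >-> R}).
Hypothesis iidX : iid X X0.
Hypothesis iidY : iid Y Y0.
Hypothesis indXY : independent_families X Y.

Lemma sigma_of_family_bigI (V : I -> {RV P >-> R}) (J : seq I) (A : I -> set R) :
  (forall j, measurable (A j)) ->
  sigma_of_family V (\big[setI/setT]_(j <- J) (V j @^-1` A j)).
Proof.
move=> mA; pose G := \bigcup_(i in [set: I]) preimage_set_system setT (V i) measurable.
have : measurable (\big[setI/setT]_(j <- J) (V j @^-1` A j) : set (g_sigma_algebraType G)).
  elim: J => [|j J IH]; first by rewrite big_nil; exact: measurableT.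
  rewrite big_cons; apply: measurableI => //.
  apply: sub_sigma_algebra; exists j => //.
  by exists (A j) => //; rewrite setTI.
by [].
Qed.

Let lefts := pmap (fun k : I + I => if k is inl i then Some i else None).
Let rights := pmap (fun k : I + I => if k is inr i then Some i else None).

Let F (k : I + I) : T -> R := match k with inl i => X i | inr i => Y i end.
Let F0 (k : I + I) : T -> R := match k with inl i => X0 | inr i => Y0 end.

Let uniq_lefts J : uniq J -> uniq (lefts J).
Proof.
apply: (@pmap_uniq _ _ _ inl) => -[i|i] //=.
Qed.

Let uniq_rights J : uniq J -> uniq (rights J).
Proof.
apply: (@pmap_uniq _ _ _ inr) => -[i|i] //=.
Qed.

(** Independence of the two generated sigma-algebras glues the two families
    into a single mutually independent one, indexed by the disjoint sum. *)
Let joint_indep (J : seq (I + I)) (A : I + I -> set R) : uniq J ->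
  (forall j, measurable (A j)) ->
  fine (P (\big[setI/setT]_(j <- J) (F j @^-1` A j))) =
  \prod_(j <- J) fine (P (F0 j @^-1` A j)).
Proof.
move=> uJ mA.
have -> : \big[setI/setT]_(j <- J) (F j @^-1` A j) =
    (\big[setI/setT]_(i <- lefts J) (X i @^-1` A (inl i))) `&`
    (\big[setI/setT]_(i <- rights J) (Y i @^-1` A (inr i))).
  elim: J {uJ} => [|[i|i] J IH] /=; first by rewrite !big_nil setIT.
    by rewrite !big_cons IH setIA.
  by rewrite !big_cons IH setICA.
have -> : \prod_(j <- J) fine (P (F0 j @^-1` A j)) =
    (\prod_(i <- lefts J) fine (P (X0 @^-1` A (inl i)))) *
    (\prod_(i <- rights J) fine (P (Y0 @^-1` A (inr i)))).
  elim: J {uJ} => [|[i|i] J IH] /=; first by rewrite !big_nil mulr1.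
    by rewrite !big_cons IH mulrA.
  by rewrite !big_cons IH mulrCA.
rewrite indXY; [|exact: sigma_of_family_bigI..].
have prodE (V : I -> {RV P >-> R}) (V0 : {RV P >-> R}) (s : seq I) (B : I -> set R) :
    iid V V0 -> uniq s -> (forall j, measurable (B j)) ->
    P (\big[setI/setT]_(i <- s) (V i @^-1` B i)) =
    (\prod_(i <- s) fine (P (V0 @^-1` B i)))%:E.
  move=> [iV dV] us mB; rewrite iV//; elim: s {us} => [|j s IH]; first by rewrite !big_nil.
  rewrite !big_cons IH EFinM; congr (_ * _)%E.
  have := dV j (B j) (mB j); rewrite /distribution /pushforward => ->.
  by rewrite fineK// fin_num_measure// -[X in measurable X]setTI; exact: measurable_funP.
rewrite (prodE X X0)// ?uniq_lefts// (prodE Y Y0)// ?uniq_rights//.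
Qed.

Lemma mean_prod_fields (J : seq I) (f g : I -> R -> R) : uniq J ->
  (forall j, measurable_fun setT (f j)) -> (forall j, measurable_fun setT (g j)) ->
  (forall j, exists M : R, forall x, `|f j x| <= M) ->
  (forall j, exists M : R, forall x, `|g j x| <= M) ->
  mean P (fun w => \prod_(j <- J) (f j (X j w) * g j (Y j w))) =
  \prod_(j <- J) (mean P (f j \o X0) * mean P (g j \o Y0)).
Proof.
move=> uJ mf mg bf bg.
pose h (k : I + I) := match k with inl i => f i | inr i => g i end.
have mF k : measurable_fun setT (F k) by case: k => i /=; exact: measurable_funP.
have mF0 k : measurable_fun setT (F0 k) by case: k => i /=; exact: measurable_funP.
have := @mean_prod _ _ _ P _ F F0 mF mF0 joint_indep
  ([seq inl i | i <- J] ++ [seq inr i | i <- J]) h.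
rewrite cat_uniq !map_inj_uniq ?uJ; try by move=> ? ? [].
have -> : has (in_mem^~ (mem [seq inl i | i <- J])) [seq inr i | i <- J] = false.
  by apply/hasPn => _ /mapP[i _ ->]; apply/negP => /mapP[].
move=> /(_ isT); rewrite big_cat !big_map /=.
move=> joint; rewrite [RHS]big_split /= -joint; [|by case..].
by congr mean; apply/funext => w; rewrite big_cat !big_map big_split.
Qed.

End IndependentFields.

(** * Spectral and Frobenius norms *)
Section SpectralNorm.
Variable R : realType.
Implicit Types (m n p : nat) (c : R).

Definition sqnorm n (x : 'cV[R]_n) : R := \sum_i x i ord0 ^+ 2.

Definition frob2 m n (C : 'M[R]_(m, n)) : R := \sum_i \sum_j C i j ^+ 2.

Lemma sqnorm_ge0 n (x : 'cV[R]_n) : 0 <= sqnorm x.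
Proof. by apply: sumr_ge0 => i _; exact: sqr_ge0. Qed.

Lemma frob2_ge0 m n (C : 'M[R]_(m, n)) : 0 <= frob2 C.
Proof. by apply: sumr_ge0 => i _; apply: sumr_ge0 => j _; exact: sqr_ge0. Qed.

Lemma norm2_le n (x : 'cV[R]_n) c : 0 <= c -> (norm2 x <= c) = (sqnorm x <= c ^+ 2).
Proof.
move=> c0; rewrite -[in RHS](sqr_sqrtr (sqnorm_ge0 x)) -/(norm2 x).
by rewrite ler_sqr ?nnegrE// sqrtr_ge0.
Qed.

(** Expand the nonnegative sum of the squares of [B * a i - C * b i]. *)
Lemma cauchy_schwarz_sum n (a b : 'I_n -> R) :
  (\sum_i a i * b i) ^+ 2 <= (\sum_i a i ^+ 2) * \sum_i b i ^+ 2.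
Proof.
set A := \sum_i a i ^+ 2; set B := \sum_i b i ^+ 2; set C := \sum_i a i * b i.
have B0 : 0 <= B by apply: sumr_ge0 => i _; exact: sqr_ge0.
have [B00|Bn0] := eqVneq B 0.
  have b0 i : b i = 0.
    apply/eqP; rewrite -sqrf_eq0; apply/eqP.
    by have := psumr_eq0P (fun i _ => sqr_ge0 (b i)) B00; apply.
  by rewrite B00 mulr0 /C big1 ?expr0n// => i _; rewrite b0 mulr0.
have : 0 <= \sum_i (B * a i - C * b i) ^+ 2.
  by apply: sumr_ge0 => i _; exact: sqr_ge0.
rewrite (eq_bigr (fun i => B ^+ 2 * a i ^+ 2 +
   ((- (2 * B * C)) * (a i * b i) + C ^+ 2 * b i ^+ 2))); last by move=> i _; ring.
rewrite !big_split /= -!mulr_sumr -/A -/B -/C.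
rewrite (_ : _ + _ = B * (A * B - C ^+ 2)); last by ring.
by rewrite pmulr_rge0 ?subr_ge0// lt0r Bn0.
Qed.

Lemma sqnorm_mulmx_frob m n (C : 'M[R]_(m, n)) (x : 'cV[R]_n) :
  sqnorm (C *m x) <= frob2 C * sqnorm x.
Proof.
rewrite /sqnorm /frob2 mulr_suml; apply: ler_sum => i _.
by rewrite mxE; exact: cauchy_schwarz_sum.
Qed.

Lemma spectral_norm_le m n (C : 'M[R]_(m, n)) c : 0 <= c ->
  (forall x, sqnorm x <= 1 -> sqnorm (C *m x) <= c ^+ 2) -> spectral_norm C <= c.
Proof.
move=> c0 H; apply: ge_sup.
  exists (norm2 (C *m 0)); exists 0 => //=.
  by rewrite norm2_le// /sqnorm big1 ?expr1n ?ler01// => i _; rewrite mxE expr0n.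
move=> _ [x /= x1 <-]; rewrite norm2_le//; apply: H.
by move: x1; rewrite norm2_le// expr1n.
Qed.

Lemma spectral_norm_has_ubound m n (C : 'M[R]_(m, n)) :
  has_ubound [set norm2 (C *m x) | x in [set x : 'cV[R]_n | norm2 x <= 1]].
Proof.
exists (frob2 C + 1) => _ [y /= y1 <-].
have F0 := frob2_ge0 C.
rewrite norm2_le ?addr_ge0//; apply: (le_trans (sqnorm_mulmx_frob _ _)).
move: y1; rewrite norm2_le// expr1n => y1.
have := sqnorm_ge0 y; nra.
Qed.

Lemma sqnorm_le_spectral m n (C : 'M[R]_(m, n)) c x : spectral_norm C <= c ->
  0 <= c -> sqnorm x <= 1 -> sqnorm (C *m x) <= c ^+ 2.
Proof.
move=> Cc c0 x1; rewrite -norm2_le//; apply: le_trans Cc.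
apply: ub_le_sup; last by exists x => //=; rewrite norm2_le// expr1n.
exact: spectral_norm_has_ubound.
Qed.

Lemma spectral_norm_ge0 m n (C : 'M[R]_(m, n)) : 0 <= spectral_norm C.
Proof.
apply: (@le_trans _ _ (norm2 (C *m 0))); first exact: sqrtr_ge0.
apply: ub_le_sup; first exact: spectral_norm_has_ubound.
exists 0 => //=; rewrite norm2_le// /sqnorm big1 ?expr1n ?ler01// => i _.
by rewrite mxE expr0n.
Qed.

Lemma sqnormZ n (x : 'cV[R]_n) a : sqnorm (a *: x) = a ^+ 2 * sqnorm x.
Proof. by rewrite /sqnorm mulr_sumr; apply: eq_bigr => i _; rewrite mxE exprMn. Qed.

Lemma sqnorm_mulmx_le m n (C : 'M[R]_(m, n)) c :
  (forall x, sqnorm x <= 1 -> sqnorm (C *m x) <= c) ->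
  forall x, sqnorm (C *m x) <= c * sqnorm x.
Proof.
move=> H x; have [x0|xn0] := eqVneq (sqnorm x) 0.
  have -> : x = 0.
    apply/matrixP => i j; rewrite (ord1 j) mxE; apply/eqP; rewrite -sqrf_eq0; apply/eqP.
    exact: (psumr_eq0P (fun i _ => sqr_ge0 (x i ord0)) x0).
  by rewrite mulmx0 /sqnorm !big1 ?mulr0// => i _; rewrite mxE expr0n.
have xp : 0 < sqnorm x by rewrite lt0r xn0 sqnorm_ge0.
have sp : 0 < Num.sqrt (sqnorm x) by rewrite sqrtr_gt0.
have := H ((Num.sqrt (sqnorm x))^-1 *: x).
rewrite -scalemxAr !sqnormZ exprVn sqr_sqrtr ?sqnorm_ge0// mulVf// => /(_ (lexx _)).
by rewrite mulrC ler_pdivrMr.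
Qed.

Lemma mulmx_symmetric_sq p (M : 'M[R]_p) (x : 'cV[R]_p) : M^T = M ->
  sqnorm (M *m x) ^+ 2 <= sqnorm x * sqnorm (M ^+ 2 *m x).
Proof.
move=> symM.
have -> : sqnorm (M *m x) = \sum_i x i ord0 * (M ^+ 2 *m x) i ord0.
  have -> : sqnorm (M *m x) = ((M *m x)^T *m (M *m x)) ord0 ord0.
    by rewrite [RHS]mxE /sqnorm; apply: eq_bigr => i _; rewrite [in RHS]mxE expr2.
  rewrite trmx_mul symM -mulmxA mxE; apply: eq_bigr => i _.
  by rewrite mxE expr2 -mulmxE mulmxA.
exact: cauchy_schwarz_sum.
Qed.

Lemma trmxX p (M : 'M[R]_p) k : M^T = M -> (M ^+ k)^T = M ^+ k.
Proof.
move=> symM; elim: k => [|k IH]; first by rewrite expr0; exact: trmx1.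
by rewrite [in LHS]exprS -[in LHS]mulmxE trmx_mul symM IH mulmxE -exprSr.
Qed.

(** For a symmetric matrix and a vector [x] of the unit ball, [|M x|^2] is the
    scalar product of [x] and [M^2 x], hence at most [|M^2 x|]. Iterating
    squares the matrix at each step, and only the last power has to be
    compared with its Frobenius norm. This plays the role of the spectral
    theorem. *)
Lemma sqnorm_pow2_le_frob p (M : 'M[R]_p) (x : 'cV[R]_p) r : M^T = M ->
  sqnorm x <= 1 -> sqnorm (M *m x) ^+ (2 ^ r) <= frob2 (M ^+ (2 ^ r)).
Proof.
move=> + x1; elim: r M => [|r IH] M symM.
  rewrite expn0 !expr1; apply: (le_trans (sqnorm_mulmx_frob _ _)).
  by rewrite ler_piMr// frob2_ge0.
rewrite expnS !exprM; apply: le_trans (IH (M ^+ 2) (trmxX _ symM)).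
rewrite lerXn2r ?nnegrE ?sqnorm_ge0 ?exprn_ge0 ?sqnorm_ge0//.
apply: (le_trans (mulmx_symmetric_sq _ symM)).
by rewrite ler_piMl// sqnorm_ge0.
Qed.

Lemma frob2_pow_le p (M : 'M[R]_p) c k :
  (forall x, sqnorm x <= 1 -> sqnorm (M *m x) <= c) -> 0 <= c ->
  frob2 (M ^+ k) <= p%:R * c ^+ k.
Proof.
move=> H c0.
have Hk x : sqnorm (M ^+ k *m x) <= c ^+ k * sqnorm x.
  elim: k x => [|k IH] x; first by rewrite !expr0 mul1mx mul1r.
  rewrite exprSr -mulmxE -mulmxA (le_trans (IH _))// exprSr -mulrA ler_wpM2l ?exprn_ge0//.
  exact: sqnorm_mulmx_le.
rewrite /frob2 exchange_big /= -[p in p%:R]card_ord mulr_natl -sumr_const.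
apply: ler_sum => j _.
have := Hk (delta_mx j ord0).
rewrite -colE {2}/sqnorm (bigD1 j)//= big1 ?addr0.
  rewrite mxE !eqxx expr1n mulr1; apply: le_trans.
  by apply: ler_sum => i _; rewrite mxE.
by move=> i ij; rewrite mxE (negbTE ij) expr0n.
Qed.

(** A constant factor is invisible to arbitrarily high powers. *)
Lemma le_of_pow2_le (y c a : R) : 0 <= y -> 0 <= c ->
  (forall r, y ^+ (2 ^ r) <= a * c ^+ (2 ^ r)) -> y <= c.
Proof.
move=> y0 c0 H; rewrite leNgt; apply/negP => cy.
have [c00|cn0] := eqVneq c 0.
  by have := H 0%N; rewrite expn0 !expr1 c00 mulr0; lra.
have cp : 0 < c by rewrite lt0r cn0.
pose z := y / c - 1.
have z0 : 0 < z by rewrite subr_gt0 ltr_pdivlMr// mul1r.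
have Hz k : 1 + k%:R * z <= (1 + z) ^+ k.
  elim: k => [|k IH]; first by rewrite mul0r addr0 expr0.
  rewrite exprS -natr1; have kz : 0 <= k%:R * z by rewrite mulr_ge0// ltW.
  nra.
pose r := (Num.truncn (a / z)).+1.
have rlt : a / z < r%:R by rewrite truncnS_gt.
have : (1 + z) ^+ (2 ^ r) <= a.
  by rewrite addrC subrK expr_div_n ler_pdivrMr ?exprn_gt0.
have := Hz (2 ^ r)%N.
have : (r%:R : R) <= (2 ^ r)%:R by rewrite ler_nat ltnW// ltn_expl.
move: rlt; rewrite ltr_pdivrMr//.
set K : R := (2 ^ r)%:R.
nra.
Qed.

(** A condition on a supremum over an uncountable ball becomes a countable union
    of polynomial conditions on the entries of the matrix, which is what makes
    the events about the norm of a random matrix measurable. *)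
Lemma spectral_norm_gtP p (M : 'M[R]_p) c : M^T = M -> 0 <= c ->
  (c < spectral_norm M) <->
  exists r, p%:R * (c ^+ 2) ^+ (2 ^ r) < frob2 (M ^+ (2 ^ r)).
Proof.
move=> symM c0; split => [|[r]]; last first.
  rewrite !ltNge; apply: contra => Mc; apply: frob2_pow_le; last exact: sqr_ge0.
  by move=> x x1; exact: sqnorm_le_spectral.
move=> cM; apply: contrapT => /forallNP H.
move: cM; rewrite ltNge => /negP; apply; apply: spectral_norm_le => // x x1.
apply: (@le_of_pow2_le _ _ p%:R); rewrite ?sqnorm_ge0 ?sqr_ge0// => r.
apply: (le_trans (sqnorm_pow2_le_frob r symM x1)).
by rewrite leNgt; apply/negP.
Qed.

Lemma sqnormD4 n (a b c e : 'cV[R]_n) :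
  sqnorm (a + b + c + e) <= 4 * (sqnorm a + sqnorm b + sqnorm c + sqnorm e).
Proof.
rewrite /sqnorm -!big_split mulr_sumr; apply: ler_sum => i _ /=; rewrite !mxE.
set x := a _ _; set y := b _ _; set z := c _ _; set w := e _ _.
have := sqr_ge0 (x - y); have := sqr_ge0 (z - w); have := sqr_ge0 (x + y - z - w).
rewrite !expr2; nra.
Qed.

Lemma spectral_norm_add4 p (M0 M1 M2 M3 : 'M[R]_p) c r : 0 <= c -> M0^T = M0 ->
  frob2 (M0 ^+ (2 ^ r)) <= (c ^+ 2) ^+ (2 ^ r) ->
  frob2 M1 <= c ^+ 2 -> frob2 M2 <= c ^+ 2 -> frob2 M3 <= c ^+ 2 ->
  spectral_norm (M0 + M1 + M2 + M3) <= 4 * c.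
Proof.
move=> c0 sym0 H0 H1 H2 H3; apply: spectral_norm_le => [|x x1]; first by rewrite mulr_ge0.
rewrite !mulmxDl; apply: (le_trans (sqnormD4 _ _ _ _)).
have F (M : 'M[R]_p) : frob2 M <= c ^+ 2 -> sqnorm (M *m x) <= c ^+ 2.
  move=> Mc; apply: le_trans Mc; apply: (le_trans (sqnorm_mulmx_frob _ _)).
  by rewrite ler_piMr// frob2_ge0.
have := F _ H1; have := F _ H2; have := F _ H3.
have : sqnorm (M0 *m x) <= c ^+ 2.
  rewrite -(@ler_pXn2r _ (2 ^ r)) ?nnegrE ?sqnorm_ge0 ?sqr_ge0 ?expn_gt0//.
  exact: le_trans (sqnorm_pow2_le_frob r sym0 x1) H0.
by rewrite exprMn; lra.
Qed.

Lemma frob2_pow_trace p (M : 'M[R]_p) k : M^T = M ->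
  frob2 (M ^+ k) = \tr (M ^+ (k + k)).
Proof.
move=> symM; rewrite exprD /mxtrace; apply: eq_bigr => i _.
rewrite -mulmxE mxE; apply: eq_bigr => j _.
by rewrite expr2 -{2}(trmxX k symM) mxE.
Qed.

End SpectralNorm.

(** * Off-diagonal part and trace moments *)
Section OffDiagonal.
Variable R : realType.

Definition off p (S : 'M[R]_p) : 'M[R]_p := S - diag_of S.

Lemma offE p (S : 'M[R]_p) i j : off S i j = if i == j then 0 else S i j.
Proof. by rewrite !mxE; case: eqP => [->|_]; rewrite ?mulr1n ?subrr// mulr0n subr0. Qed.

Lemma off_gramE p n (X : 'M[R]_(p, n)) i j :
  off (sample_cov X) i j = if i == j then 0 else \sum_t X i t * X j t.
Proof.
by rewrite offE mxE; case: eqP => // _; apply: eq_bigr => t _; rewrite mxE.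
Qed.

Lemma off_gram_sym p n (X : 'M[R]_(p, n)) :
  (off (sample_cov X))^T = off (sample_cov X).
Proof.
apply/matrixP => i j; rewrite mxE !off_gramE eq_sym; case: eqP => // _.
by apply: eq_bigr => t _; rewrite mulrC.
Qed.

End OffDiagonal.

(** Independence enters only through the product rule for moments, so that the
    bound applies to any field of bounded entries that satisfies it. *)
Section TraceMoments.
Context d (T : measurableType d) (R : realType) (P : probability T R).
Variables (p n : nat) (Y : nat * nat -> T -> R) (mu : nat -> R) (D G : R).
Hypothesis bY : forall e, bounded_mfun (Y e).
Hypothesis prodY : forall (J : seq (nat * nat)) (k : nat * nat -> nat),
  uniq J -> mean P (fun w => \prod_(e <- J) Y e w ^+ k e) = \prod_(e <- J) mu (k e).
Hypothesis p0 : (0 < p)%N.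
Hypothesis D0 : 0 <= D.
Hypothesis pD : p%:R <= D.
Hypothesis npD : n%:R * p%:R <= D ^+ 2.
Hypothesis G0 : 0 <= G.

Let M w := off (sample_cov (\matrix_(i < p, t < n) Y (i : nat, t : nat) w)).

Let D1 : 1 <= D.
Proof. by apply: le_trans pD; rewrite ler1n. Qed.

Let Dgt0 : 0 < D. Proof. exact: lt_le_trans ltr01 D1. Qed.

Let bM k i j : bounded_mfun (fun w => (M w ^+ k) i j).
Proof.
elim: k i j => [|k IH] i j.
  by under eq_fun do rewrite expr0 mxE; exact: bmf_cst.
have -> : (fun w => (M w ^+ k.+1) i j) = fun w => \sum_x M w i x * (M w ^+ k) x j.
  by apply/funext => w; rewrite exprS -mulmxE mxE.
apply: bmf_sum => x _; apply: bmfM => //.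
rewrite (_ : (fun w => _) = fun w =>
   if i == x then 0 else \sum_(t < n) Y (i : nat, t : nat) w * Y (x : nat, t : nat) w).
  by case: eqP => _; [exact: bmf_cst|apply: bmf_sum => t _; exact: bmfM].
apply/funext => w; rewrite off_gramE; case: eqP => // _.
by apply: eq_bigr => t _; rewrite !mxE.
Qed.

Lemma sum_ord_mem_le (s : seq nat) (N : nat) :
  \sum_(t < N) (if val t \in s then 1 else 0 : R) <= (size s)%:R.
Proof.
rewrite -big_mkcond /= sumr_const /= ler_nat cardE.
rewrite -(size_map val); apply: uniq_leq_size.
  by rewrite map_inj_uniq ?enum_uniq//; exact: val_inj.
by move=> _ /mapP[t + ->]; rewrite mem_enum.
Qed.

(** Two steps [i -> t -> x] of a walk that has used the edges [w]. An edge seen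
    for the first time costs [D^-1]. If the column [t] is new, then both edges
    are new, since [x != i], and the [n p] choices are paid by [D^-2]. If [t]
    is one of the at most [c] old columns and the row [x] is new, the edge from
    [t] to [x] is new and the [p] choices are paid by [D^-1]. Otherwise there
    are at most [c^2] choices. In total [1 + c + c^2], at most [(c + 1)^2]. *)
Lemma walk_step_sum (c : nat) (w : seq (nat * nat)) (i : 'I_p) :
  (size w <= c)%N ->
  \sum_(x < p | x != i) \sum_(t < n)
    D ^- size (undup [:: (i : nat, t : nat), (x : nat, t : nat) & w]) <=
  (c.+1%:R) ^+ 2 * D ^- size (undup w).
Proof.
move=> wc.
pose rows := map fst w; pose cols := map snd w.
pose chi (s : seq nat) (t : nat) : R := if t \in s then 1 else 0.
have chi0 s t : 0 <= chi s t by rewrite /chi; case: ifP.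
have Dk k : 0 < D ^- k by rewrite invr_gt0 exprn_gt0.
have Di : D^-1 <= 1 by rewrite invf_le1.
have Di0 : 0 < D^-1 by rewrite invr_gt0.
have step (x : 'I_p) (t : 'I_n) : x != i ->
    D ^- size (undup [:: (i : nat, t : nat), (x : nat, t : nat) & w]) <=
    (D ^- 2 + chi cols t * D^-1 + chi cols t * chi rows x) * D ^- size (undup w).
  move=> xi.
  have inw (y : nat) : (y, t : nat) \in w -> (y \in rows) && (val t \in cols).
    by move=> yw; apply/andP; split; apply/mapP; exists (y, t : nat).
  have -> : undup [:: (i : nat, t : nat), (x : nat, t : nat) & w] =
      if (i : nat, t : nat) \in w then undup ((x : nat, t : nat) :: w)
      else (i : nat, t : nat) :: undup ((x : nat, t : nat) :: w).
    by rewrite /= inE xpair_eqE eqxx andbT -val_eqE /= in xi *; rewrite eq_sym (negbTE xi).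
  rewrite /chi -!exprVn.
  case: ifP => [iw|iw]; rewrite [undup (_ :: w)]/=; case: ifP => [xw|xw].
  - have /andP[-> _] := inw _ xw; have /andP[_ ->] := inw _ iw.
    by rewrite !mul1r ler_peMl ?exprn_ge0 ?ltW//; have := sqr_ge0 D^-1; lra.
  - have /andP[_ ->] := inw _ iw; rewrite [leLHS]/= [leLHS]exprS mul1r.
    apply: ler_wpM2r; first by rewrite exprn_ge0 ?ltW.
    by have := sqr_ge0 D^-1; case: ifP => _; lra.
  - have /andP[-> ->] := inw _ xw; rewrite [leLHS]/= [leLHS]exprS mul1r.
    apply: ler_wpM2r; first by rewrite exprn_ge0 ?ltW.
    by have := sqr_ge0 D^-1; lra.
  - rewrite [leLHS]/= [leLHS]exprS [X in _ * X]exprS mulrA -expr2; apply: ler_wpM2r; first by rewrite exprn_ge0 ?ltW.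
    by case: ifP => _; case: ifP => _; lra.
apply: (@le_trans _ _ (\sum_(x < p) \sum_(t < n)
    (D ^- 2 + chi cols t * D^-1 + chi cols t * chi rows x) * D ^- size (undup w))).
  rewrite [leRHS](bigID (fun x => x != i))/= -[leLHS]addr0; apply: lerD.
    by apply: ler_sum => x xi; apply: ler_sum => t _; exact: step.
  apply: sumr_ge0 => x _; apply: sumr_ge0 => t _; apply: mulr_ge0; last exact: ltW.
  by rewrite !addr_ge0 ?mulr_ge0// ltW.
under eq_bigr do rewrite -mulr_suml.
rewrite -mulr_suml; apply: ler_wpM2r; first exact: ltW.
have c1E : c.+1%:R = c%:R + 1 :> R by rewrite natr1.
rewrite c1E.
have Scols : \sum_(t < n) chi cols t <= c%:R.
  by rewrite (le_trans (sum_ord_mem_le _ _))// size_map ler_nat.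
have Srows : \sum_(x < p) chi rows x <= c%:R.
  by rewrite (le_trans (sum_ord_mem_le _ _))// size_map ler_nat.
under eq_bigr do rewrite !big_split /= -!mulr_suml sumr_const card_ord.
rewrite !big_split /= !sumr_const card_ord -mulr_sumr -mulrnA.
set C := \sum_(t < n) chi cols t in Scols *.
set Q := \sum_(x < p) chi rows x in Srows *.
rewrite -(mulr_natr (D ^- 2)) natrM -(mulr_natr (C / D)).
have C0 : 0 <= C by apply: sumr_ge0.
have Q0 : 0 <= Q by apply: sumr_ge0.
have CQ : C * Q <= c%:R * c%:R by apply: ler_pM.
have X1 : D ^- 2 * (n%:R * p%:R) <= 1 by rewrite mulrC ler_pdivrMr ?exprn_gt0// mul1r.
have X2 : D^-1 * p%:R <= 1 by rewrite mulrC ler_pdivrMr// mul1r.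
have X3 : C * D^-1 * p%:R <= c%:R.
  by rewrite -mulrA -[leRHS]mulr1; apply: ler_pM => //; apply: mulr_ge0 => //; exact: ltW.
have : 0 <= c%:R :> R by [].
rewrite expr2; nra.
Qed.

(** Expanding a power of the off-diagonal Gram matrix gives a sum over walks
    alternating between rows and columns. The first two edges of the walk are
    peeled off and stored in [w]; once the walk is exhausted, independence
    turns the mean of the product over [w] into one moment per distinct edge,
    and each of them costs [D^-1]. The number of ways of choosing the next two
    edges is compensated by these factors, so the walks are never counted
    globally. *)
Lemma walk_moment (c h : nat) (w : seq (nat * nat)) (i j : 'I_p) :
  (forall k, (0 < k <= c)%N -> D * `|mu k| <= G ^+ k) ->
  (size w + h.*2 <= c)%N ->
  `|mean P (fun om => (\prod_(e <- w) Y e om) * (M om ^+ h) i j)| <=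
  G ^+ (size w + h.*2) * D ^- size (undup w) * ((c.+1%:R) ^+ 2) ^+ h.
Proof.
move=> muG; elim: h w i => [|h IH] w i.
  rewrite addn0 expr0 mulr1 => wc.
  have bw : bounded_mfun (fun om => \prod_(e <- w) Y e om) by exact: bmf_prod.
  apply: (@le_trans _ _ `|mean P (fun om => \prod_(e <- w) Y e om)|).
    rewrite (_ : (fun om => _) = fun om => (i == j)%:R * \prod_(e <- w) Y e om).
      by rewrite meanZ// normrM ler_piMl//; case: eqP; rewrite ?normr1 ?normr0.
    by apply/funext => om; rewrite expr0 mxE mulrC.
  rewrite (_ : (fun om => _) =
      fun om => \prod_(e <- undup w) Y e om ^+ count_mem e w); last first.
    by apply/funext => om; rewrite -big_undup_iterop_count.
  rewrite prodY ?undup_uniq// normr_prod.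
  have -> : G ^+ size w = \prod_(e <- undup w) G ^+ count_mem e w.
    by rewrite big_undup_iterop_count big_const_seq count_predT iter_mulr_1.
  have -> : D ^- size (undup w) = \prod_(e <- undup w) D^-1.
    by rewrite big_const_seq count_predT iter_mulr_1 exprVn.
  rewrite -big_split /= big_seq [leRHS]big_seq; apply: ler_prod => e.
  rewrite mem_undup => ew; rewrite normr_ge0 /= ler_pdivlMr// mulrC muG//.
  by rewrite -has_count has_pred1 ew /= (leq_trans (count_size _ _)).
rewrite doubleS => wc.
have wc1 : (size w <= c)%N by rewrite (leq_trans _ wc)// leq_addr.
pose edge (x : 'I_p) (t : 'I_n) := [:: (i : nat, t : nat), (x : nat, t : nat) & w].
rewrite (_ : (fun om => _) = fun om => \sum_(x < p | x != i) \sum_(t < n)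
    (\prod_(e <- edge x t) Y e om) * (M om ^+ h) x j); last first.
  apply/funext => om; rewrite exprS -mulmxE mxE mulr_sumr (bigID (fun x => x != i)) /=.
  rewrite [X in _ + X]big1 ?addr0; last first.
    by move=> x; rewrite negbK => /eqP ->; rewrite off_gramE eqxx mul0r mulr0.
  apply: eq_bigr => x xi; rewrite off_gramE eq_sym (negbTE xi) mulr_suml mulr_sumr.
  by apply: eq_bigr => t _; rewrite !mxE !big_cons; ring.
have bterm x t : bounded_mfun (fun om => (\prod_(e <- edge x t) Y e om) * (M om ^+ h) x j).
  by apply: bmfM => //; exact: bmf_prod.
rewrite mean_sum; last by move=> x _; apply: bmf_sum.
under eq_bigr do rewrite mean_sum//.
rewrite (le_trans (ler_norm_sum _ _ _))//.
apply: (@le_trans _ _ (\sum_(x < p | x != i) \sum_(t < n)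
   G ^+ (size w + h.*2.+2) * ((c.+1%:R) ^+ 2) ^+ h * D ^- size (undup (edge x t)))).
  apply: ler_sum => x xi; rewrite (le_trans (ler_norm_sum _ _ _))//.
  apply: ler_sum => t _; have := IH (edge x t) x.
  by rewrite /= !addSn -!addnS => /(_ wc); rewrite mulrAC.
under eq_bigr do rewrite -mulr_sumr.
rewrite -mulr_sumr.
have := walk_step_sum i wc1; set S := (X in X <= _) => HS.
rewrite [leRHS](_ : _ = G ^+ (size w + h.*2.+2) * (c.+1%:R ^+ 2) ^+ h *
   (c.+1%:R ^+ 2 * D ^- size (undup w))); last by rewrite exprS; ring.
by apply: ler_wpM2l => //; rewrite mulr_ge0 ?exprn_ge0.
Qed.

Lemma mean_trace_pow (h : nat) :
  (forall k, (0 < k <= h.*2)%N -> D * `|mu k| <= G ^+ k) ->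
  mean P (fun om => \tr (M om ^+ h)) <=
  p%:R * (G ^+ h.*2 * ((h.*2.+1%:R) ^+ 2) ^+ h).
Proof.
move=> muG; rewrite mean_sum//.
rewrite -[p in p%:R]card_ord mulr_natl -sumr_const; apply: ler_sum => i _.
have := @walk_moment h.*2 h [::] i i muG (leqnn _).
rewrite /= expr0 invr1 mulr1; apply: le_trans.
rewrite (_ : (fun om => \prod_(e <- [::]) _ * _) = fun om => (M om ^+ h) i i).
  exact: ler_norm.
by apply/funext => om; rewrite big_nil mul1r.
Qed.

Lemma bmf_trace_pow h : bounded_mfun (fun om => \tr (M om ^+ h)).
Proof. by apply: bmf_sum. Qed.

End TraceMoments.

(** * Cross terms between two matrices of entries *)
Section CrossTerms.
Variable R : realType.

Definition cross p n (A C : 'M[R]_(p, n)) : 'M[R]_p := off (A *m C^T).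

Lemma crossE p n (A C : 'M[R]_(p, n)) i j :
  cross A C i j = if i == j then 0 else \sum_t A i t * C j t.
Proof.
by rewrite offE mxE; case: eqP => // _; apply: eq_bigr => t _; rewrite mxE.
Qed.

Lemma cross_trmx p n (A C : 'M[R]_(p, n)) : (cross A C)^T = cross C A.
Proof.
apply/matrixP => i j; rewrite mxE !crossE eq_sym; case: eqP => // _.
by apply: eq_bigr => t _; rewrite mulrC.
Qed.

Lemma frob2_trmx p (C : 'M[R]_p) : frob2 C^T = frob2 C.
Proof.
by rewrite /frob2 exchange_big; apply: eq_bigr => i _; apply: eq_bigr => j _; rewrite mxE.
Qed.

Lemma offD p (S S' : 'M[R]_p) : off (S + S') = off S + off S'.
Proof.
by apply/matrixP => i j; rewrite [RHS]mxE !offE mxE; case: eqP => _; rewrite ?addr0.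
Qed.

Lemma off_gramD p n (A C : 'M[R]_(p, n)) :
  off (sample_cov (C + A)) =
  off (sample_cov C) + cross A C + cross C A + off (sample_cov A).
Proof.
rewrite /cross -!offD /sample_cov linearD /= mulmxDl !mulmxDr.
by congr off; rewrite -!addrA; congr (_ + _); rewrite addrCA.
Qed.

End CrossTerms.

Section CrossMoments.
Context d (T : measurableType d) (R : realType) (P : probability T R).
Variables (p n : nat) (A C : nat * nat -> T -> R) (m : nat -> nat -> R).
Hypothesis bA : forall e, bounded_mfun (A e).
Hypothesis bC : forall e, bounded_mfun (C e).
Hypothesis prodAC : forall (J : seq (nat * nat)) (k l : nat * nat -> nat),
  uniq J -> mean P (fun w => \prod_(e <- J) (A e w ^+ k e * C e w ^+ l e)) =
            \prod_(e <- J) m (k e) (l e).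

Let mat (Y : nat * nat -> T -> R) w : 'M[R]_(p, n) :=
  \matrix_(i < p, t < n) Y (i : nat, t : nat) w.

Let term i j (t t' : nat) w : R :=
  A (i, t) w * C (j, t) w * (A (i, t') w * C (j, t') w).

Let bterm i j t t' : bounded_mfun (term i j t t').
Proof. by apply: bmfM; apply: bmfM. Qed.

Let mean_term_same i j t : i != j ->
  mean P (term i j t t) = m 2 0 * m 0 2.
Proof.
move=> ij.
have E (a b a' b' : nat) : ((a, b) == (a', b')) = (a == a') && (b == b') by [].
have ji : (j == i) = false by rewrite eq_sym (negbTE ij).
have := @prodAC [:: (i, t); (j, t)] (fun e => (e.1 == i).*2) (fun e => (e.1 == j).*2).
rewrite /= !inE !E !eqxx (negbTE ij) => /(_ isT).
rewrite !big_cons !big_nil /= !eqxx (negbTE ij) ji mulr1 => <-.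
congr mean; apply/funext => w; rewrite !big_cons big_nil /= !eqxx (negbTE ij) ji.
by rewrite /term /= ?expr0; ring.
Qed.

Let mean_term_diff i j t t' : i != j -> t != t' ->
  mean P (term i j t t') = m 1 0 ^+ 2 * m 0 1 ^+ 2.
Proof.
move=> ij tt'.
have E (a b a' b' : nat) : ((a, b) == (a', b')) = (a == a') && (b == b') by [].
have := @prodAC [:: (i, t); (j, t); (i, t'); (j, t')] (fun e => e.1 == i)
  (fun e => e.1 == j).
have ji : (j == i) = false by rewrite eq_sym (negbTE ij).
rewrite /= !inE !E !eqxx (negbTE ij) (negbTE tt') ji /= => /(_ isT).
rewrite !big_cons !big_nil /= !eqxx (negbTE ij) ji mulr1.
rewrite (_ : m _ _ * _ = m 1 0 ^+ 2 * m 0 1 ^+ 2); last by rewrite /=; ring.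
move=> <-; congr mean; apply/funext => w.
rewrite !big_cons big_nil /= !eqxx (negbTE ij) ji /term /= ?expr0 ?expr1; ring.
Qed.

Lemma bmf_frob2_cross :
  bounded_mfun (fun w => frob2 (cross (mat A w) (mat C w))).
Proof.
apply: bmf_sum => i _; apply: bmf_sum => j _; apply: bmfX.
rewrite (_ : (fun w => _) = fun w => if i == j then 0 else
   \sum_(t < n) A (i : nat, t : nat) w * C (j : nat, t : nat) w).
  by case: eqP => _; [exact: bmf_cst|apply: bmf_sum => t _; exact: bmfM].
apply/funext => w; rewrite crossE; case: eqP => // _.
by apply: eq_bigr => t _; rewrite !mxE.
Qed.

(** In the square of an off-diagonal entry the factors taken from [A] and those
    taken from [C] lie in different rows. For two equal columns this leaves two
    positions, each carrying a second moment; for two different columns it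
    leaves four positions, each carrying a first moment. *)
Lemma mean_frob2_cross : 0 <= m 2 0 -> 0 <= m 0 2 ->
  mean P (fun w => frob2 (cross (mat A w) (mat C w))) <=
  p%:R ^+ 2 * (n%:R * (m 2 0 * m 0 2) + n%:R ^+ 2 * (m 1 0 ^+ 2 * m 0 1 ^+ 2)).
Proof.
move=> m20 m02.
have S0 : 0 <= m 1 0 ^+ 2 * m 0 1 ^+ 2 by rewrite mulr_ge0 ?sqr_ge0.
rewrite (_ : (fun w => _) = fun w => \sum_(i < p) \sum_(j < p | j != i)
   \sum_(t < n) \sum_(t' < n) term i j t t' w); last first.
  apply/funext => w; apply: eq_bigr => i _.
  rewrite (bigID (fun j => j != i)) /= [X in _ + X]big1 ?addr0; last first.
    by move=> j; rewrite negbK => /eqP ->; rewrite crossE eqxx expr0n.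
  apply: eq_bigr => j ji; rewrite crossE eq_sym (negbTE ji) expr2 mulr_suml.
  apply: eq_bigr => t _; rewrite mulr_sumr; apply: eq_bigr => t' _.
  by rewrite !mxE.
rewrite mean_sum; last by move=> i _; do 3 apply: bmf_sum => ? _.
set B := (X in _ <= _ * X).
apply: (@le_trans _ _ (\sum_(i < p) \sum_(j < p) B)); last first.
  by rewrite !sumr_const !card_ord -mulrnA -(mulr_natl B) natrM expr2.
have B0 : 0 <= B by apply: addr_ge0; apply: mulr_ge0 => //; exact: mulr_ge0.
apply: ler_sum => i _; rewrite [leRHS](bigID (fun j => j != i)) /= -[leLHS]addr0.
apply: lerD; last by apply: sumr_ge0.
rewrite mean_sum; last by move=> j _; do 2 apply: bmf_sum => ? _.
apply: ler_sum => j ji; rewrite mean_sum; last by move=> t _; apply: bmf_sum.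
apply: (@le_trans _ _ (\sum_(t < n)
    (m 2 0 * m 0 2 + n%:R * (m 1 0 ^+ 2 * m 0 1 ^+ 2)))); last first.
  by rewrite sumr_const card_ord -[leLHS]mulr_natl /B mulrDr [n%:R * (n%:R * _)]mulrA -expr2.
apply: ler_sum => t _; rewrite mean_sum// (bigD1 t)//=; apply: lerD.
  by rewrite mean_term_same// eq_sym.
rewrite mulr_natl -[n in leRHS]card_ord -sumr_const [leRHS](bigD1 t)//= -[leLHS]add0r.
apply: lerD => //; apply: ler_sum => t' tt'.
by rewrite mean_term_diff// eq_sym.
Qed.

End CrossMoments.

(** * Slow variation *)
Section SlowVariation.
Variable R : realType.
Let mu := @lebesgue_measure R.

Lemma lebesgue_measure_shift (u : R) (A : set R) : measurable A ->
  mu ((fun v => v + u) @^-1` A) = mu A.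
Proof.
move=> mA; have mu_shift : measurable_fun setT (fun v : R => v + u).
  exact: measurable_funD.
transitivity (pushforward mu ((fun v => v + u) : _ -> measurableTypeR R) A) => //.
apply/esym/lebesgue_measure_unique => //= _ [[a b]] _ <-.
rewrite /pushforward.
have -> : (fun v => v + u) @^-1` `]a, b]%classic = `]a - u, b - u]%classic.
  by apply/seteqP; split => v /=; rewrite !in_itv /= => /andP[? ?]; apply/andP; split; lra.
rewrite /mu !lebesgue_measure_itv /= !lte_fin ltrD2r.
by case: ifP => // _; rewrite -!EFinB; congr EFin; ring.
Qed.

(** In the variable [ln x] slow variation says that the increments of [f] over a
    fixed step tend to zero. For a measurable [f] this convergence is uniform
    over steps in [[0, 1]], which makes [f] sublinear. *)
Section UniformShift.
Variables (f : R -> R).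
Hypothesis mf : measurable_fun setT f.
Hypothesis shift_f : forall u e : R, 0 < e ->
  exists B : R, forall x : R, B <= x -> `|f (x + u) - f x| <= e.

Let E (e x : R) := [set v | (0 <= v <= 2) && (e < `|f (x + v) - f x|)].

Let mE e x : measurable (E e x).
Proof.
have -> : E e x = `[0, 2]%classic `&` [set v | e < `|f (x + v) - f x|].
  by apply/seteqP; split => v /=; rewrite in_itv /= => /andP.
apply: measurableI => //.
rewrite -[X in measurable X]setTI; apply: measurable_fun_ltr => //.
apply: measurableT_comp => //; apply: measurable_funB => //.
by apply: measurableT_comp => //; exact: measurable_funD.
Qed.

(** Along any sequence of [x] tending to infinity the indicator of the
    exceptional set vanishes pointwise; dominated convergence applies. *)
Let small_exceptional_set (e : R) : 0 < e ->
  exists X, forall x, X <= x -> (mu (E e x) < (2^-1)%:E)%E.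
Proof.
move=> e0; apply: contrapT => /forallNP noX.
have /choice[x xP] : forall k : nat, exists x, k%:R <= x /\ ((2^-1)%:E <= mu (E e x))%E.
  move=> k; apply: contrapT => /forallNP H; apply: (noX k%:R) => x kx.
  by rewrite ltNge; apply/negP => h; apply: (H x).
have m02 : measurable (`[0, 2]%classic : set R) by [].
have [||||| _ _] := @dominated_convergence _ _ _ mu `[0, 2]%classic m02
  (fun k v => (\1_(E e (x k)) v)%:E) (cst 0%E) (cst 1%E).
- by move=> k; apply/measurable_EFinP; apply: measurable_indic; exact: mE.
- exact: measurable_cst.
- apply: aeW => v _; apply: cvg_near_cst.
  have [B HB] := shift_f v e0.
  exists (Num.truncn B).+1 => // k /= Bk; rewrite indicE memNset//= => /andP[_].
  rewrite ltNge HB//; case: (xP k) => kx _; apply: le_trans kx.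
  by rewrite (le_trans (ltW (truncnS_gt _)))// ler_nat.
- apply: measurable_bounded_integrable => //=.
    by rewrite /mu lebesgue_measure_itv /= lte_fin ltr0n -EFinB ltry.
  by exists 1; split; [exact: num_real|move=> y y1 v _ /=; rewrite normr1 ltW].
- apply: aeW => v k _; rewrite /= lee_fin indicE.
  by case: (_ \in _); rewrite ?normr1 ?normr0.
rewrite integral0 => /fine_cvgP[_ /cvgr0Pnorm_lt /(_ 2^-1)].
rewrite invr_gt0 ltr0n => /(_ isT)[N _ /(_ N (leqnn N))] /=.
rewrite integral_indic //=; last exact: mE.
rewrite (_ : setI _ _ = E e (x N)); last first.
  apply/seteqP; split=> v /=; first by case.
  by move=> h; split => //; move: h => /andP[]; rewrite in_itv.
case: (xP N) => _ h; rewrite ltNge => /negP; apply.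
have fE : mu (E e (x N)) \is a fin_num.
  rewrite ge0_fin_numE//; apply: (@le_lt_trans _ _ (mu `[0, 2]%classic)).
    apply: le_measure; [apply/mem_set; exact: mE|exact/mem_set|].
    by move=> v /= /andP[]; rewrite in_itv.
  by rewrite /mu lebesgue_measure_itv /= lte_fin ltr0n -EFinB ltry.
rewrite ger0_norm ?fine_ge0//.
by rewrite -lee_fin fineK.
Qed.

(** The exceptional sets of [x] and of [x + u] are both too small for their
    union, after a translation, to cover [[1, 2]]. *)
Lemma uniform_shift (e : R) : 0 < e ->
  exists X, forall x u, X <= x -> 0 <= u <= 1 -> `|f (x + u) - f x| <= e.
Proof.
move=> e0; have e2 : 0 < e / 2 by rewrite divr_gt0.
have [X HX] := small_exceptional_set e2.
exists X => x u Xx /andP[u0 u1].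
pose F := (fun v => v + - u) @^-1` E (e / 2) (x + u).
have mF : measurable F.
  rewrite -[X in measurable X]setTI; apply: measurable_funD => //; exact: mE.
have muF : (mu F < (2^-1)%:E)%E.
  by rewrite lebesgue_measure_shift; [apply: HX; lra|exact: mE].
have muE := HX x Xx.
have [v []] : exists v : R, [/\ 1 <= v <= 2, ~ E (e / 2) x v & ~ F v].
  apply: contrapT => /forallNP H.
  have : (mu `[1%R, 2%R]%classic < 1%:E)%E.
    apply: (@le_lt_trans _ _ (mu (E (e / 2) x `|` F))).
      apply: le_measure; [exact/mem_set| |].
        by apply/mem_set; apply: measurableU => //; exact: mE.
      move=> v /=; rewrite in_itv /= => v12; apply: contrapT => /not_orP[nE nF].
      exact: (H v).
    apply: le_lt_trans; first by apply: measureU2 => //; exact: mE.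
    rewrite (_ : 1%:E = (2^-1)%:E + (2^-1)%:E)%E; last by rewrite -EFinD; congr EFin; lra.
    exact: lteD.
  rewrite /mu lebesgue_measure_itv /= lte_fin (_ : 1 < 2 :> R); last by lra.
  by rewrite -EFinB lte_fin; lra.
move=> /andP[v1 v2] nE nF.
have h1 : `|f (x + v) - f x| <= e / 2.
  by rewrite leNgt; apply/negP => h; apply: nE; rewrite /E /= h; lra.
have h2 : `|f (x + v) - f (x + u)| <= e / 2.
  rewrite leNgt; apply/negP => h; apply: nF; rewrite /F /E /=.
  by rewrite (_ : x + u + (v - u) = x + v); [rewrite h; lra|ring].
rewrite (_ : f (x + u) - f x = (f (x + v) - f x) - (f (x + v) - f (x + u))); last by ring.
by rewrite (le_trans (ler_normB _ _))//; lra.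
Qed.

Lemma sublinear_of_shift (eta : R) : 0 < eta ->
  exists X, forall x, X <= x -> `|f x| <= eta * x.
Proof.
move=> eta0; have eta2 : 0 < eta / 2 by rewrite divr_gt0.
have [X0 HX0] := uniform_shift eta2.
pose X := Num.max X0 0.
have X0' : 0 <= X by rewrite le_max lexx orbT.
have HX x u : X <= x -> 0 <= u <= 1 -> `|f (x + u) - f x| <= eta / 2.
  by rewrite ge_max => /andP[? _]; exact: HX0.
have grow k x : X <= x <= X + k%:R -> `|f x - f X| <= eta / 2 * k%:R.
  elim: k x => [|k IH] x.
    rewrite addr0 => /andP[? ?]; have -> : x = X by apply/eqP; rewrite eq_le; apply/andP.
    by rewrite subrr normr0 mulr0.
  rewrite -natr1 => /andP[Xx xk]; have [xk'|xk'] := leP x (X + k%:R).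
    by apply: (le_trans (IH x _)); [rewrite Xx|lra].
  have k0 : 0 <= k%:R :> R by [].
  have H1 : `|f (X + k%:R) - f X| <= eta / 2 * k%:R by apply: IH; lra.
  have : `|f x - f (X + k%:R)| <= eta / 2.
    rewrite -[in f x](subrK (X + k%:R) x) [x - _ + _]addrC; apply: HX; lra.
  rewrite (_ : f x - f X = (f x - f (X + k%:R)) + (f (X + k%:R) - f X)); last by ring.
  by move=> H2; rewrite (le_trans (ler_normD _ _))//; lra.
pose Y := (`|f X| + eta) * 2 / eta.
exists (Num.max X Y) => x; rewrite ge_max => /andP[Xx Yx].
have xX : 0 <= x - X by lra.
have H : `|f x - f X| <= eta / 2 * (Num.truncn (x - X)).+1%:R.
  by apply: grow; rewrite Xx; have := ltW (truncnS_gt (x - X)); lra.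
have kx : (Num.truncn (x - X)).+1%:R <= x - X + 1.
  by rewrite -natr1; have /andP[h _] := truncn_itv xX; lra.
have : `|f x| <= `|f x - f X| + `|f X| by rewrite -{1}(subrK (f X) (f x)) ler_normD.
move: Yx; rewrite /Y ler_pdivrMr// => Yx.
nra.
Qed.

End UniformShift.

(** All that is needed of slow variation: [ln L] is sublinear in [ln x], so [L]
    lies between two arbitrarily small powers. *)
Lemma slowly_varying_power_bounds (L : R -> R) (eta : R) :
  slowly_varying L -> 0 < eta ->
  exists X, forall x, X <= x -> x `^ (- eta) <= L x <= x `^ eta.
Proof.
move=> [[a [mL Lpos]] Lc] eta0.
pose f y := ln ((L \_ `[a, +oo[%classic) (expR y)).
have fE (y : R) : a <= expR y -> f y = ln (L (expR y)).
  by move=> ay; rewrite /f patchE mem_set//= in_itv /= andbT.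
have mf : measurable_fun setT f.
  have mLr : measurable_fun setT (L \_ `[a, +oo[%classic).
    by apply: (measurable_restrictT L _).1 mL; exact: measurable_itv.
  exact: (measurableT_comp (@measurable_ln R) (measurableT_comp mLr (@measurable_expR R))).
have expge (y : R) : y <= expR y by rewrite (le_trans _ (expR_ge1Dx y))// lerDr.
have shift_f (u e : R) : 0 < e -> exists B : R, forall y : R, B <= y -> `|f (y + u) - f y| <= e.
  move=> e0.
  have := Lc _ (expR_gt0 u) => Hc.
  have {}Hc : ln (L (expR u * x) / L x) @[x --> +oo] --> ln (1 : R).
    by apply: continuous_cvg Hc; exact: continuous_ln.
  move: Hc; rewrite ln1 => /cvgr0Pnorm_le /(_ _ e0)[M [_ HM]].
  exists (Num.max (M + 1) (Num.max a (a - u))) => y; rewrite !ge_max => /and3P[My ay auy].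
  have a1 : a <= expR y by exact: le_trans ay (expge y).
  have a2 : a <= expR (y + u) by rewrite (le_trans _ (expge _))//; lra.
  rewrite !fE// -ln_div ?posrE ?Lpos// expRD [expR y * _]mulrC.
  by apply: HM; rewrite (lt_le_trans _ (expge y))//; lra.
have [X HX] := sublinear_of_shift mf shift_f eta0.
exists (Num.max (expR X) (Num.max a 1)) => x; rewrite !ge_max => /and3P[Xx ax x1].
have x0 : 0 < x by exact: lt_le_trans x1.
have := HX (ln x); rewrite -ler_expR lnK ?posrE// => /(_ Xx).
rewrite fE lnK ?posrE// ler_norml => /andP[h1 h2].
rewrite /powR !gt_eqF//.
by apply/andP; split; rewrite -[L x]lnK ?posrE ?Lpos// ler_expR; lra.
Qed.

End SlowVariation.

(** * Tails and truncated moments *)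
Section PowerLemmas.
Variable R : realType.
Implicit Types x y r s : R.

Lemma powRDp x r s : 0 < x -> x `^ (r + s) = x `^ r * x `^ s.
Proof. by move=> x0; rewrite powRD// (gt_eqF x0) implybT. Qed.

Lemma ler_powRl x y r : 0 <= r -> 0 <= x -> x <= y -> x `^ r <= y `^ r.
Proof.
by move=> r0 x0 xy; apply: ge0_ler_powR => //; rewrite nnegrE//; exact: le_trans xy.
Qed.

Lemma eventually_le_powR (c eta : R) : 0 < eta ->
  exists X, forall x, X <= x -> c <= x `^ eta.
Proof.
move=> eta0; pose c' := Num.max c 1.
have c'0 : 0 <= c' by rewrite le_max ler01 orbT.
exists (c' `^ eta^-1) => x Xx; apply: (@le_trans _ _ c'); first by rewrite le_max lexx.
have <- : (c' `^ eta^-1) `^ eta = c' by rewrite -powRrM mulVf ?gt_eqF// powRr1.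
by apply: ler_powRl => //; [exact: ltW|exact: powR_ge0].
Qed.

End PowerLemmas.

Section Tails.
Context d (T : measurableType d) (R : realType) (P : probability T R).
Variable Z : {RV P >-> R}.

Definition abs_tail (x : R) : R := fine (P [set w | x < `|Z w|]).

Lemma measurable_abs_gt (x : R) : measurable [set w | x < `|Z w|].
Proof.
rewrite -[X in measurable X]setTI; apply: measurable_fun_ltr => //.
exact: measurableT_comp.
Qed.

Lemma abs_tail_ge0 x : 0 <= abs_tail x.
Proof. exact: fine_ge0. Qed.

Lemma abs_tail_le1 x : abs_tail x <= 1.
Proof.
rewrite -lee_fin -prob_fineK; last exact: measurable_abs_gt.
by apply: probability_le1; exact: measurable_abs_gt.
Qed.

Lemma abs_tail_le x y : x <= y -> abs_tail y <= abs_tail x.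
Proof.
move=> xy; rewrite -lee_fin -!prob_fineK; [|exact: measurable_abs_gt..].
apply: le_measure; [exact/mem_set/measurable_abs_gt..|].
by move=> w /=; exact: le_lt_trans.
Qed.

Lemma abs_tail_split x : 0 <= x -> abs_tail x =
  fine (P [set w | x < Z w]) + fine (P [set w | Z w < - x]).
Proof.
move=> x0.
have m1 : measurable [set w | x < Z w].
  by rewrite -[X in measurable X]setTI; apply: measurable_fun_ltr.
have m2 : measurable [set w | Z w < - x].
  by rewrite -[X in measurable X]setTI; apply: measurable_fun_ltr.
rewrite /abs_tail (_ : [set w | x < `|Z w|] = [set w | x < Z w] `|` [set w | Z w < - x]).
  rewrite measureU//; first by rewrite fineD// fin_num_measure.
  by apply/seteqP; split => // w [/= h1 h2]; lra.
apply/seteqP; split => w /=; rewrite lter_normr.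
  by case/orP => ?; [left|right; lra].
by case=> ?; apply/orP; [left|right; lra].
Qed.

Lemma tail_power_bounds (alpha qplus qminus : R) (L : R -> R) (eta : R) :
  qplus + qminus = 1 -> slowly_varying L ->
  tail_equiv (fun x => fine (P [set w | x < Z w])) qplus alpha L ->
  tail_equiv (fun x => fine (P [set w | Z w < - x])) qminus alpha L ->
  0 < eta ->
  exists X, forall x, X <= x ->
    x `^ (- (alpha + eta)) <= abs_tail x <= x `^ (- (alpha - eta)).
Proof.
move=> q1 Lsv Hp Hm eta0.
have eta2 : 0 < eta / 2 by rewrite divr_gt0.
have [X1 HX1] := slowly_varying_power_bounds Lsv eta2.
have [X2 HX2] := eventually_le_powR (2 : R) eta2.
have : fine (P [set w | x < Z w]) / (L x * x `^ (- alpha)) +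
       fine (P [set w | Z w < - x]) / (L x * x `^ (- alpha)) @[x --> +oo] --> (1 : R).
  by rewrite -q1; apply: cvgD.
move=> /cvgrPdist_lt /(_ (2^-1)); rewrite invr_gt0 ltr0n => /(_ isT)[X3 [_ HX3]].
exists (Num.max (Num.max X1 X2) (Num.max (X3 + 1) 1)) => x.
rewrite !ge_max => /andP[/andP[x1 x2] /andP[x3 x4]].
have x0 : 0 < x by lra.
have /HX3 : X3 < x by lra.
rewrite -mulrDl -abs_tail_split; last exact: ltW.
have /andP[L1 L2] := HX1 _ x1.
have h2 := HX2 _ x2.
have pw (e : R) : 0 < x `^ e by exact: powR_gt0.
have L0 : 0 < L x by exact: lt_le_trans L1.
have LA : 0 < L x * x `^ (- alpha) by rewrite mulr_gt0.
rewrite ltr_distlC => /andP[]; rewrite ltr_pdivlMr// ltr_pdivrMr// => u1 u2.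
have E1 : x `^ (- (alpha + eta)) = x `^ (- (eta / 2)) * x `^ (- (eta / 2)) * x `^ (- alpha).
  by rewrite -!powRDp//; congr (_ `^ _); lra.
have E2 : x `^ (- (alpha - eta)) = x `^ (eta / 2) * x `^ (eta / 2) * x `^ (- alpha).
  by rewrite -!powRDp//; congr (_ `^ _); lra.
have h3 : x `^ (- (eta / 2)) <= 2^-1 by rewrite powRN lef_pV2 ?posrE.
apply/andP; split.
  rewrite E1 (le_trans _ (ltW u1))// mulrA; apply: ler_wpM2r; first exact: ltW.
  by rewrite (_ : 1 - 2^-1 = 2^-1); [apply: ler_pM => //; exact: ltW|lra].
rewrite E2 (le_trans (ltW u2))// mulrA; apply: ler_wpM2r; first exact: ltW.
by apply: ler_pM; [lra|exact: ltW|lra|].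
Qed.

End Tails.

Section TruncatedMoments.
Context d (T : measurableType d) (R : realType) (P : probability T R).
Variables (Z : {RV P >-> R}) (gamma : R).
Hypothesis gamma0 : 0 < gamma.

Definition restr (A : set R) (z : R) : R := z * \1_A z.

Definition cball (tau : R) : set R := [set z | `|z| <= tau].
Definition band (tau K : R) : set R := [set z | tau < `|z| <= K].

Lemma measurable_cball tau : measurable (cball tau).
Proof.
rewrite -[X in measurable X]setTI; apply: measurable_fun_ler => //.
Qed.

Lemma measurable_band tau K : measurable (band tau K).
Proof.
rewrite (_ : band tau K = cball K `\` cball tau).
  by apply: measurableD; exact: measurable_cball.
apply/seteqP; split => z; rewrite /band /cball /=.
  by case/andP => h1 h2; split => //; rewrite leNgt h1.
by move=> [h1 /negP]; rewrite -ltNge h1 => ->.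
Qed.

Lemma measurable_restr A : measurable A -> measurable_fun setT (restr A).
Proof. by move=> mA; apply: measurable_funM => //; exact: measurable_indic. Qed.

Lemma restr_bounded A K z : A `<=` cball K -> 0 <= K -> `|restr A z| <= K.
Proof.
move=> AK K0; rewrite /restr indicE; case: (boolP (z \in A)) => [/set_mem /AK|_].
  by rewrite mulr1.
by rewrite mulr0 normr0.
Qed.

Lemma bmf_restr A K : measurable A -> A `<=` cball K -> 0 <= K ->
  bounded_mfun (restr A \o Z).
Proof.
move=> mA AK K0; apply: bmf_comp => //; first exact: measurable_restr.
by exists K => z; exact: restr_bounded.
Qed.

Definition trunc_pow (tau z : R) : R := `|z| `^ gamma * \1_(cball tau) z.

Lemma bmf_trunc_pow tau : 0 <= tau -> bounded_mfun (trunc_pow tau \o Z).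
Proof.
move=> tau0; apply: bmf_comp => //.
  apply: measurable_funM; last by apply: measurable_indic; exact: measurable_cball.
  exact: (measurableT_comp (@measurable_powR R gamma) (@normr_measurable R setT)).
exists (tau `^ gamma) => z; rewrite /trunc_pow indicE.
case: (boolP (z \in _)) => [/set_mem zt|_]; last by rewrite mulr0 normr0 powR_ge0.
by rewrite mulr1 ger0_norm ?powR_ge0//; apply: ler_powRl => //; exact: ltW.
Qed.

(** Each level [2^k] that is exceeded contributes more than enough to cover the
    growth of the power up to the next level. *)
Let dyadic_bound (n : nat) (z : R) : `|z| <= 2 ^+ n ->
  `|z| `^ gamma <= 1 + \sum_(k < n) (2 `^ gamma) ^+ k.+1 * \1_[set x | 2 ^+ k < `|x|] z.
Proof.
elim: n => [|n IH] zn.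
  have <- : 1 `^ gamma = 1 + \sum_(k < 0) (2 `^ gamma) ^+ k.+1 * \1_[set x | 2 ^+ k < `|x|] z.
    by rewrite big_ord0 addr0 powR1.
  by apply: ler_powRl => //; exact: ltW.
rewrite big_ord_recr /=; have [zn'|zn'] := leP `|z| (2 ^+ n).
  by rewrite (le_trans (IH zn'))// addrA lerDl mulr_ge0 ?exprn_ge0 ?powR_ge0.
rewrite indicE mem_set// mulr1 addrA.
apply: (@le_trans _ _ ((2 `^ gamma) ^+ n.+1)).
  rewrite -!powR_mulrn ?powR_ge0// -powRrM mulrC powRrM powR_mulrn//.
  by apply: ler_powRl => //; exact: ltW.
rewrite lerDr addr_ge0//; apply: sumr_ge0 => k _.
by rewrite mulr_ge0 ?exprn_ge0 ?powR_ge0.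
Qed.

(** A tail of order [x^-gamma'] makes the dyadic levels contribute a geometric
    series of ratio [2^(gamma - gamma')], whatever the truncation. *)
Lemma truncated_moment_bounded (C gamma' : R) : gamma < gamma' -> 0 <= C ->
  (forall x, 1 <= x -> abs_tail Z x <= C * x `^ (- gamma')) ->
  exists2 M, 0 <= M & forall tau, 0 <= tau -> mean P (trunc_pow tau \o Z) <= M.
Proof.
move=> gg C0 tailC.
pose rho : R := 2 `^ (gamma - gamma').
have rho0 : 0 < rho by apply: powR_gt0.
have rho1 : rho < 1.
  rewrite /rho /powR ifF; last by apply/negbTE; rewrite pnatr_eq0.
  by rewrite -[ltRHS]expR0 ltr_expR pmulr_llt0 ?subr_lt0// ln_gt0// ltr1n.
exists (1 + C * 2 `^ gamma / (1 - rho)).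
  by rewrite addr_ge0// divr_ge0 ?mulr_ge0 ?powR_ge0// subr_ge0 ltW.
move=> tau tau0.
pose n := Num.truncn tau.
have tn : tau <= 2 ^+ n.+1.
  rewrite (le_trans (ltW (truncnS_gt tau)))// -natrX ler_nat ltnW// ltn_expl//.
pose S w := 1 + \sum_(k < n.+1) (2 `^ gamma) ^+ k.+1 * \1_[set v | 2 ^+ k < `|Z v|] w.
have bI k : bounded_mfun (\1_[set v | 2 ^+ k < `|Z v|] : T -> R).
  by apply: bmf_indic; exact: measurable_abs_gt.
have bS : bounded_mfun S.
  by apply: bmfD; [exact: bmf_cst|apply: bmf_sum => k _; exact: bmfZ].
apply: (@le_trans _ _ (mean P S)).
  apply: le_mean => //; first exact: bmf_trunc_pow.
  move=> w; rewrite /trunc_pow /= indicE; case: (boolP (Z w \in _)) => [/set_mem zt|_].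
    by rewrite mulr1 (le_trans (dyadic_bound (le_trans zt tn))).
  by rewrite mulr0 addr_ge0// sumr_ge0// => k _; rewrite mulr_ge0 ?exprn_ge0 ?powR_ge0.
rewrite meanD; [|exact: bmf_cst|by apply: bmf_sum => k _; exact: bmfZ].
rewrite mean_sum; last by move=> k _; exact: bmfZ.
rewrite (_ : mean P (fun=> 1) = 1); last exact: mean_cst.
rewrite lerD2l.
apply: (@le_trans _ _ (\sum_(k < n.+1) (C * 2 `^ gamma) * rho ^+ k)).
  apply: ler_sum => k _; rewrite meanZ// mean_indic; last exact: measurable_abs_gt.
  have := tailC (2 ^+ k); rewrite exprn_ege1 ?ler1n// => /(_ isT) h.
  apply: (@le_trans _ _ ((2 `^ gamma) ^+ k.+1 * (C * (2 ^+ k) `^ (- gamma')))).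
    by rewrite ler_wpM2l ?exprn_ge0 ?powR_ge0.
  rewrite le_eqVlt; apply/orP; left; apply/eqP.
  rewrite /rho powRDp// exprS exprMn mulrAC.
  rewrite -[in (2 ^+ k) `^ _]powR_mulrn// -powRrM mulrC [k%:R * _]mulrC powRrM powR_mulrn ?powR_ge0//.
  ring.
rewrite -mulr_sumr ler_wpM2l ?mulr_ge0 ?powR_ge0//.
rewrite -[leRHS]mul1r ler_pdivlMr ?subr_gt0//.
have -> : (\sum_(k < n.+1) rho ^+ k) * (1 - rho) = 1 - rho ^+ n.+1.
  by rewrite -[in RHS](expr1n _ n.+1) subrXX mulrC; congr (_ * _);
     apply: eq_bigr => k _; rewrite expr1n mul1r.
by rewrite gerBl exprn_ge0// ltW.
Qed.

Variable M : R.
Hypothesis momentM : forall tau, 0 <= tau -> mean P (trunc_pow tau \o Z) <= M.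

(** On the ball of radius [tau], [|z|^m] is [|z|^gamma] times at most
    [tau^(m - gamma)]. *)
Lemma mean_restr_pow_ge (m : nat) (tau : R) : gamma <= m%:R -> 0 < tau ->
  mean P (fun w => `|restr (cball tau) (Z w)| ^+ m) <= M * tau `^ (m%:R - gamma).
Proof.
move=> gm tau0.
apply: (@le_trans _ _ (mean P (fun w => tau `^ (m%:R - gamma) * (trunc_pow tau \o Z) w))).
  apply: le_mean.
  - by apply: bmfX; apply: bmf_abs; apply: (@bmf_restr _ tau);
      [exact: measurable_cball|exact: subset_refl|exact: ltW].
  - by apply: bmfZ; apply: bmf_trunc_pow; exact: ltW.
  move=> w; rewrite /restr /trunc_pow /= indicE.
  have m0 : (0 < m)%N by rewrite -(ltr_nat R) (lt_le_trans gamma0).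
  case: (boolP (Z w \in _)) => [/set_mem zt|_]; last by rewrite !mulr0 normr0 expr0n gtn_eqF.
  rewrite !mulr1 -powR_mulrn// -{1}(subrK gamma m%:R).
  have [->|zn0] := eqVneq (Z w) 0.
    by rewrite normr0 powR0 ?mulr_ge0 ?powR_ge0// subrK gt_eqF// ltr0n.
  rewrite powRDp ?normr_gt0// ler_wpM2r ?powR_ge0//.
  by apply: ler_powRl => //; rewrite subr_ge0.
rewrite meanZ; last by apply: bmf_trunc_pow; exact: ltW.
by rewrite mulrC ler_wpM2r ?powR_ge0// momentM// ltW.
Qed.

Lemma mean_restr_pow_le (m : nat) (tau : R) : m%:R <= gamma -> 0 < tau ->
  mean P (fun w => `|restr (cball tau) (Z w)| ^+ m) <= 1 + M.
Proof.
move=> gm tau0.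
apply: (@le_trans _ _ (mean P (fun w => cst 1 w + (trunc_pow tau \o Z) w))).
  apply: le_mean.
  - by apply: bmfX; apply: bmf_abs; apply: (@bmf_restr _ tau);
      [exact: measurable_cball|exact: subset_refl|exact: ltW].
  - by apply: bmfD; [exact: bmf_cst|apply: bmf_trunc_pow; exact: ltW].
  move=> w; rewrite /restr /trunc_pow /= indicE.
  case: (boolP (Z w \in _)) => [/set_mem zt|_]; last first.
    by rewrite !mulr0 normr0 addr0 expr0n; case: (m == 0)%N.
  rewrite !mulr1; have [z1|z1] := leP `|Z w| 1.
    by apply: (@le_trans _ _ 1); [exact: exprn_ile1|rewrite lerDl powR_ge0].
  by rewrite -powR_mulrn// (le_trans (ler_powR (ltW z1) gm))// lerDr.
rewrite meanD; [|exact: bmf_cst|by apply: bmf_trunc_pow; exact: ltW].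
by rewrite mean_cst lerD2l momentM// ltW.
Qed.

End TruncatedMoments.

Section Centering.
Context d (T : measurableType d) (R : realType) (P : probability T R).
Variables (Z : {RV P >-> R}) (gamma M : R).
Hypothesis gamma1 : 1 <= gamma.
Hypothesis momentM : forall tau, 0 <= tau -> mean P (trunc_pow gamma tau \o Z) <= M.

Let zk (k : nat) (w : T) : R := restr (cball k.+1%:R) (Z w).

Let bmf_zk k : bounded_mfun (zk k).
Proof.
by apply: (@bmf_restr _ _ _ _ _ _ k.+1%:R) => //; exact: measurable_cball.
Qed.

Let zk_near w : \forall k \near \oo, zk k w = Z w.
Proof.
exists (Num.truncn `|Z w|) => // k /= wk.
rewrite /zk /restr indicE mem_set ?mulr1//= /cball /=.
by rewrite (le_trans (ltW (truncnS_gt _)))// ler_nat ltnS.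
Qed.

Let zk_le k w : `|zk k w| <= `|Z w|.
Proof.
by rewrite /zk /restr normrM indicE ler_piMr//; case: (_ \in _); rewrite ?normr1 ?normr0.
Qed.

Let mean_EFin f : bounded_mfun f -> (\int[P]_w (f w)%:E = (mean P f)%:E)%E.
Proof.
move=> bf; rewrite /mean /Rintegral fineK//.
exact: integrable_fin_num (bmf_integrable P bf).
Qed.

Lemma abs_mean_fin : ('E_P[(fun w => `|Z w|%R)] < +oo)%E.
Proof.
rewrite unlock; pose g k w := (`|zk k w|)%:E.
have mg k : measurable_fun setT (g k).
  by apply/measurable_EFinP; case: (bmf_abs (bmf_zk k)).
have nd w : nondecreasing_seq (g ^~ w).
  move=> i j ij; rewrite /g lee_fin /zk /restr !indicE !normrM ler_wpM2l//.
  case: (boolP (Z w \in cball i.+1%:R)) => [/set_mem wi|_]; last by rewrite normr0.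
  rewrite mem_set//= /cball /=; apply: (le_trans wi).
  by rewrite ler_nat ltnS.
have <- : (\int[P]_w limn (g ^~ w) = \int[P]_w (`|Z w|)%:E)%E.
  apply: eq_integral => w _; apply/cvg_lim => //; apply: cvg_near_cst.
  by apply: filterS (zk_near w) => k; rewrite /g => ->.
rewrite monotone_convergence//; last by move=> k w _; rewrite lee_fin.
apply: (@le_lt_trans _ _ (1 + M)%:E); last exact: ltry.
apply: lime_le.
  apply: ereal_nondecreasing_is_cvgn => i j ij; apply: ge0_le_integral => //.
    by move=> w _; rewrite lee_fin.
  by move=> w _; exact: nd.
apply: nearW => k; rewrite /g (mean_EFin (bmf_abs (bmf_zk k))) lee_fin.
have := @mean_restr_pow_le _ _ _ P Z _ (lt_le_trans ltr01 gamma1) M momentM 1 k.+1%:R.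
by move=> /(_ gamma1)/(_ (ltr0Sn _ _)).
Qed.

Lemma mean_restr_cvg0 : ('E_P[Z] = 0)%E -> mean P (zk k) @[k --> \oo] --> (0 : R).
Proof.
rewrite unlock => EZ.
have iZ : P.-integrable setT (EFin \o (fun w => `|Z w|)).
  apply/integrableP; split; first by apply/measurable_EFinP; exact: measurableT_comp.
  have := abs_mean_fin; rewrite unlock; congr (_ < _)%E.
  by apply: eq_integral => w _; rewrite /= normr_id.
have [||||| _ _] := @dominated_convergence _ _ _ P setT measurableT
  (fun k w => (zk k w)%:E) (fun w => (Z w)%:E) (fun w => (`|Z w|)%:E).
- by move=> k; apply/measurable_EFinP; case: (bmf_zk k).
- exact/measurable_EFinP.
- apply: aeW => w _; apply: cvg_near_cst.
  by apply: filterS (zk_near w) => k ->.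
- exact: iZ.
- by apply: aeW => w k _; rewrite /= lee_fin.
by rewrite EZ => /fine_cvgP[].
Qed.

(** A centered variable has the same truncated mean, up to sign, as the part
    that has been cut off, and there [|z|] is at most
    [tau^(1 - gamma) |z|^gamma]. The part cut off is itself truncated at a high
    integer level, so that only means of bounded functions appear. *)
Lemma mean_restr_centered (tau : R) : ('E_P[Z] = 0)%E -> 0 < tau ->
  `|mean P (fun w => restr (cball tau) (Z w))| <= M * tau `^ (1 - gamma).
Proof.
move=> EZ tau0; apply/ler_addgt0Pr => e e0.
have bt : bounded_mfun (restr (cball tau) \o Z).
  by apply: (@bmf_restr _ _ _ _ _ _ tau) => //; [exact: measurable_cball|exact: ltW].
have /cvgr0Pnorm_le /(_ _ e0)[N _ HN] := mean_restr_cvg0 EZ.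
pose k := maxn N (Num.truncn tau).
have hk := HN k (leq_maxl _ _).
have tk : tau <= k.+1%:R.
  by rewrite (le_trans (ltW (truncnS_gt _)))// ler_nat ltnS leq_maxr.
pose D w := zk k w + (-1) * restr (cball tau) (Z w).
have bD : bounded_mfun D by apply: bmfD => //; exact: bmfZ.
have -> : mean P (fun w => restr (cball tau) (Z w)) = mean P (zk k) - mean P D.
  by rewrite meanD//; [rewrite meanZ//; ring|exact: bmfZ].
rewrite (le_trans (ler_normB _ _))// addrC lerD//.
rewrite (le_trans (norm_mean_le P bD))//.
have g0 : 0 < gamma by exact: lt_le_trans gamma1.
have bp : bounded_mfun (trunc_pow gamma k.+1%:R \o Z) by exact: bmf_trunc_pow.
apply: (@le_trans _ _ (mean P (fun w => tau `^ (1 - gamma) * (trunc_pow gamma k.+1%:R \o Z) w))).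
  apply: le_mean; [exact: bmf_abs|exact: bmfZ|move=> w].
  rewrite /D /zk /trunc_pow /restr /= !indicE.
  have R0 : 0 <= tau `^ (1 - gamma) * (`|Z w| `^ gamma * (Z w \in cball k.+1%:R)%:R).
    by rewrite !mulr_ge0 ?powR_ge0.
  case: (boolP (Z w \in cball tau)) => [/set_mem wt|wt].
    rewrite [Z w \in cball k.+1%:R]mem_set/=; last by rewrite /cball /=; exact: le_trans wt tk.
    by rewrite mulr1 mulN1r subrr normr0 !mulr_ge0 ?powR_ge0.
  rewrite !mulr0 addr0.
  case: (boolP (Z w \in cball k.+1%:R)) => [wk|_]; last by rewrite !mulr0 normr0.
  rewrite !mulr1.
  have tz : tau < `|Z w|.
    by rewrite ltNge; apply/negP => h; move/negP: wt; apply; exact/mem_set.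
  rewrite -[leLHS](powRr1 (normr_ge0 _)) -{1}(subrK gamma 1) powRDp; last exact: lt_trans tz.
  apply: ler_wpM2r; first exact: powR_ge0.
  rewrite -(opprB gamma 1) !powRN lef_pV2 ?posrE ?powR_gt0//; last exact: lt_trans tz.
  by apply: ler_powRl; [rewrite subr_ge0|exact: ltW|exact: ltW].
by rewrite meanZ// mulrC ler_wpM2r ?powR_ge0// momentM.
Qed.

End Centering.

(** * Growth of the normalization *)
Section Growth.
Variable R : realType.
Variables (U : R -> R) (b q v : nat -> R) (p : nat -> nat).
Variables (alpha s1 sa c : R).
Hypothesis alpha0 : 0 < alpha.
Hypothesis U_ge0 : forall x, 0 <= U x.
Hypothesis U_le : forall x y, x <= y -> U y <= U x.
Hypothesis U_power : forall eta : R, 0 < eta -> exists X, forall x, X <= x ->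
  x `^ (- (alpha + eta)) <= U x <= x `^ (- (alpha - eta)).
Hypothesis q01 : forall n, (0 < n)%N -> 0 <= q n <= 1.
Hypothesis s10 : 0 < s1.
Hypothesis sa0 : 0 < sa.
Hypothesis c0 : 0 < c.
Hypothesis qv : forall n, (0 < n)%N -> s1 * q n <= v n <= sa.
Hypothesis nq_ge : \forall n \near \oo, c <= n%:R * q n.
Hypothesis normalized : n%:R * (p n)%:R * v n * U (b n) @[n --> \oo] --> (1 : R).
Hypothesis p_infty : p n @[n --> \oo] --> \oo.
Hypothesis p_le : forall zeta : R, 0 < zeta ->
  \forall n \near \oo, ((p n)%:R : R) <= n%:R `^ (1 + zeta).

Let near_gt0 : \forall n \near \oo, (0 < n)%N.
Proof. by exists 1%N. Qed.

Let normalized_bounds : \forall n \near \oo,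
  2^-1 <= n%:R * (p n)%:R * v n * U (b n) <= 2.
Proof.
move/cvgrPdist_lt : normalized => /(_ 2^-1); rewrite invr_gt0 ltr0n => /(_ isT).
by apply: filterS => n; rewrite ltr_distlC => /andP[h1 h2]; apply/andP; split; lra.
Qed.

Let npqU : \forall n \near \oo, n%:R * (p n)%:R * q n * U (b n) <= 2 / s1.
Proof.
near=> n.
have n0 : (0 < n)%N by near: n.
have /andP[h1 h2] := qv n0.
have /andP[_ h] : 2^-1 <= n%:R * (p n)%:R * v n * U (b n) <= 2 by near: n.
rewrite ler_pdivlMr//; apply: le_trans h.
rewrite (_ : _ * s1 = n%:R * (p n)%:R * (s1 * q n) * U (b n)); last by ring.
by apply: ler_wpM2r => //; apply: ler_wpM2l.
Unshelve. all: by end_near. Qed.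

Let p_ge (A : R) : \forall n \near \oo, A <= (p n)%:R.
Proof.
have := p_infty; move=> /(_ [set k | (Num.truncn A < k)%N]) H.
have : \forall n \near \oo, (Num.truncn A < p n)%N.
  by apply: H; exists (Num.truncn A).+1.
apply: filterS => n An; apply: (le_trans (ltW (truncnS_gt A))).
by rewrite ler_nat.
Qed.

(** If [b] stayed bounded along a subsequence, so would [U (b n)] stay away from
    zero; but the normalization and [c <= n q] bound [p] by a multiple of
    [1 / U (b n)], while [p] tends to infinity. *)
Lemma normalization_infty (B : R) : \forall n \near \oo, B <= b n.
Proof.
have [X HX] := U_power ltr01.
pose B' := Num.max B (Num.max X 1).
have B'1 : 0 < B' by rewrite /B' !lt_max ltr01 !orbT.
have UB : 0 < U B'.
  have /andP[h _] : B' `^ (- (alpha + 1)) <= U B' <= B' `^ (- (alpha - 1)).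
    by apply: HX; rewrite /B' !le_max lexx orbT.
  by apply: lt_le_trans h; exact: powR_gt0.
near=> n.
have pn : 2 / s1 / c / U B' + 1 <= (p n)%:R by near: n; exact: p_ge.
have nq : c <= n%:R * q n by near: n.
have h : n%:R * (p n)%:R * q n * U (b n) <= 2 / s1 by near: n; exact: npqU.
rewrite leNgt; apply/negP => bB.
have UbB : U B' <= U (b n).
  by apply: U_le; apply: (le_trans (ltW bB)); rewrite /B' le_max lexx.
have : (p n)%:R <= 2 / s1 / c / U B'.
  rewrite ler_pdivlMr// ler_pdivlMr//; apply: le_trans h.
  rewrite (_ : n%:R * _ * _ * _ = (p n)%:R * U (b n) * (n%:R * q n)); last by ring.
  apply: ler_pM => //; [by rewrite mulr_ge0// ltW|exact: ltW|].
  exact: ler_wpM2l.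
lra.
Unshelve. all: by end_near. Qed.

(** Powers of [b] measure every size: [n p q] is of order [b^alpha] by the
    normalization, and [p] is at most a constant times [n p q] because [n q] is
    bounded below. For the fourth bound, if [n >= p] the square is at most
    [n p q]; otherwise [p] exceeds [n] by at most a small power of [p], hence
    of [b]. For the last one, [n p <= n^3]. *)
Lemma asymptotic_regime (eta B : R) : 0 < eta -> \forall n \near \oo,
  [/\ B <= b n, n%:R * (p n)%:R * q n <= b n `^ (alpha + eta),
      (p n)%:R <= b n `^ (alpha + 1),
      Num.sqrt (Num.max n%:R (p n)%:R * (p n)%:R) * q n <= b n `^ (alpha / 2 + eta) &
      b n `^ (alpha / 4) <= n%:R].
Proof.
move=> eta0.
have eta2 : 0 < eta / 2 by rewrite divr_gt0.
have a8 : 0 < alpha / 8 by rewrite divr_gt0.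
have m0 : 0 < 2^-1 * Num.min eta 1.
  by apply: mulr_gt0 => //; rewrite lt_min eta0 ltr01.
have [X1 HX1] := U_power m0.
have [X2 HX2] := U_power a8.
have [Y1 HY1] := eventually_le_powR (2 / s1) eta2.
have half0 : 0 < 2^-1 :> R by rewrite invr_gt0.
have [Y2 HY2] := eventually_le_powR (2 / s1 / c) half0.
have [Y3 HY3] := eventually_le_powR (2 * sa) a8.
pose zeta := eta / (alpha + 1).
have al1 : 0 < alpha + 1 by rewrite addr_gt0.
have zeta0 : 0 < zeta by rewrite divr_gt0.
near=> n.
have bB : Num.max B (Num.max (Num.max X1 X2) (Num.max (Num.max Y1 Y2) (Num.max Y3 1))) <= b n.
  by near: n; exact: normalization_infty.
move: bB; rewrite !ge_max => /and3P[bB /andP[bX1 bX2] /andP[/andP[bY1 bY2] /andP[bY3 b1]]].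
have n0 : (0 < n)%N by near: n.
have nR : 0 < n%:R :> R by rewrite ltr0n.
have nR1 : 1 <= n%:R :> R by rewrite ler1n.
have /andP[q0 q1] := q01 n0.
have /andP[v1 v2] := qv n0.
have b0 : 0 < b n by exact: lt_le_trans b1.
have pwle x y : x <= y -> b n `^ x <= b n `^ y by move=> xy; apply: ler_powR.
have pw0 x : 0 < b n `^ x by exact: powR_gt0.
have nq : c <= n%:R * q n by near: n.
have h : n%:R * (p n)%:R * q n * U (b n) <= 2 / s1 by near: n; exact: npqU.
have /andP[hh _] : 2^-1 <= n%:R * (p n)%:R * v n * U (b n) <= 2 by near: n.
have p1 : 1 <= (p n)%:R :> R by near: n; exact: p_ge.
have pz : (p n)%:R <= n%:R `^ (1 + zeta) by near: n; exact: (p_le zeta0).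
have p2 : (p n)%:R <= n%:R `^ (1 + 1) :> R by near: n; exact: (p_le ltr01).
have /andP[U1 _] := HX1 _ bX1.
have /andP[_ U2] := HX2 _ bX2.
set m := 2^-1 * Num.min eta 1 in U1 *.
have m1 : m <= eta / 2.
  by rewrite /m mulrC; apply: ler_wpM2r; rewrite // ge_min lexx.
have m2 : m <= 2^-1.
  by rewrite /m -[leRHS]mulr1; apply: ler_wpM2l; rewrite // ge_min lexx orbT.
have npq : n%:R * (p n)%:R * q n <= 2 / s1 * b n `^ (alpha + m).
  rewrite -[b n `^ _]invrK -powRN ler_pdivlMr ?powR_gt0//.
  by apply: le_trans h; apply: ler_wpM2l => //; rewrite !mulr_ge0.
have F1 : n%:R * (p n)%:R * q n <= b n `^ (alpha + eta).
  apply: (le_trans npq); rewrite (_ : alpha + eta = eta / 2 + (alpha + eta / 2)); last by lra.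
  rewrite [leRHS](powRDp _ _ b0); apply: ler_pM; rewrite ?divr_ge0 ?powR_ge0 ?(ltW s10)//.
  - exact: HY1.
  - by apply: pwle; lra.
have F2 : (p n)%:R <= b n `^ (alpha + 1).
  apply: (@le_trans _ _ (2 / s1 / c * b n `^ (alpha + m))).
    rewrite mulrAC ler_pdivlMr//; apply: le_trans npq.
    by rewrite mulrAC mulrC; apply: ler_wpM2r.
  rewrite (_ : alpha + 1 = 2^-1 + (alpha + 2^-1)); last by lra.
  rewrite [leRHS](powRDp _ _ b0); apply: ler_pM; rewrite ?divr_ge0 ?powR_ge0 ?(ltW s10) ?(ltW c0)//.
  - exact: HY2.
  - by apply: pwle; lra.
have F3 : Num.max n%:R (p n)%:R * (p n)%:R * q n ^+ 2 <= b n `^ (alpha + 2 * eta).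
  have [pn|np] := leP (p n)%:R n%:R.
    apply: (@le_trans _ _ (b n `^ (alpha + eta))); last by apply: pwle; lra.
    apply: le_trans F1; rewrite expr2 mulrA ler_piMr// !mulr_ge0//.
  apply: (@le_trans _ _ (b n `^ (alpha + eta) * b n `^ eta)); last first.
    by rewrite -powRDp//; apply: pwle; lra.
  apply: (@le_trans _ _ (n%:R * (p n)%:R * q n * n%:R `^ zeta)).
    rewrite (_ : n%:R * _ * _ * _ = (n%:R * n%:R `^ zeta) * (p n)%:R * q n); last by ring.
    have -> : n%:R * n%:R `^ zeta = n%:R `^ (1 + zeta).
      by rewrite powRDp// powRr1// ltW.
    apply: (@le_trans _ _ ((p n)%:R * (p n)%:R * q n)).
      by rewrite expr2 mulrA ler_piMr// !mulr_ge0.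
    by apply: ler_wpM2r => //; apply: ler_wpM2r.
  apply: ler_pM => //; rewrite ?mulr_ge0 ?powR_ge0//.
  apply: (@le_trans _ _ ((b n `^ (alpha + 1)) `^ zeta)).
    by apply: ler_powRl; [exact: ltW|exact: ltW|apply: le_trans F2; exact: ltW].
  by rewrite -powRrM; apply: pwle; rewrite /zeta mulrC divfK// gt_eqF.
split => //.
- have Dp : 0 <= Num.max n%:R (p n)%:R * (p n)%:R :> R.
    by rewrite mulr_ge0// le_max ltW.
  rewrite -(@ler_pXn2r _ 2) ?nnegrE ?powR_ge0 ?mulr_ge0 ?sqrtr_ge0//.
  rewrite exprMn sqr_sqrtr// -[leRHS]powR_mulrn ?powR_ge0// -powRrM.
  by apply: (le_trans F3); apply: pwle; lra.
- rewrite -(@ler_pXn2r _ 3) ?nnegrE ?powR_ge0//.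
  rewrite -[leLHS]powR_mulrn ?powR_ge0// -powRrM.
  have n3 : n%:R * (p n)%:R <= n%:R ^+ 3 :> R.
    rewrite exprS; apply: ler_wpM2l => //.
    by move: p2; rewrite (_ : 1 + 1 = 2%:R)// powR_mulrn.
  apply: le_trans n3.
  have key : 2^-1 <= n%:R * (p n)%:R * (sa * b n `^ (- (alpha - alpha / 8))).
    apply: (le_trans hh); rewrite -mulrA; apply: ler_wpM2l; first by rewrite mulr_ge0.
    by apply: ler_pM => //; apply: le_trans v1; rewrite mulr_ge0// ltW.
  have : b n `^ (alpha / 4 * 3%:R) * (2 * sa) <= b n `^ (alpha - alpha / 8).
    rewrite (_ : alpha - alpha / 8 = alpha / 4 * 3%:R + alpha / 8); last by lra.
    by rewrite powRDp//; apply: ler_wpM2l; [exact: ltW|exact: HY3].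
  move: key; rewrite powRN.
  set W := b n `^ (alpha - alpha / 8); set V := b n `^ (alpha / 4 * 3%:R).
  move=> key VW; have W0 : 0 < W by exact: pw0.
  have : W <= n%:R * (p n)%:R * (2 * sa).
    have : W * 2^-1 <= W * (n%:R * (p n)%:R * (sa / W)) by apply: ler_wpM2l => //; exact: ltW.
    rewrite (_ : W * (_ * _) = n%:R * (p n)%:R * sa); last by field; rewrite gt_eqF.
    lra.
  move=> WN; rewrite -(@ler_pM2r _ (2 * sa)) ?mulr_gt0//.
  exact: le_trans VW WN.
Unshelve. all: by end_near. Qed.

End Growth.

(** * The thinned volatility *)
Section ThinnedVolatility.
Context d (T : measurableType d) (R : realType) (P : probability T R).
Variables (sigma0 : {RV P >-> R}) (m : nat) (s q : 'I_m.+1 -> R) (i1 : 'I_m.+1).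
Hypothesis sigma0_ge0 : forall w, 0 <= sigma0 w.
Hypothesis s_ord0 : s ord0 = 0.
Hypothesis s_incr : forall i j : 'I_m.+1, (i < j)%N -> s i < s j.
Hypothesis law : forall i, P [set w | sigma0 w = s i :> R] = (q i)%:E.
Hypothesis sum_q : \sum_(i < m.+1) q i = 1.
Hypothesis i1E : val i1 = 1%N.

Let atom i : set T := [set w | sigma0 w = s i].

Let measurable_atom i : measurable (atom i).
Proof.
have mX : measurable_fun setT sigma0 by [].
have -> : atom i = sigma0 @^-1` [set s i] by [].
by rewrite -[X in measurable X]setTI; exact: mX.
Qed.

Let f w : R := \sum_(i < m.+1) \1_(atom i) w.

Let bf : bounded_mfun f.
Proof. by apply: bmf_sum => i _; exact: bmf_indic. Qed.

Let bg : bounded_mfun (fun w => 1 + (-1) * f w).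
Proof. by apply: bmfD; [exact: bmf_cst|exact: bmfZ]. Qed.

(** As the atoms are disjoint, [f] is the indicator of their union, so [1 - f]
    is the indicator of a negligible event. Adding a multiple of it makes
    almost sure inequalities hold everywhere. *)
Let mean_off_atoms : mean P (fun w => 1 + (-1) * f w) = 0.
Proof.
rewrite meanD; [|exact: bmf_cst|exact: bmfZ].
rewrite (_ : mean P (fun=> 1) = 1); last exact: mean_cst.
rewrite meanZ// mean_sum; last by move=> i _; exact: bmf_indic.
rewrite (eq_bigr q); first by rewrite sum_q mulr1 subrr.
by move=> i _; rewrite mean_indic//; have := law i; rewrite -/(atom i) => ->.
Qed.

Let f_atom w i : sigma0 w = s i -> f w = 1.
Proof.
move=> wi; rewrite /f (bigD1 i)//= indicE mem_set// big1 ?addr0// => j ji.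
rewrite indicE memNset// /atom /= wi => sij.
move: ji; rewrite -val_eqE /= neq_ltn => /orP[] /s_incr; rewrite sij ltxx//.
Qed.

Let f_off w : (forall i, sigma0 w <> s i) -> f w = 0.
Proof.
move=> H; rewrite /f big1// => i _; rewrite indicE memNset// /atom /=; exact: H.
Qed.

Let atomP w : (exists i, sigma0 w = s i) \/ (forall i, sigma0 w <> s i).
Proof.
have [h|h] := pselect (exists i, sigma0 w = s i); [by left|right => i wi].
by apply: h; exists i.
Qed.

Let s_le i : s i <= s ord_max.
Proof.
have [->//|ne] := eqVneq i ord_max; apply: ltW; apply: s_incr.
by rewrite ltn_neqAle -val_eqE in ne *; rewrite ne -ltnS ltn_ord.
Qed.

Let s_ge0 i : 0 <= s i.
Proof.
have [->|ne] := eqVneq i ord0; first by rewrite s_ord0.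
by rewrite -s_ord0; apply: ltW; apply: s_incr; rewrite lt0n; move: ne; rewrite -val_eqE.
Qed.

Lemma volatility_max_ge0 : 0 <= s ord_max. Proof. exact: s_ge0. Qed.

Lemma volatility_min_gt0 : 0 < s i1.
Proof. by rewrite -s_ord0; apply: s_incr; rewrite i1E. Qed.

Let s_ge1 i : i != ord0 -> s i1 <= s i.
Proof.
move=> ne; have [->//|ne1] := eqVneq i i1; apply: ltW; apply: s_incr.
move: ne ne1; rewrite -!val_eqE /= i1E; case: (val i) => [|[|k]] //.
Qed.

Let measurable_gt : measurable [set w | s ord_max < sigma0 w].
Proof. by rewrite -[X in measurable X]setTI; apply: measurable_fun_ltr. Qed.

Let measurable_neq0 : measurable [set w | sigma0 w != 0].
Proof.
rewrite (_ : [set w | _] = ~` atom ord0); first exact: measurableC.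
by apply/seteqP; split => w /=; rewrite /atom /= s_ord0 => /eqP.
Qed.

Lemma prob_volatility_gt_max : fine (P [set w | s ord_max < sigma0 w]) = 0.
Proof.
apply/eqP; rewrite eq_le fine_ge0// andbT -mean_off_atoms -mean_indic//.
apply: le_mean => //; first exact: bmf_indic.
move=> w; rewrite indicE; case: (atomP w) => [[i wi]|H].
  rewrite (f_atom wi) memNset /=; first by rewrite mulN1r subrr.
  by rewrite wi; apply/negP; rewrite -leNgt.
by rewrite (f_off H) mulr0 addr0; case: (_ \in _).
Qed.

Lemma volatility_prob_le i : i != ord0 ->
  q i <= fine (P [set w | sigma0 w != 0]).
Proof.
move=> i0; rewrite -lee_fin -law -prob_fineK//.
apply: le_measure; [exact/mem_set/measurable_atom|exact/mem_set|].
move=> w /= ->; rewrite gt_eqF//; apply: lt_le_trans (s_ge1 i0).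
exact: volatility_min_gt0.
Qed.

Lemma volatility_moment (alpha : R) : 0 < alpha ->
  exists2 v, 'E_P[(fun w => (sigma0 w `^ alpha)%R)]%E = v%:E &
    s i1 `^ alpha * fine (P [set w | sigma0 w != 0]) <= v <= s ord_max `^ alpha.
Proof.
move=> al0.
pose k x : R := x `^ alpha * \1_(`[0, s ord_max]%classic) x.
have mk : measurable_fun setT k.
  by apply: measurable_funM; [exact: measurable_powR|exact: measurable_indic].
have kb x : 0 <= k x <= s ord_max `^ alpha.
  rewrite /k indicE; case: (boolP (x \in _)) => [/set_mem|_]; last by rewrite mulr0 lexx powR_ge0.
  rewrite /= in_itv /= mulr1 powR_ge0 => /andP[x0 xs] /=.
  by apply: ler_powRl => //; exact: ltW.
have bk : bounded_mfun (k \o sigma0).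
  apply: bmf_comp => //; exists (s ord_max `^ alpha) => x.
  by have /andP[h1 h2] := kb x; rewrite ger0_norm.
exists (mean P (k \o sigma0)).
  rewrite unlock /mean /Rintegral fineK; last exact: integrable_fin_num (bmf_integrable P bk).
  apply: ge0_ae_eq_integral => //.
  - apply/measurable_EFinP.
    have mX : measurable_fun setT sigma0 by [].
    exact: (measurableT_comp (@measurable_powR R alpha) mX).
  - by apply/measurable_EFinP; case: bk.
  - by move=> w _; rewrite lee_fin powR_ge0.
  - by move=> w _; rewrite lee_fin /=; have /andP[] := kb (sigma0 w).
  exists [set w | s ord_max < sigma0 w]; split => //.
    by have := prob_fineK P measurable_gt; rewrite prob_volatility_gt_max.
  move=> w /=; apply: contra_notP => /negP; rewrite -leNgt => ws _.
  by rewrite /k indicE mem_set ?mulr1//= in_itv /= sigma0_ge0 ws.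
apply/andP; split; last first.
  rewrite -[leRHS](mean_cst P); apply: le_mean => //; first exact: bmf_cst.
  by move=> w; have /andP[] := kb (sigma0 w).
rewrite -mean_indic// -meanZ; last exact: bmf_indic.
have -> : mean P (k \o sigma0) = mean P (fun w => (k \o sigma0) w +
    s i1 `^ alpha * (1 + (-1) * f w)).
  by rewrite meanD//; [rewrite meanZ// mean_off_atoms mulr0 addr0|exact: bmfZ].
apply: le_mean; [by apply: bmfZ; exact: bmf_indic|by apply: bmfD => //; exact: bmfZ|].
move=> w; case: (atomP w) => [[i wi]|H].
  rewrite (f_atom wi) mulN1r subrr mulr0 addr0 /= /k [X in _ <= _ * X]indicE.
  rewrite mem_set; last by rewrite /= in_itv /= sigma0_ge0 wi s_le.
  rewrite mulr1 indicE; have [w0|wn0] := eqVneq (sigma0 w) 0.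
    by rewrite memNset ?mulr0 ?powR_ge0//= w0 eqxx.
  rewrite mem_set// mulr1 wi; apply: ler_powRl; [exact: ltW|exact: s_ge0|apply: s_ge1].
  by apply: contra wn0 => /eqP i0; rewrite wi i0 s_ord0.
rewrite (f_off H) mulr0 addr0 mulr1 -[leLHS]add0r; apply: lerD.
  by have /andP[] := kb (sigma0 w).
by rewrite ler_piMr ?powR_ge0// indicE; case: (_ \in _).
Qed.

End ThinnedVolatility.

(** * The matrix at a fixed size *)
Section FixedSize.
Context d (T : measurableType d) (R : realType) (P : probability T R).
Variables (sigma Z : nat * nat -> {RV P >-> R}) (sigma0 Z0 : {RV P >-> R}).
Hypothesis iid_sigma : iid sigma sigma0.
Hypothesis iid_Z : iid Z Z0.
Hypothesis indep_sigma_Z : independent_families sigma Z.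
Hypothesis sigma_ge0 : forall k w, 0 <= sigma k w.

Variable s : R.
Hypothesis s0 : 0 <= s.
Hypothesis sigma_le_s : fine (P [set w | s < sigma0 w]) = 0.

Let q : R := fine (P [set w | sigma0 w != 0]).
Let h : R -> R := restr (cball s).

Let measurable_neq0 (X : {RV P >-> R}) : measurable [set w | X w != 0].
Proof.
have mX : measurable_fun setT X by [].
have -> : [set w | X w != 0] = X @^-1` (~` [set 0]).
  by apply/seteqP; split => w /=; [move=> /eqP|move=> /eqP].
by rewrite -[X in measurable X]setTI; apply: mX => //; exact: measurableC.
Qed.

Let q_ge0 : 0 <= q. Proof. exact: fine_ge0. Qed.

Let q_le1 : q <= 1.
Proof.
rewrite -lee_fin -prob_fineK; last exact: measurable_neq0.
by apply: probability_le1; exact: measurable_neq0.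
Qed.

Let mh : measurable_fun setT h.
Proof. by apply: measurable_restr; exact: measurable_cball. Qed.

Let h_bound x : `|h x| <= s.
Proof. by apply: restr_bounded => //; exact: subset_refl. Qed.

Lemma mean_thinned_pow k : (0 < k)%N ->
  0 <= mean P (fun w => `|h (sigma0 w)| ^+ k) <= s ^+ k * q.
Proof.
move=> k0; rewrite mean_ge0 /=; last by move=> w; rewrite exprn_ge0.
rewrite /q -mean_indic; last exact: measurable_neq0.
rewrite -meanZ; last by apply: bmf_indic; exact: measurable_neq0.
apply: le_mean.
- by apply: bmfX; apply: bmf_abs; apply: (@bmf_comp _ _ _ _ h) => //; exists s.
- by apply: bmfZ; apply: bmf_indic; exact: measurable_neq0.
move=> w; rewrite indicE; case: (eqVneq (sigma0 w) 0) => [w0|wn0].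
  by rewrite w0 /h /restr mul0r normr0 expr0n gtn_eqF// mulr_ge0// exprn_ge0.
by rewrite mem_set ?mulr1//=; apply: lerXn2r; rewrite ?nnegrE.
Qed.

Lemma norm_mean_thinned_pow k : (0 < k)%N ->
  `|mean P (fun w => h (sigma0 w) ^+ k)| <= s ^+ k * q.
Proof.
move=> k0; have /andP[_] := mean_thinned_pow k0; apply: le_trans.
have bh : bounded_mfun (fun w => h (sigma0 w)).
  by apply: (@bmf_comp _ _ _ _ h) => //; exists s.
rewrite (le_trans (norm_mean_le P (bmfX k bh)))//.
rewrite (_ : (fun w => _) = (fun w => `|h (sigma0 w)| ^+ k))//.
by apply/funext => w; rewrite normrX.
Qed.

Definition entry (g : R -> R) (e : nat * nat) (w : T) : R :=
  h (sigma e w) * g (Z e w).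

Definition bounded_borel (g : R -> R) : Prop :=
  measurable_fun setT g /\ exists M : R, forall x, `|g x| <= M.

Lemma bmf_entry g e : bounded_borel g -> bounded_mfun (entry g e).
Proof.
move=> [mg bg]; apply: bmfM.
  by apply: (@bmf_comp _ _ _ _ h) => //; exists s.
by apply: (@bmf_comp _ _ _ _ g).
Qed.

Let bounded_borelX g k : bounded_borel g -> bounded_borel (fun x => g x ^+ k).
Proof.
move=> [mg [M gM]]; split; first exact: measurable_funX.
by exists (M ^+ k) => x; rewrite normrX lerXn2r ?nnegrE// (le_trans _ (gM x)).
Qed.

Let bounded_borelM g1 g2 : bounded_borel g1 -> bounded_borel g2 ->
  bounded_borel (fun x => g1 x * g2 x).
Proof.
move=> [m1 [M1 b1]] [m2 [M2 b2]]; split; first exact: measurable_funM.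
by exists (M1 * M2) => x; rewrite normrM ler_pM.
Qed.

(** An entry is a function of its volatility times a function of its noise, so
    the moments of several entries split into moments of the generic volatility
    and of the generic noise. *)
Lemma mean_prod_entries (g1 g2 : R -> R) (J : seq (nat * nat))
    (k l : nat * nat -> nat) :
  bounded_borel g1 -> bounded_borel g2 -> uniq J ->
  mean P (fun w => \prod_(e <- J) (entry g1 e w ^+ k e * entry g2 e w ^+ l e)) =
  \prod_(e <- J) (mean P (fun w => h (sigma0 w) ^+ (k e + l e)) *
                  mean P (fun w => g1 (Z0 w) ^+ k e * g2 (Z0 w) ^+ l e)).
Proof.
move=> b1 b2 uJ.
have bh : bounded_borel h by split => //; exists s.
have := @mean_prod_fields _ _ _ P _ sigma Z sigma0 Z0 iid_sigma iid_Z indep_sigma_Z J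
  (fun e x => h x ^+ (k e + l e)) (fun e x => g1 x ^+ k e * g2 x ^+ l e) uJ.
move=> <-.
- congr mean; apply/funext => w; apply: eq_bigr => e _.
  rewrite /entry; move: (h _) => a; by rewrite !exprMn exprD mulrACA.
- by move=> e; case: (bounded_borelX (k e + l e) bh).
- by move=> e; case: (bounded_borelM (bounded_borelX (k e) b1) (bounded_borelX (l e) b2)).
- by move=> e; case: (bounded_borelX (k e + l e) bh).
- by move=> e; case: (bounded_borelM (bounded_borelX (k e) b1) (bounded_borelX (l e) b2)).
Qed.

Variables (gamma M : R).
Hypothesis gamma0 : 0 < gamma.
Hypothesis M0 : 0 <= M.
Hypothesis momentM : forall tau, 0 <= tau -> mean P (trunc_pow gamma tau \o Z0) <= M.
Hypothesis tailM : forall x, 1 <= x -> abs_tail Z0 x <= M * x `^ (- gamma).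

Variables (p n : nat) (tau K D : R).
Hypothesis p0 : (0 < p)%N.
Hypothesis n0 : (0 < n)%N.
Hypothesis tau1 : 1 <= tau.
Hypothesis tauK : tau <= K.
Hypothesis D0 : 0 <= D.
Hypothesis pD : p%:R <= D.
Hypothesis npD : n%:R * p%:R <= D ^+ 2.

Let tau0 : 0 < tau. Proof. exact: lt_le_trans tau1. Qed.
Let K1 : 1 <= K. Proof. exact: le_trans tauK. Qed.
Let K0 : 0 <= K. Proof. exact: le_trans K1. Qed.

Let gB : R -> R := restr (cball tau).
Let gA : R -> R := restr (band tau K).

Let bounded_gB : bounded_borel gB.
Proof.
split; first by apply: measurable_restr; exact: measurable_cball.
by exists tau => x; apply: restr_bounded; [exact: subset_refl|exact: ltW].
Qed.

Let gA_bound x : `|gA x| <= K.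
Proof. by apply: restr_bounded => // z /= /andP[]. Qed.

Let bounded_gA : bounded_borel gA.
Proof.
split; last by exists K.
by apply: measurable_restr; exact: measurable_band.
Qed.

Hypothesis Dq_gamma : D * q <= tau `^ gamma.
Hypothesis Dq_sq : D * q <= tau ^+ 2.
Hypothesis Dq_or_centered : D * q <= tau \/ (1 <= gamma /\ ('E_P[Z0] = 0)%E).

Let S : R := Num.max s 1.
Let S1 : 1 <= S. Proof. by rewrite le_max lexx orbT. Qed.
Let sS : s <= S. Proof. by rewrite le_max lexx. Qed.

Let muB k := mean P (fun w => h (sigma0 w) ^+ k) * mean P (fun w => gB (Z0 w) ^+ k).

Let norm_mean_gB k : `|mean P (fun w => gB (Z0 w) ^+ k)| <=
  mean P (fun w => `|gB (Z0 w)| ^+ k).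
Proof.
have bg : bounded_mfun (fun w => gB (Z0 w)).
  by case: bounded_gB => ? ?; apply: (@bmf_comp _ _ _ _ gB).
rewrite (le_trans (norm_mean_le P (bmfX k bg)))//.
rewrite (_ : (fun w => _) = (fun w => `|gB (Z0 w)| ^+ k))//.
by apply/funext => w; rewrite normrX.
Qed.

(** These are the moments required by the walk expansion, with a base
    proportional to [tau]. For [k >= gamma] the truncation gives
    [tau^(k - gamma)] and [D q <= tau^gamma] suffices. Below [gamma] the moment
    is only bounded, and [D q <= tau^k] is needed: for [k >= 2] this follows
    from [D q <= tau^2], while [k = 1] requires either [D q <= tau] or
    centering. *)
Lemma small_entry_moment k : (0 < k)%N ->
  D * `|muB k| <= (S * (1 + M) * tau) ^+ k.
Proof.
move=> k0; rewrite /muB normrM.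
have hs := norm_mean_thinned_pow k0.
have target : S ^+ k * (1 + M) * tau ^+ k <= (S * (1 + M) * tau) ^+ k.
  rewrite !exprMn ler_wpM2r ?exprn_ge0 ?(ltW tau0)//.
  rewrite ler_wpM2l ?exprn_ge0 ?(le_trans _ S1)//.
  by case: k k0 {hs} => // k _; rewrite exprS ler_peMr ?addr_ge0// exprn_ege1// lerDl.
have sSk : s ^+ k <= S ^+ k by apply: lerXn2r => //; rewrite nnegrE// (le_trans _ S1).
suff [a [amean a0 aD]] : exists a, [/\ `|mean P (fun w => gB (Z0 w) ^+ k)| <= (1 + M) * a,
    0 <= a & D * q * a <= tau ^+ k].
  apply: le_trans target.
  apply: (@le_trans _ _ (D * (s ^+ k * q * ((1 + M) * a)))).
    by apply: ler_wpM2l => //; apply: ler_pM.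
  rewrite (_ : _ * _ = s ^+ k * (1 + M) * (D * q * a)); last by ring.
  apply: ler_pM => //; rewrite ?mulr_ge0 ?exprn_ge0 ?addr_ge0//.
  by apply: ler_wpM2r => //; rewrite addr_ge0.
have low_case : `|mean P (fun w => gB (Z0 w) ^+ k)| <= M * tau `^ (k%:R - gamma) ->
   exists a, [/\ `|mean P (fun w => gB (Z0 w) ^+ k)| <= (1 + M) * a,
    0 <= a & D * q * a <= tau ^+ k].
  move=> H; exists (tau `^ (k%:R - gamma)); split; last 2 first.
  - exact: powR_ge0.
  - rewrite -[leRHS]powR_mulrn ?(ltW tau0)// -[in leRHS](subrK gamma k%:R) [leRHS]powRDp//.
    by rewrite mulrC; apply: ler_wpM2l => //; exact: powR_ge0.
  apply: (le_trans H); apply: ler_wpM2r; first exact: powR_ge0.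
  by rewrite lerDr.
have [gk|kg] := leP gamma k%:R.
  apply: low_case; apply: (le_trans (norm_mean_gB k)).
  exact: mean_restr_pow_ge.
have high_case : D * q <= tau ^+ k ->
   exists a, [/\ `|mean P (fun w => gB (Z0 w) ^+ k)| <= (1 + M) * a,
    0 <= a & D * q * a <= tau ^+ k].
  move=> H; exists 1; split; rewrite ?mulr1//.
  apply: (le_trans (norm_mean_gB k)).
  exact: (mean_restr_pow_le gamma0 momentM (ltW kg)).
have [k1|k1] := leqP k 1.
  have kE : k = 1%N by apply/eqP; rewrite eqn_leq k1.
  case: Dq_or_centered => [Dt|[g1 EZ]]; first by apply: high_case; rewrite kE expr1.
  apply: low_case; rewrite kE (_ : (fun w => _) = (fun w => gB (Z0 w))).
    exact: mean_restr_centered.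
  by apply/funext => w; rewrite expr1.
by apply: high_case; apply: (le_trans Dq_sq); exact: ler_weXn2l.
Qed.

Let mat (Y : nat * nat -> T -> R) w : 'M[R]_(p, n) :=
  \matrix_(i < p, t < n) Y (i : nat, t : nat) w.
Let B := entry gB.
Let A := entry gA.

Let walk_count (h : nat) : R := ((h.*2.+1)%:R ^+ 2) ^+ h.

Lemma prob_small_part (r : nat) (y : R) : 0 < y ->
  (P [set w | (y < frob2 (off (sample_cov (mat B w)) ^+ (2 ^ r)))%R] <=
   (p%:R * ((S * (1 + M) * tau) ^+ (2 ^ r + 2 ^ r).*2 * walk_count (2 ^ r + 2 ^ r)) / y)%:E)%E.
Proof.
move=> y0.
pose F w := frob2 (off (sample_cov (mat B w)) ^+ (2 ^ r)).
have FE : F = fun w => \tr (off (sample_cov (mat B w)) ^+ (2 ^ r + 2 ^ r)).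
  by apply/funext => w; rewrite /F frob2_pow_trace//; exact: off_gram_sym.
have bB e : bounded_mfun (B e) by exact: bmf_entry.
have bF : bounded_mfun F by rewrite FE; exact: bmf_trace_pow.
apply: le_trans; first exact: (markov_mean P bF (fun w => frob2_ge0 _) y0).
rewrite lee_fin; apply: ler_wpM2r; first by rewrite invr_ge0 ltW.
rewrite FE; apply: (@mean_trace_pow _ _ _ _ p n B muB D) => //.
- move=> J k uJ; have := @mean_prod_entries gB gB J k (fun=> 0%N) bounded_gB bounded_gB uJ.
  under eq_fun do under eq_bigr do rewrite expr0 mulr1.
  move=> ->; apply: eq_bigr => e _; rewrite addn0; congr (_ * mean _ _).
  by apply/funext => w; rewrite expr0 mulr1.
- by rewrite !mulr_ge0 ?addr_ge0 ?(le_trans _ S1) ?(ltW tau0).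
- by move=> k /andP[k0 _]; exact: small_entry_moment.
Qed.

Let pi_ : R := M * tau `^ (- gamma).

Let pi_ge0 : 0 <= pi_. Proof. by rewrite mulr_ge0 ?powR_ge0. Qed.

(** A large entry is at most [K] and is rarely present at all. *)
Lemma mean_large_entry k : (0 < k)%N ->
  mean P (fun w => `|gA (Z0 w)| ^+ k) <= K ^+ k * pi_.
Proof.
move=> k0.
have bI : bounded_mfun (\1_[set w | tau < `|Z0 w|] : T -> R).
  by apply: bmf_indic; exact: measurable_abs_gt.
apply: (@le_trans _ _ (mean P (fun w => K ^+ k * \1_[set w | tau < `|Z0 w|] w))).
  apply: le_mean; [|exact: bmfZ|].
    apply: bmfX; apply: bmf_abs.
    by case: bounded_gA => ? ?; apply: (@bmf_comp _ _ _ _ gA).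
  move=> w; rewrite indicE; case: (ltP tau `|Z0 w|) => tw.
    by rewrite mem_set// mulr1; apply: lerXn2r; rewrite ?nnegrE.
  rewrite /gA /restr indicE [Z0 w \in _]memNset ?mulr0; last first.
    by rewrite /band /= => /andP[]; rewrite ltNge tw.
  by rewrite normr0 expr0n gtn_eqF// mulr_ge0 ?exprn_ge0.
rewrite meanZ//; apply: ler_wpM2l; first exact: exprn_ge0.
by rewrite mean_indic; [exact: tailM|exact: measurable_abs_gt].
Qed.

Let v : R := (1 + M) ^+ 2 * tau `^ (Num.max (2 - gamma) 0).

Lemma mean_small_entry_sq :
  mean P (fun w => `|gB (Z0 w)| ^+ 2) <= v /\
  (mean P (fun w => `|gB (Z0 w)| ^+ 1)) ^+ 2 <= v.
Proof.
have M1 : 1 <= 1 + M by rewrite lerDl.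
have pmono (x y : R) : x <= y -> tau `^ x <= tau `^ y by move=> xy; apply: ler_powR.
have k1 : 1 <= tau `^ (Num.max (2 - gamma) 0).
  by rewrite -(powRr0 tau); apply: pmono; rewrite le_max lexx orbT.
split.
  have [g2|g2] := leP gamma 2.
    apply: (le_trans (mean_restr_pow_ge gamma0 momentM g2 tau0)).
    apply: ler_pM => //; first exact: powR_ge0.
      by nra.
    by apply: pmono; rewrite le_max lexx.
  apply: (le_trans (mean_restr_pow_le gamma0 momentM (ltW g2) tau0)).
  by rewrite /v; nra.
have m0 : 0 <= mean P (fun w => `|gB (Z0 w)| ^+ 1).
  by apply: mean_ge0 => w; rewrite exprn_ge0.
have [g1|g1] := leP gamma 1.
  apply: (@le_trans _ _ ((M * tau `^ (1 - gamma)) ^+ 2)).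
    rewrite lerXn2r ?nnegrE ?mulr_ge0 ?powR_ge0//.
    exact: (@mean_restr_pow_ge _ _ _ _ _ _ gamma0 _ momentM 1%N tau g1 tau0).
  rewrite exprMn -[X in _ * X]powR_mulrn ?powR_ge0// -powRrM /v.
  apply: ler_pM; rewrite ?exprn_ge0 ?powR_ge0//.
    by rewrite lerXn2r ?nnegrE ?addr_ge0// lerDr.
  apply: pmono; rewrite le_max; apply/orP; left; rewrite mulr_natr mulr2n.
  by have := gamma0; lra.
apply: (@le_trans _ _ ((1 + M) ^+ 2)).
  rewrite lerXn2r ?nnegrE ?addr_ge0//.
  exact: (@mean_restr_pow_le _ _ _ _ _ _ gamma0 _ momentM 1%N tau (ltW g1) tau0).
by rewrite /v ler_peMr ?exprn_ge0 ?addr_ge0.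
Qed.

Let mAC (g1 g2 : R -> R) k l :=
  mean P (fun w => h (sigma0 w) ^+ (k + l)) *
  mean P (fun w => g1 (Z0 w) ^+ k * g2 (Z0 w) ^+ l).

Let Q : R := n%:R * p%:R * q * pi_.

Let Q_ge0 : 0 <= Q. Proof. by apply: mulr_ge0 => //; apply: mulr_ge0. Qed.

Let mean_sq_abs (g : R -> R) : mean P (fun w => g (Z0 w) ^+ 2) =
  mean P (fun w => `|g (Z0 w)| ^+ 2).
Proof.
by congr mean; apply/funext => w; rewrite real_normK// num_real.
Qed.

Let mean_1_abs (g : R -> R) : bounded_borel g -> (mean P (fun w => g (Z0 w) ^+ 1)) ^+ 2 <=
  (mean P (fun w => `|g (Z0 w)| ^+ 1)) ^+ 2.
Proof.
move=> [mg bg]; have bZ : bounded_mfun (fun w => g (Z0 w)) by exact: bmf_comp.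
rewrite -[leLHS]real_normK ?num_real// lerXn2r ?nnegrE//.
  by apply: mean_ge0 => w; rewrite exprn_ge0.
exact: norm_mean_le (bmfX 1 bZ).
Qed.

Let mAC_l g1 g2 k : mAC g1 g2 k 0 = mean P (fun w => h (sigma0 w) ^+ k) *
  mean P (fun w => g1 (Z0 w) ^+ k).
Proof.
by rewrite /mAC addn0; congr (_ * mean _ _); apply/funext => w; rewrite expr0 mulr1.
Qed.

Let mAC_r g1 g2 k : mAC g1 g2 0 k = mean P (fun w => h (sigma0 w) ^+ k) *
  mean P (fun w => g2 (Z0 w) ^+ k).
Proof.
by rewrite /mAC add0n; congr (_ * mean _ _); apply/funext => w; rewrite expr0 mul1r.
Qed.

Let entry_second_moment (g : R -> R) (a2 : R) : mean P (fun w => `|g (Z0 w)| ^+ 2) <= a2 ->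
  0 <= mean P (fun w => h (sigma0 w) ^+ 2) * mean P (fun w => g (Z0 w) ^+ 2)
    <= s ^+ 2 * q * a2.
Proof.
move=> ga; have hs := norm_mean_thinned_pow (isT : (0 < 2)%N).
have h0 : 0 <= mean P (fun w => h (sigma0 w) ^+ 2) by apply: mean_ge0 => w; exact: sqr_ge0.
rewrite mean_sq_abs; have g0 : 0 <= mean P (fun w => `|g (Z0 w)| ^+ 2).
  by apply: mean_ge0 => w; exact: sqr_ge0.
rewrite mulr_ge0//=; apply: ler_pM => //.
by move: hs; rewrite ger0_norm.
Qed.

Let entry_mean_sq (g : R -> R) (a1sq : R) : bounded_borel g ->
  (mean P (fun w => `|g (Z0 w)| ^+ 1)) ^+ 2 <= a1sq ->
  (mean P (fun w => h (sigma0 w) ^+ 1) * mean P (fun w => g (Z0 w) ^+ 1)) ^+ 2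
    <= s ^+ 2 * q ^+ 2 * a1sq.
Proof.
move=> bg ga; have hs := norm_mean_thinned_pow (isT : (0 < 1)%N).
rewrite exprMn (_ : s ^+ 2 * q ^+ 2 = (s * q) ^+ 2); last by rewrite exprMn.
apply: ler_pM; rewrite ?sqr_ge0//.
  rewrite -[leLHS]real_normK ?num_real// lerXn2r ?nnegrE ?mulr_ge0//.
exact: le_trans (mean_1_abs bg) ga.
Qed.

Let prob_cross (g1 g2 : R -> R) (a b e f c : R) : bounded_borel g1 -> bounded_borel g2 ->
  mean P (fun w => `|g1 (Z0 w)| ^+ 2) <= a ->
  (mean P (fun w => `|g1 (Z0 w)| ^+ 1)) ^+ 2 <= b ->
  mean P (fun w => `|g2 (Z0 w)| ^+ 2) <= e ->
  (mean P (fun w => `|g2 (Z0 w)| ^+ 1)) ^+ 2 <= f ->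
  0 < c ->
  (P [set w | (c < frob2 (cross (mat (entry g1) w) (mat (entry g2) w)))%R] <=
   (p%:R ^+ 2 * (n%:R * (s ^+ 2 * q * a * (s ^+ 2 * q * e)) +
      n%:R ^+ 2 * (s ^+ 2 * q ^+ 2 * b * (s ^+ 2 * q ^+ 2 * f))) / c)%:E)%E.
Proof.
move=> b1 b2 ga gb ge gf c0.
have be1 e' : bounded_mfun (entry g1 e') by exact: bmf_entry.
have be2 e' : bounded_mfun (entry g2 e') by exact: bmf_entry.
apply: le_trans.
  exact: (markov_mean P (bmf_frob2_cross p n be1 be2) (fun w => frob2_ge0 _) c0).
rewrite lee_fin; apply: ler_wpM2r; first by rewrite invr_ge0 ltW.
have /andP[a0 a2] := entry_second_moment ga; have /andP[e0 e2] := entry_second_moment ge.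
apply: le_trans.
  apply: (@mean_frob2_cross _ _ _ P p n _ _ (mAC g1 g2) be1 be2).
  - by move=> J k l uJ; exact: mean_prod_entries.
  - by rewrite mAC_l.
  - by rewrite mAC_r.
rewrite !mAC_l !mAC_r; apply: ler_wpM2l; first exact: exprn_ge0.
apply: lerD; apply: ler_wpM2l => //; first exact: ler_pM.
by apply: ler_pM; rewrite ?sqr_ge0//; exact: entry_mean_sq.
Qed.

Let large1 : (mean P (fun w => `|gA (Z0 w)| ^+ 1)) ^+ 2 <= K ^+ 2 * pi_ ^+ 2.
Proof.
rewrite -exprMn; apply: lerXn2r.
- by rewrite nnegrE; apply: mean_ge0 => w; rewrite exprn_ge0.
- by rewrite nnegrE; exact: mulr_ge0.
- exact: (mean_large_entry (isT : (0 < 1)%N)).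
Qed.

Lemma prob_cross_large_small c : 0 < c ->
  (P [set w | (c < frob2 (cross (mat A w) (mat B w)))%R] <=
   (s ^+ 4 * v * K ^+ 2 * (p%:R * q) * (Q * (1 + Q)) / c)%:E)%E.
Proof.
move=> c0; have [v2 v1] := mean_small_entry_sq.
apply: le_trans.
  exact: (prob_cross bounded_gA bounded_gB (mean_large_entry (isT : (0 < 2)%N)) large1 v2 v1 c0).
rewrite lee_fin; apply: ler_wpM2r; first by rewrite invr_ge0 ltW.
rewrite (_ : _ * _ = s ^+ 4 * v * K ^+ 2 * (p%:R * q) * (Q * (1 + n%:R * q ^+ 2 * pi_))).
  apply: ler_wpM2l; first by rewrite !mulr_ge0 ?exprn_ge0 ?addr_ge0 ?powR_ge0.
  apply: ler_wpM2l => //; rewrite lerD2l /Q; apply: ler_wpM2r => //.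
  rewrite -mulrA; apply: ler_wpM2l => //; rewrite expr2; apply: ler_wpM2r => //.
  by rewrite (le_trans q_le1)// ler1n.
rewrite /Q; ring.
Qed.

Lemma prob_cross_large_large c : 0 < c ->
  (P [set w | (c < frob2 (cross (mat A w) (mat A w)))%R] <=
   (s ^+ 4 * K ^+ 4 * (Q ^+ 2 / n%:R + Q ^+ 4 / n%:R ^+ 2) / c)%:E)%E.
Proof.
move=> c0.
apply: le_trans.
  exact: (prob_cross bounded_gA bounded_gA (mean_large_entry (isT : (0 < 2)%N)) large1
    (mean_large_entry (isT : (0 < 2)%N)) large1 c0).
rewrite lee_fin; apply: ler_wpM2r; first by rewrite invr_ge0 ltW.
have n0' : n%:R != 0 :> R by rewrite pnatr_eq0 -lt0n.
have p0' : p%:R != 0 :> R by rewrite pnatr_eq0 -lt0n.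
rewrite (_ : p%:R ^+ 2 * _ = s ^+ 4 * K ^+ 4 * (Q ^+ 2 / n%:R + Q ^+ 4 / (n%:R * p%:R) ^+ 2)).
  apply: ler_wpM2l; first by rewrite mulr_ge0 ?exprn_ge0.
  rewrite lerD2l; apply: ler_wpM2l; first exact: exprn_ge0.
  have np0 : 0 < n%:R :> R by rewrite ltr0n.
  have pp0 : 1 <= p%:R :> R by rewrite ler1n.
  rewrite lef_pV2 ?posrE ?exprn_gt0 ?mulr_gt0 ?(lt_le_trans _ pp0)//.
  by rewrite lerXn2r ?nnegrE ?mulr_ge0// ler_peMr// ltW.
by rewrite /Q; field; rewrite n0' p0'.
Qed.

Let chiK : R -> R := \1_[set z | K < `|z|].

Let chi_s : R -> R := \1_[set x | s < x].

Let chi0 : R -> R := \1_[set x | x != 0].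

Let bounded_indic (C : set R) : measurable C -> bounded_borel (\1_C : R -> R).
Proof.
move=> mC; split; first exact: measurable_indic.
by exists 1 => x; rewrite indicE; case: (_ \in _); rewrite ?normr1 ?normr0.
Qed.

Let bounded_chiK : bounded_borel chiK.
Proof.
apply: bounded_indic; rewrite -[X in measurable X]setTI; apply: measurable_fun_ltr => //.
Qed.

Let bounded_chi_s : bounded_borel chi_s.
Proof.
apply: bounded_indic; rewrite -[X in measurable X]setTI; apply: measurable_fun_ltr => //.
Qed.

Let bounded_chi0 : bounded_borel chi0.
Proof.
apply: bounded_indic; have -> : [set x : R | x != 0] = ~` [set 0].
  by apply/seteqP; split => w /=; [move=> /eqP|move=> /eqP].
exact: measurableC.
Qed.

Let bad (e : nat * nat) (w : T) : R :=
  chi_s (sigma e w) + chi0 (sigma e w) * chiK (Z e w).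

Let bmf_bb (g : R -> R) (X : {RV P >-> R}) : bounded_borel g ->
  bounded_mfun (fun w => g (X w)).
Proof. by move=> [mg bg]; apply: (@bmf_comp _ _ _ _ g). Qed.

Let bmf_bad e : bounded_mfun (bad e).
Proof. by apply: bmfD; [exact: bmf_bb|apply: bmfM; exact: bmf_bb]. Qed.

Let mean_bad e : mean P (bad e) = q * abs_tail Z0 K.
Proof.
have bb1 : bounded_borel (cst 1 : R -> R).
  by split; [exact: measurable_cst|exists 1 => x; rewrite normr1].
have prod1 (f g : R -> R) : bounded_borel f -> bounded_borel g ->
    mean P (fun w => f (sigma e w) * g (Z e w)) =
    mean P (fun w => f (sigma0 w)) * mean P (fun w => g (Z0 w)).
  move=> [mf bf] [mg bg].
  have := @mean_prod_fields _ _ _ P _ sigma Z sigma0 Z0 iid_sigma iid_Z indep_sigma_Z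
    [:: e] (fun=> f) (fun=> g) isT (fun=> mf) (fun=> mg) (fun=> bf) (fun=> bg).
  rewrite big_seq1 => <-; congr mean; apply/funext => w; by rewrite big_seq1.
rewrite meanD; [|exact: bmf_bb|by apply: bmfM; exact: bmf_bb].
rewrite (prod1 chi0 chiK)//.
have -> : mean P (fun w => chi_s (sigma e w)) = 0.
  have := prod1 chi_s (cst 1) bounded_chi_s bb1; rewrite (_ : mean P (fun w => cst 1 (Z0 w)) = 1).
    rewrite mulr1 (_ : (fun w => _ * _) = (fun w => chi_s (sigma e w))); last first.
      by apply/funext => w; rewrite mulr1.
    move=> ->; rewrite -sigma_le_s -mean_indic//.
    by rewrite -[X in measurable X]setTI; apply: measurable_fun_ltr.
  exact: mean_cst.
rewrite add0r; congr (_ * _).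
  by rewrite /q -mean_indic; [|exact: measurable_neq0].
by rewrite /abs_tail -mean_indic; [|exact: measurable_abs_gt].
Qed.

(** Every entry that has to be excluded adds at least one to [Fbad], so on the
    event [Fbad <= 1/2] no entry is excluded. *)
Let Fbad (w : T) : R := \sum_(i < p) \sum_(t < n) bad (i : nat, t : nat) w.

Let bad_ge0 e w : 0 <= bad e w.
Proof. by rewrite /bad /chi_s /chi0 /chiK addr_ge0 ?mulr_ge0. Qed.

Let bmf_Fbad : bounded_mfun Fbad.
Proof. by do 2 (apply: bmf_sum => ? _). Qed.

Lemma prob_bad_event :
  (P [set w | (2^-1 < Fbad w)%R] <=
   (2 * (n%:R * p%:R * q * (M * K `^ (- gamma))))%:E)%E.
Proof.
apply: le_trans.
  apply: (markov_mean P bmf_Fbad _ (_ : 0 < 2^-1)) => // w.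
  by do 2 (apply: sumr_ge0 => ? _).
rewrite lee_fin invrK mulrC; apply: ler_wpM2l => //.
rewrite mean_sum; last by move=> i _; apply: bmf_sum.
under eq_bigr do rewrite mean_sum//.
under eq_bigr do under eq_bigr do rewrite mean_bad.
under eq_bigr do rewrite sumr_const card_ord.
rewrite sumr_const card_ord -mulrnA -[leLHS]mulr_natl natrM -[leRHS]mulrA.
apply: ler_wpM2l; first by rewrite mulr_ge0.
by apply: ler_wpM2l => //; exact: tailM.
Qed.

Let good_entry e w : bad e w = 0 -> sigma e w * Z e w = B e w + A e w.
Proof.
rewrite /bad => /eqP; rewrite paddr_eq0 ?mulr_ge0 /chi_s /chi0 /chiK// => /andP[/eqP h1 /eqP h2].
rewrite /B /A /entry -mulrDr.
have [w0|wn0] := eqVneq (sigma e w) 0.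
  by rewrite w0 /h /restr !mul0r.
have -> : h (sigma e w) = sigma e w.
  rewrite /h /restr indicE mem_set ?mulr1// /cball /= ger0_norm//.
  rewrite leNgt; apply/negP => sw; move: h1; rewrite indicE mem_set//.
  by move/eqP; rewrite oner_eq0.
move: h2; rewrite indicE mem_set// mul1r => h2.
have ZK : `|Z e w| <= K.
  rewrite leNgt; apply/negP => sw; move: h2; rewrite indicE mem_set//.
  by move/eqP; rewrite oner_eq0.
congr (_ * _); rewrite /gB /gA /restr -mulrDr !indicE.
have [zt|zt] := leP `|Z e w| tau.
  by rewrite mem_set// memNset ?addr0 ?mulr1// /band /= ltNge zt.
by rewrite memNset ?mem_set ?add0r ?mulr1// /band/cball /=; [rewrite zt|rewrite leNgt zt].
Qed.

Let good_matrix w : ~ 2^-1 < Fbad w ->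
  data_matrix sigma Z p n w = mat B w + mat A w.
Proof.
move=> Fw; apply/matrixP => i t; rewrite !mxE; apply: good_entry.
have b_le : bad (i : nat, t : nat) w <= Fbad w.
  rewrite /Fbad (bigD1 i)//= (bigD1 t)//= -addrA lerDl addr_ge0//.
    by apply: sumr_ge0.
  by apply: sumr_ge0 => ? _; apply: sumr_ge0.
have : bad (i : nat, t : nat) w <= 2^-1.
  by rewrite (le_trans b_le)// leNgt; apply/negP.
rewrite /bad /chi_s /chi0 /chiK !indicE.
case: (_ \in _); case: (_ \in _); case: (_ \in _) => /=; lra.
Qed.

Let measurable_frob (X : nat * nat -> T -> R) k :
  (forall e, measurable_fun setT (X e)) ->
  measurable_fun setT (fun w => frob2 (off (sample_cov (mat X w)) ^+ k)).
Proof.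
move=> mX.
have mM i j : measurable_fun setT (fun w => off (sample_cov (mat X w)) i j).
  rewrite (_ : (fun w => _) = fun w => if i == j then 0 else
     \sum_(t < n) X (i : nat, t : nat) w * X (j : nat, t : nat) w).
    case: eqP => _; first exact: measurable_cst.
    by apply: measurable_sum => t; exact: measurable_funM.
  apply/funext => w; rewrite off_gramE; case: eqP => // _.
  by apply: eq_bigr => t _; rewrite !mxE.
have mMk i j : measurable_fun setT (fun w => (off (sample_cov (mat X w)) ^+ k) i j).
  elim: k i j => [|k IH] i j.
    by under eq_fun do rewrite expr0 mxE; exact: measurable_cst.
  rewrite (_ : (fun w => _) = fun w => \sum_x off (sample_cov (mat X w)) i x *
     (off (sample_cov (mat X w)) ^+ k) x j).
    by apply: measurable_sum => x; exact: measurable_funM.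
  by apply/funext => w; rewrite exprS -mulmxE mxE.
by apply: measurable_sum => i; apply: measurable_sum => j; exact: measurable_funX.
Qed.

Lemma measurable_spectral_gt c : 0 <= c ->
  measurable [set w | c < spectral_norm (off (sample_cov (data_matrix sigma Z p n w)))].
Proof.
move=> c0.
pose X e w := sigma e w * Z e w.
rewrite (_ : [set w | _] = \bigcup_r [set w | p%:R * (c ^+ 2) ^+ (2 ^ r) <
    frob2 (off (sample_cov (mat X w)) ^+ (2 ^ r))]).
  apply: bigcupT_measurable => r; rewrite -[X in measurable X]setTI.
  apply: measurable_fun_ltr => //; apply: measurable_frob => e.
  exact: measurable_funM.
apply/seteqP; split => w /=.
  by move/(spectral_norm_gtP (off_gram_sym _) c0) => -[r Hr]; exists r.
by move=> [r _ Hr]; apply/(spectral_norm_gtP (off_gram_sym _) c0); exists r.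
Qed.

(** Outside four exceptional events the matrix is the off-diagonal part of the
    Gram matrix of the small entries, which the high moments control, plus three
    pieces involving a large entry, which the Frobenius norm controls. Two of
    these pieces are transposes of each other and share an event. *)
Lemma prob_spectral_gt (r : nat) (c : R) : 0 < c ->
  (P [set w | (4 * c < spectral_norm (off (sample_cov (data_matrix sigma Z p n w))))%R] <=
   (2 * (n%:R * p%:R * q * (M * K `^ (- gamma))) +
    p%:R * ((S * (1 + M) * tau) ^+ (2 ^ r + 2 ^ r).*2 * walk_count (2 ^ r + 2 ^ r))
      / (c ^+ 2) ^+ (2 ^ r) +
    s ^+ 4 * v * K ^+ 2 * (p%:R * q) * (Q * (1 + Q)) / c ^+ 2 +
    s ^+ 4 * K ^+ 4 * (Q ^+ 2 / n%:R + Q ^+ 4 / n%:R ^+ 2) / c ^+ 2)%:E)%E.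
Proof.
move=> c0; have c20 : 0 < c ^+ 2 by rewrite exprn_gt0.
have y0 : 0 < (c ^+ 2) ^+ (2 ^ r) by rewrite exprn_gt0.
have bB e : bounded_mfun (B e) by exact: bmf_entry.
have bA e : bounded_mfun (A e) by exact: bmf_entry.
pose E0 := [set w | (2^-1 < Fbad w)%R].
pose E1 := [set w | ((c ^+ 2) ^+ (2 ^ r) < frob2 (off (sample_cov (mat B w)) ^+ (2 ^ r)))%R].
pose E2 := [set w | (c ^+ 2 < frob2 (cross (mat A w) (mat B w)))%R].
pose E3 := [set w | (c ^+ 2 < frob2 (cross (mat A w) (mat A w)))%R].
have mgt (f : T -> R) x : measurable_fun setT f -> measurable [set w | (x < f w)%R].
  by move=> mf; rewrite -[X in measurable X]setTI; apply: measurable_fun_ltr.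
have m0 : measurable E0 by apply: mgt; case: bmf_Fbad.
have m1 : measurable E1 by apply: mgt; apply: measurable_frob => e; case: (bB e).
have m2 : measurable E2 by apply: mgt; case: (bmf_frob2_cross p n bA bB).
have m3 : measurable E3 by apply: mgt; case: (bmf_frob2_cross p n bA bA).
apply: (@le_trans _ _ (P (E0 `|` E1 `|` E2 `|` E3))).
  apply: le_measure.
  - by apply/mem_set; apply: measurable_spectral_gt; rewrite mulr_ge0// ltW.
  - by apply/mem_set; do 3 apply: measurableU => //.
  move=> w /= Hw; apply: contrapT => /not_orP[/not_orP[/not_orP[w0 w1] w2] w3].
  move: Hw; rewrite ltNge => /negP; apply.
  rewrite good_matrix// off_gramD.
  apply: (@spectral_norm_add4 _ _ _ _ _ _ _ r); rewrite ?(ltW c0)//.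
  - exact: off_gram_sym.
  - by rewrite leNgt; apply/negP.
  - by rewrite leNgt; apply/negP.
  - by rewrite -cross_trmx frob2_trmx leNgt; apply/negP.
  - by rewrite leNgt; apply/negP.
apply: (le_trans (measureU2 _ _ m3)); first by do 2 apply: measurableU => //.
rewrite EFinD; apply: leeD; last exact: prob_cross_large_large.
apply: (le_trans (measureU2 _ _ m2)); first by apply: measurableU.
rewrite EFinD; apply: leeD; last exact: prob_cross_large_small.
apply: (le_trans (measureU2 _ m0 m1)).
by rewrite EFinD; apply: leeD; [exact: prob_bad_event|exact: prob_small_part].
Qed.

End FixedSize.

(** * Exceptional probabilities as powers of the normalization *)
Section Regime.
Variable R : realType.

(** With [Q] of order [b^(delta alpha)], the four terms have the orders
    [b^(- delta alpha)], [b^(alpha + 1 - 4 N delta)],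
    [b^(max (2 - alpha) 0 + alpha / 2 - 2)] and [b^(- alpha / 4)] up to factors
    [b^(O(delta))]. The first is small because [K] exceeds [b] by a power, the
    second because [tau] is below [b] by a power and [N] is large; the third
    exponent is negative exactly because [0 < alpha < 4] and equals minus half
    the smaller of [alpha] and [4 - alpha]. The requirements on [delta]
    make these main exponents dominate the [O(delta)]; the slack [eta] is a
    fraction of [delta * alpha], so that the first exponent stays negative. *)
Lemma error_terms_le (alpha delta eta M e s S C b n p q gamma tau K c v Q : R) (N : nat) :
  0 < alpha < 4 -> 0 < delta ->
  100 * delta <= alpha -> 100 * delta <= `|2 - alpha| -> 100 * delta <= 4 - alpha ->
  eta = delta * alpha / 8 ->
  0 <= M -> 0 < e -> 0 <= C -> 0 <= S ->
  alpha + 2 <= 4 * N%:R * delta ->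
  1 <= b -> 1 <= n -> 0 <= p -> 0 <= q ->
  n * p * q <= b `^ (alpha + eta) -> p <= b `^ (alpha + 1) ->
  p * q <= b `^ (alpha / 2 + eta) -> b `^ (alpha / 4) <= n ->
  gamma = alpha - eta -> tau = b `^ (1 - delta) -> K = b `^ (1 + delta) ->
  c = e * b ^+ 2 -> v = (1 + M) ^+ 2 * tau `^ (Num.max (2 - gamma) 0) ->
  Q = n * p * q * (M * tau `^ (- gamma)) ->
  2 * (n * p * q * (M * K `^ (- gamma))) +
    p * ((S * (1 + M) * tau) ^+ (N + N).*2 * C) / (c ^+ 2) ^+ N +
    s ^+ 4 * v * K ^+ 2 * (p * q) * (Q * (1 + Q)) / c ^+ 2 +
    s ^+ 4 * K ^+ 4 * (Q ^+ 2 / n + Q ^+ 4 / n ^+ 2) / c ^+ 2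
  <= (2 * M + (S * (1 + M)) ^+ (N + N).*2 * C / (e ^+ 2) ^+ N +
      s ^+ 4 * ((1 + M) ^+ 2 * (M * (1 + M)) + (M ^+ 2 + M ^+ 4)) / e ^+ 2)
     * b `^ (- (delta * alpha / 4)).
Proof.
move=> /andP[al0 al4] d0 d1 d2 d3 etaE M0 e0 C0 S0 Nd b1 n1 p0 q0 npq pb pq nb.
move=> gE tE KE cE vE QE.
have bpos : 0 < b by exact: lt_le_trans b1.
have da : delta * alpha <= 4 * delta by nra.
have da0 : 0 < delta * alpha by exact: mulr_gt0.
have eta0 : 0 < eta by rewrite etaE; lra.
have etad : eta <= delta / 2 by rewrite etaE; lra.
have g0 : 0 < gamma by rewrite gE; lra.
have g4 : gamma <= 4 by rewrite gE; lra.
have dg0 : 0 < delta * gamma by exact: mulr_gt0.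
have dg : delta * gamma <= 4 * delta by nra.
have dle1 : delta <= 1 / 25 by lra.
have de : delta * eta <= delta * alpha / 8.
  by rewrite etaE; nra.
have dgE : delta * gamma = delta * alpha - delta * eta by rewrite gE; ring.
pose pw (x : R) := b `^ x.
have pwD x y : pw (x + y) = pw x * pw y by rewrite /pw powRDp.
have pw0 x : 0 < pw x by exact: powR_gt0.
have pwle x y : x <= y -> pw x <= pw y by move=> xy; apply: ler_powR.
have pwN x : pw (- x) = (pw x)^-1 by rewrite /pw powRN.
have pwX x k : pw x ^+ k = pw (x * k%:R).
  by rewrite /pw powRrM powR_mulrn ?powR_ge0.
have pwR x y : pw x `^ y = pw (x * y) by rewrite /pw powRrM.
have b2E : b ^+ 2 = pw 2 by rewrite /pw powR_mulrn ?ltW.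
have c2E : c ^+ 2 = e ^+ 2 * pw 4.
  by rewrite cE exprMn b2E pwX; congr (_ * pw _); lra.
set rho := delta * alpha / 4.
rewrite -/(pw _) in tE KE.
have npq0 : 0 <= n * p * q by rewrite !mulr_ge0 ?(le_trans _ n1).
pose a := 2 * eta + delta * gamma.
have a0 : 0 < a by rewrite /a; lra.
have a5 : a <= 5 * delta by rewrite /a; lra.
have Q0 : 0 <= Q by rewrite QE !mulr_ge0 ?powR_ge0 ?(le_trans _ n1).
have Qle : Q <= M * pw a.
  rewrite QE mulrCA; apply: ler_wpM2l => //.
  rewrite tE pwR; apply: (@le_trans _ _ (pw (alpha + eta) * pw ((1 - delta) * - gamma))).
    by apply: ler_wpM2r => //; exact: ltW.
  by rewrite -pwD; apply: pwle; rewrite /a gE; lra.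
have pwa1 : 1 <= pw a by rewrite -(powRr0 b); apply: pwle; exact: ltW.
have Q1le : 1 + Q <= (1 + M) * pw a.
  by rewrite mulrDl mul1r; apply: lerD.
have s4 : 0 <= s ^+ 4 by rewrite (_ : 4 = 2 * 2)%N// exprM exprn_even_ge0.
have e2 : 0 < e ^+ 2 by rewrite exprn_gt0.
have T1 : 2 * (n * p * q * (M * K `^ (- gamma))) <= 2 * M * pw (- rho).
  rewrite -[leRHS]mulrA; apply: ler_wpM2l => //; rewrite mulrCA; apply: ler_wpM2l => //.
  rewrite KE pwR; apply: (@le_trans _ _ (pw (alpha + eta) * pw ((1 + delta) * - gamma))).
    by apply: ler_wpM2r => //; exact: ltW.
  by rewrite -pwD; apply: pwle; rewrite /rho; lra.
have T2 : p * ((S * (1 + M) * tau) ^+ (N + N).*2 * C) / (c ^+ 2) ^+ N <=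
    (S * (1 + M)) ^+ (N + N).*2 * C / (e ^+ 2) ^+ N * pw (- rho).
  rewrite c2E; move: (e ^+ 2) e2 => E2 E20.
  rewrite !exprMn tE !pwX invfM -[(pw _)^-1]pwN.
  set u := S ^+ _; set w := (1 + M) ^+ _; set z := (E2 ^+ N)^-1.
  rewrite (_ : p * _ * _ = u * w * C * z * (p * pw ((1 - delta) * (N + N).*2%:R) *
    pw (- (4 * N%:R)))); last by ring.
  have u0 : 0 <= u by rewrite exprn_ge0.
  have w0 : 0 <= w by rewrite exprn_ge0// addr_ge0.
  have z0 : 0 <= z by rewrite invr_ge0 exprn_ge0// ltW.
  apply: ler_wpM2l; first by rewrite !mulr_ge0.
  apply: (@le_trans _ _ (pw (alpha + 1) * pw ((1 - delta) * (N + N).*2%:R) * pw (- (4 * N%:R)))).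
    by do 2 (apply: ler_wpM2r; first exact: ltW).
  rewrite -!pwD; apply: pwle; rewrite -addnn !natrD.
  by rewrite /rho; lra.
have T3 : s ^+ 4 * v * K ^+ 2 * (p * q) * (Q * (1 + Q)) / c ^+ 2 <=
    s ^+ 4 * ((1 + M) ^+ 2 * (M * (1 + M))) / e ^+ 2 * pw (- rho).
  rewrite c2E [(e ^+ 2 * _)^-1]invfM -[(pw _)^-1]pwN KE pwX.
  pose kappa := Num.max (2 - gamma) 0.
  have kappa0 : 0 <= kappa by rewrite le_max lexx orbT.
  have vle : v <= (1 + M) ^+ 2 * pw kappa.
    rewrite vE; apply: ler_wpM2l; first exact: sqr_ge0.
    by rewrite tE pwR; apply: pwle; rewrite -/kappa; nra.
  have kle : kappa + 2 * delta + alpha / 2 + eta + 2 * a - 2 <= - rho.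
    rewrite /kappa /rho gE; case: (leP (2 - (alpha - eta)) 0) => hg.
      by lra.
    have al2 : alpha < 2.
      rewrite ltNge; apply/negP => a2; move: d2.
      by rewrite ler0_norm; lra.
    by lra.
  have v0 : 0 <= v by rewrite vE mulr_ge0 ?sqr_ge0 ?powR_ge0.
  rewrite (_ : _ / _ * _ = s ^+ 4 / e ^+ 2 * (((1 + M) ^+ 2 * pw kappa) * pw ((1 + delta) * 2%:R) *
    pw (alpha / 2 + eta) * ((M * pw a) * ((1 + M) * pw a)) * pw (- 4)) *
    pw (- rho - (kappa + 2 * delta + alpha / 2 + eta + 2 * a - 2))); last first.
    have -> : pw (- rho) = pw kappa * pw ((1 + delta) * 2%:R) * pw (alpha / 2 + eta) * pw a * pw a *
       pw (- 4) * pw (- rho - (kappa + 2 * delta + alpha / 2 + eta + 2 * a - 2)).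
      by rewrite -!pwD; congr pw; lra.
    by ring.
  rewrite (_ : s ^+ 4 * _ * _ * _ * _ * _ = s ^+ 4 / e ^+ 2 *
    (v * pw ((1 + delta) * 2%:R) * (p * q) * (Q * (1 + Q)) * pw (- 4))); last by ring.
  apply: (@le_trans _ _ (s ^+ 4 / e ^+ 2 * (((1 + M) ^+ 2 * pw kappa) * pw ((1 + delta) * 2%:R) *
    pw (alpha / 2 + eta) * ((M * pw a) * ((1 + M) * pw a)) * pw (- 4)))).
    apply: ler_wpM2l; first exact: (divr_ge0 s4 (ltW e2)).
    apply: ler_wpM2r; first exact: ltW.
    have pwn0 x : 0 <= pw x by exact: ltW.
    have Q10 : 0 <= 1 + Q by rewrite addr_ge0.
    apply: ler_pM; [by rewrite !mulr_ge0|exact: mulr_ge0| |exact: ler_pM].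
    apply: ler_pM; [exact: mulr_ge0|exact: mulr_ge0| |by []].
    exact: ler_wpM2r.
  have pwn0 x : 0 <= pw x by exact: ltW.
  have M1 : 0 <= 1 + M by rewrite addr_ge0.
  apply: ler_peMr; last by rewrite -[leLHS](powRr0 b); apply: pwle; lra.
  by repeat (apply: mulr_ge0 => //); rewrite ?invr_ge0 ?sqr_ge0.
have T4 : s ^+ 4 * K ^+ 4 * (Q ^+ 2 / n + Q ^+ 4 / n ^+ 2) / c ^+ 2 <=
    s ^+ 4 * (M ^+ 2 + M ^+ 4) / e ^+ 2 * pw (- rho).
  rewrite c2E [(e ^+ 2 * _)^-1]invfM -[(pw _)^-1]pwN KE pwX.
  have npos : 0 < n by exact: lt_le_trans n1.
  have ninv : n^-1 <= pw (- (alpha / 4)).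
    by rewrite pwN lef_pV2 ?posrE.
  have n2inv : (n ^+ 2)^-1 <= n^-1.
    by rewrite lef_pV2 ?posrE ?exprn_gt0// expr2 ler_peMr// ltW.
  have inner : Q ^+ 2 / n + Q ^+ 4 / n ^+ 2 <= (M ^+ 2 + M ^+ 4) * pw (4 * a) * pw (- (alpha / 4)).
    have Mp0 : 0 <= M * pw a by rewrite mulr_ge0// ltW.
    have Q2 : Q ^+ 2 <= M ^+ 2 * pw (4 * a).
      apply: (@le_trans _ _ ((M * pw a) ^+ 2)); first by apply: lerXn2r; rewrite ?nnegrE.
      by rewrite exprMn pwX; apply: ler_wpM2l; rewrite ?exprn_ge0//; apply: pwle; lra.
    have Q4 : Q ^+ 4 <= M ^+ 4 * pw (4 * a).
      apply: (@le_trans _ _ ((M * pw a) ^+ 4)); first by apply: lerXn2r; rewrite ?nnegrE.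
      by rewrite exprMn pwX; apply: ler_wpM2l; rewrite ?exprn_ge0//; apply: pwle; lra.
    rewrite -[leRHS]mulrA [leRHS]mulrDl !(mulrA _ (pw _)); apply: lerD.
      by apply: ler_pM; [exact: exprn_ge0|rewrite invr_ge0; exact: ltW|exact: Q2|exact: ninv].
    apply: ler_pM; [exact: exprn_ge0| |exact: Q4|exact: le_trans ninv].
    by rewrite invr_ge0; apply: exprn_ge0; exact: ltW.
  rewrite (_ : s ^+ 4 * _ * _ * _ = s ^+ 4 / e ^+ 2 * (pw ((1 + delta) * 4%:R) *
    (Q ^+ 2 / n + Q ^+ 4 / n ^+ 2) * pw (- 4))); last by ring.
  rewrite (_ : s ^+ 4 * _ / _ * _ = s ^+ 4 / e ^+ 2 * ((M ^+ 2 + M ^+ 4) * pw (- rho))); last by ring.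
  apply: ler_wpM2l; first exact: (divr_ge0 s4 (ltW e2)).
  apply: (@le_trans _ _ (pw ((1 + delta) * 4%:R) *
    ((M ^+ 2 + M ^+ 4) * pw (4 * a) * pw (- (alpha / 4))) * pw (- 4))).
    by apply: ler_wpM2r; [exact: ltW|apply: ler_wpM2l => //; exact: ltW].
  rewrite (_ : _ * _ = (M ^+ 2 + M ^+ 4) * (pw ((1 + delta) * 4%:R) * pw (4 * a) *
     pw (- (alpha / 4)) * pw (- 4))); last by ring.
  apply: ler_wpM2l; first by rewrite addr_ge0 ?exprn_ge0.
  by rewrite -!pwD; apply: pwle; rewrite /rho; lra.
move: T1 T2 T3 T4; rewrite -/(pw _).
move: (_ ^+ (N + N).*2 * C / (e ^+ 2) ^+ N) => u.
move: (pw (- rho)) => y T1 T2 T3 T4.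
rewrite [leRHS](_ : _ = 2 * M * y + u * y +
  s ^+ 4 * ((1 + M) ^+ 2 * (M * (1 + M))) / e ^+ 2 * y +
  s ^+ 4 * (M ^+ 2 + M ^+ 4) / e ^+ 2 * y); last by ring.
by apply: lerD => //; apply: lerD => //; apply: lerD.
Qed.

End Regime.

(** * The limit theorem *)
Section LimitLemmas.
Variable R : realType.

Lemma cvg0_of_negative_power (b : nat -> R) (C rho : R) : 0 <= C -> 0 < rho ->
  (forall B, \forall n \near \oo, B <= b n) ->
  (C * b n `^ (- rho))%:E @[n --> \oo] --> 0%E.
Proof.
move=> C0 rho0 b_infty; apply/fine_cvgP; split; first exact: nearW.
apply/cvgr0Pnorm_le => e e0.
have [X HX] := eventually_le_powR (C / e) rho0.
near=> n.
have : Num.max X 1 <= b n by near: n; exact: b_infty.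
rewrite ge_max => /andP[bX b1]; have b0 : 0 < b n by exact: lt_le_trans b1.
rewrite /= ger0_norm; last by rewrite mulr_ge0 ?powR_ge0.
rewrite powRN ler_pdivrMr ?powR_gt0// mulrC -ler_pdivrMr//; exact: HX.
Unshelve. all: by end_near. Qed.

Lemma eventually_ge_of_cvg_gt0 (u : nat -> R) (l : \bar R) : (0 < l)%E ->
  (u n)%:E @[n --> \oo] --> l ->
  exists2 c, 0 < c & \forall n \near \oo, c <= u n.
Proof.
case: l => [l| |]//; last first.
  move=> _ /cvgeyPge H; exists 1 => //.
  by apply: filterS (H 1) => n; rewrite lee_fin.
rewrite lte_fin => l0 /fine_cvgP[_ /cvgrPdist_lt /(_ (l / 2))].
rewrite divr_gt0// => /(_ isT) H; exists (l / 2); first by rewrite divr_gt0.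
by apply: filterS H => n /=; rewrite ltr_distlC => /andP[h1 h2]; lra.
Qed.

Lemma polynomial_growth_of_regular_variation (p : nat -> nat) (beta : R) (l : R -> R) :
  slowly_varying l -> beta <= 1 ->
  (forall n, (0 < n)%N -> (p n)%:R = n%:R `^ beta * l n%:R) ->
  forall zeta : R, 0 < zeta -> \forall n \near \oo, ((p n)%:R : R) <= n%:R `^ (1 + zeta).
Proof.
move=> sv b1 pE zeta z0; have [X HX] := slowly_varying_power_bounds sv z0.
exists (Num.truncn X).+1 => // n /= Xn.
have n0 : (0 < n)%N by exact: leq_trans Xn.
have n1 : 1 <= n%:R :> R by rewrite ler1n.
have nX : X <= n%:R by rewrite (le_trans (ltW (truncnS_gt X)))// ler_nat.
rewrite pE// powRDp; last by exact: lt_le_trans n1.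
have /andP[h1 h2] := HX _ nX.
apply: ler_pM => //; first by apply: le_trans h1; exact: powR_ge0.
exact: ler_powR.
Qed.

End LimitLemmas.

(** Below the threshold [X] the bound holds because a probability is at most one. *)
Lemma power_tail_bound d (T : measurableType d) (R : realType) (P : probability T R)
    (Z : {RV P >-> R}) (alpha eta X : R) : 0 < alpha - eta ->
  (forall x, X <= x -> x `^ (- (alpha + eta)) <= abs_tail Z x <= x `^ (- (alpha - eta))) ->
  exists2 C, 0 <= C & forall x, 1 <= x -> abs_tail Z x <= C * x `^ (- (alpha - eta)).
Proof.
move=> g0 HX; pose B := Num.max X 1.
have B1 : 1 <= B by rewrite le_max lexx orbT.
have B0 : 0 < B by exact: lt_le_trans B1.
exists (B `^ (alpha - eta)); first exact: powR_ge0.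
move=> x x1; have x0 : 0 < x by exact: lt_le_trans x1.
have [Bx|xB] := leP B x.
  have /andP[_ h] : x `^ (- (alpha + eta)) <= abs_tail Z x <= x `^ (- (alpha - eta)).
    by apply: HX; apply: le_trans Bx; rewrite le_max lexx.
  apply: (le_trans h); rewrite ler_peMl ?powR_ge0// -[leLHS](powRr0 B).
  by apply: ler_powR => //; exact: ltW.
apply: (le_trans (abs_tail_le1 Z x)).
rewrite powRN ler_pdivlMr ?powR_gt0// mul1r.
by apply: ler_powRl; exact: ltW.
Qed.

Theorem theorem4p3 (d : measure_display) (T : measurableType d) (R : realType)
    (P : probability T R)
    (Z : nat * nat -> {RV P >-> R}) (Zgen : {RV P >-> R})
    (sigma : nat -> nat * nat -> {RV P >-> R}) (sigmagen : nat -> {RV P >-> R})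
    (p : nat -> nat) (b : nat -> R)
    (alpha qplus qminus : R) (L : R -> R)
    (beta : R) (l : R -> R)
    (m : nat) (s : 'I_m.+1 -> R) (q : nat -> 'I_m.+1 -> R) :
  iid Z Zgen ->
  (forall n, (0 < n)%N -> iid (sigma n) (sigmagen n)) ->
  (forall n, (0 < n)%N ->
     (forall k w, 0 <= sigma n k w) /\ (forall w, 0 <= sigmagen n w)) ->
  (forall n, (0 < n)%N -> independent_families (sigma n) Z) ->
  (* normalization *)
  (forall n, (0 < n)%N -> 0 < b n) ->
  ((n%:R * (p n)%:R)%:E * 'E_P[(fun w => (sigmagen n w `^ alpha)%R)]
     * P [set w | (b n < `|Zgen w|)%R])%E @[n --> \oo] --> 1%E ->
  (* (1) *)
  (0 < alpha < 2) || (2 < alpha < 4) ->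
  0 <= qplus -> 0 <= qminus -> qplus + qminus = 1 ->
  slowly_varying L ->
  tail_equiv (fun x => fine (P [set w | x < Zgen w])) qplus alpha L ->
  tail_equiv (fun x => fine (P [set w | Zgen w < - x])) qminus alpha L ->
  (('E_P[(fun w => `|Zgen w|%R)] < +oo -> 'E_P[Zgen] = 0)%E) ->
  (* (2) *)
  p n @[n --> \oo] --> \oo ->
  slowly_varying l ->
  0 < beta <= 1 ->
  (forall n, (0 < n)%N -> (p n)%:R = n%:R `^ beta * l n%:R) ->
  (* (3) *)
  (0 < m)%N ->
  s ord0 = 0 ->
  (forall i j : 'I_m.+1, (i < j)%N -> s i < s j) ->
  (forall n i, (0 < n)%N -> P [set w | sigmagen n w = s i :> R] = (q n i)%:E) ->
  (forall n, (0 < n)%N -> \sum_(i < m.+1) q n i = 1) ->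
  q n ord0 @[n --> \oo] --> (1 : R) ->
  (forall i : 'I_m.+1, i != ord0 ->
     exists2 li : \bar R, (0 < li)%E &
       (n%:R * q n i)%:E @[n --> \oo] --> li) ->
  cvg_in_probability P
    (fun n w =>
       let S := sample_cov (data_matrix (sigma n) Z (p n) n w) in
       b n ^- 2 * spectral_norm (S - diag_of S))
    0.
Proof.
move=> iidZ iidS posS indepSZ bpos norm1 alphaP qp0 qm0 q1 svL tailp tailm center.
move=> p_infty svl /andP[_ beta1] pE m0 s0 sincr lawS sumq _ nq.
have [al0 al4 al2] : [/\ 0 < alpha, alpha < 4 & 0 < `|2 - alpha|].
  by case/orP: alphaP => /andP[h1 h2]; split; [lra|lra|rewrite normr_gt0; lra|lra|lra|rewrite normr_gt0; lra].
pose theta := Num.min alpha (Num.min `|2 - alpha| (4 - alpha)).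
have theta0 : 0 < theta by rewrite !lt_min al0 al2 subr_gt0.
have [th1 th2 th3] : [/\ theta <= alpha, theta <= `|2 - alpha| & theta <= 4 - alpha].
  by rewrite /theta !ge_min !lexx !orbT.
(* [100] leaves ample room for every multiple of [delta] met in the exponents. *)
pose delta := theta / 100.
have delta0 : 0 < delta by rewrite divr_gt0.
have deltaE : 100 * delta = theta by rewrite /delta; field.
pose eta := delta * alpha / 8.
have da0 : 0 < delta * alpha by rewrite mulr_gt0.
have eta0 : 0 < eta by rewrite divr_gt0.
have da : delta * alpha <= 4 * delta by nra.
have etad : eta <= delta / 2 by rewrite /eta; lra.
have d25 : delta <= 1 / 25 by lra.
pose gamma := alpha - eta.
have gamma0 : 0 < gamma by rewrite /gamma; lra.
have gamma4 : gamma <= 4 by rewrite /gamma; lra.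
have dg : delta * gamma <= 4 * delta by nra.
have ex0 : 0 <= 1 - delta <= 1 + delta by lra.
have ex1 : alpha / 2 + eta <= (1 - delta) * gamma by rewrite /gamma in dg *; lra.
have ex2 : alpha / 2 + eta <= (1 - delta) * 2%:R by lra.
have ex3 : alpha < 2 -> alpha / 2 + eta <= 1 - delta.
  by move=> a2; move: th2; rewrite ger0_norm; lra.
have ex4 : 2 < alpha -> 1 <= gamma by rewrite /gamma; lra.
have eta20 : 0 < eta / 2 by rewrite divr_gt0.
have tailpow e : 0 < e -> exists X, forall x, X <= x ->
    x `^ (- (alpha + e)) <= abs_tail Zgen x <= x `^ (- (alpha - e)).
  exact: tail_power_bounds q1 svL tailp tailm.
have [X HX] := tailpow _ eta20.
have gg : gamma < alpha - eta / 2 by rewrite /gamma; lra.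
have [C C0 tailC] := power_tail_bound (lt_trans gamma0 gg) HX.
have [M1 M10 moment1] := truncated_moment_bounded gamma0 gg C0 tailC.
pose M := Num.max M1 C.
have M0 : 0 <= M by rewrite le_max M10.
have momentM tau : 0 <= tau -> mean P (trunc_pow gamma tau \o Zgen) <= M.
  by move=> t0; rewrite (le_trans (moment1 _ t0))// le_max lexx.
have tailM x : 1 <= x -> abs_tail Zgen x <= M * x `^ (- gamma).
  move=> x1; apply: (le_trans (tailC _ x1)); apply: ler_pM; rewrite ?powR_ge0//.
    by rewrite le_max lexx orbT.
  by apply: ler_powR => //; lra.
pose i1 : 'I_m.+1 := inord 1.
have i1E : val i1 = 1%N by rewrite /= inordK.
have i10 : i1 != ord0 by rewrite -val_eqE /= i1E.
pose smax := s ord_max.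
have n1 : (0 < 1)%N by [].
have vol_law n n0 i := lawS n i n0.
have smax0 : 0 <= smax by exact: (volatility_max_ge0 s0 sincr).
have s10 : 0 < s i1 by exact: (volatility_min_gt0 s0 sincr i1E).
pose qq n := fine (P [set w | sigmagen n w != 0]).
pose v n := fine ('E_P[(fun w => (sigmagen n w `^ alpha)%R)])%E.
have volE n : (0 < n)%N -> 'E_P[(fun w => (sigmagen n w `^ alpha)%R)]%E = (v n)%:E /\
    s i1 `^ alpha * qq n <= v n <= smax `^ alpha.
  move=> n0; have [v' v'E v'le] := volatility_moment (proj2 (posS n n0)) s0 sincr
    (vol_law n n0) (sumq n n0) i1E al0.
  by rewrite /v v'E.
have smax_gt0 : 0 < smax.
  by apply: (lt_le_trans s10); rewrite /smax; have [->//|ne] := eqVneq i1 ord_max;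
    apply: ltW; apply: sincr; rewrite ltn_neqAle -val_eqE in ne *; rewrite ne -ltnS ltn_ord.
have qq01 n : (0 < n)%N -> 0 <= qq n <= 1.
  move=> n0; rewrite fine_ge0//= /qq.
  have mn0 : measurable [set w | sigmagen n w != 0].
    have mX : measurable_fun setT (sigmagen n) by [].
    have -> : [set w | sigmagen n w != 0] = sigmagen n @^-1` (~` [set 0]).
      by apply/seteqP; split => w /=; [move=> /eqP|move=> /eqP].
    by rewrite -[X in measurable X]setTI; apply: mX => //; exact: measurableC.
  by rewrite -lee_fin -prob_fineK//; exact: probability_le1.
have [c c0 nqc] : exists2 c, 0 < c & \forall n \near \oo, c <= n%:R * qq n.
  have [li li0 lim_li] := nq i1 i10.
  have [c c0 Hc] := eventually_ge_of_cvg_gt0 li0 lim_li.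
  exists c => //; near=> n.
  have n0 : (0 < n)%N by near: n; exists 1%N.
  apply: (@le_trans _ _ (n%:R * q n i1)); first by near: n.
  apply: ler_wpM2l => //.
  exact: (volatility_prob_le s0 sincr (vol_law n n0) i1E i10).
have normalized : n%:R * (p n)%:R * v n * abs_tail Zgen (b n) @[n --> \oo] --> (1 : R).
  have /fine_cvgP[_] := norm1; apply: cvg_trans; apply: near_eq_cvg.
  near=> n; have n0 : (0 < n)%N by near: n; exists 1%N.
  rewrite /= (proj1 (volE n n0)) (prob_fineK P (measurable_abs_gt Zgen (b n))).
  by rewrite -!EFinM /=.
have p_le := polynomial_growth_of_regular_variation svl beta1 pE.
have regime B := asymptotic_regime al0 (abs_tail_ge0 Zgen) (@abs_tail_le _ _ _ _ Zgen)
  tailpow qq01 (powR_gt0 alpha s10) (powR_gt0 alpha smax_gt0) c0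
  (fun n n0 => proj2 (volE n n0)) nqc normalized p_infty p_le B eta0.
have b_infty B : \forall n \near \oo, B <= b n.
  by apply: filterS (regime B) => n [].
have p_pos : \forall n \near \oo, (0 < p n)%N.
  by apply: (p_infty [set k | (0 < k)%N]); exists 1%N.
move=> e0 e0_gt0.
pose e := e0 / 4.
have e_gt0 : 0 < e by rewrite divr_gt0.
(* [2 ^ r] makes [p * tau ^ (4 * 2 ^ r)] negligible against [b ^ (4 * 2 ^ r)],
   as [p <= b ^ (alpha + 1)]. *)
pose r := (Num.truncn ((alpha + 2) / (4 * delta))).+1.
have Nd : alpha + 2 <= 4 * (2 ^ r)%:R * delta.
  have h1 := ltW (truncnS_gt ((alpha + 2) / (4 * delta))).
  have h2 : (r%:R : R) <= (2 ^ r)%:R by rewrite ler_nat ltnW// ltn_expl.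
  have := le_trans h1 h2; rewrite ler_pdivrMr ?mulr_gt0//.
  by rewrite mulrA [_ * 4]mulrC.
pose N := (2 ^ r)%N.
pose S := Num.max smax 1.
have S0 : 0 <= S by rewrite le_max smax0.
pose Cr : R := (((N + N).*2.+1)%:R ^+ 2) ^+ (N + N).
have Cr0 : 0 <= Cr by rewrite exprn_ge0 ?sqr_ge0.
set bound := (2 * M + (S * (1 + M)) ^+ (N + N).*2 * Cr / (e ^+ 2) ^+ N +
      smax ^+ 4 * ((1 + M) ^+ 2 * (M * (1 + M)) + (M ^+ 2 + M ^+ 4)) / e ^+ 2).
have bound0 : 0 <= bound.
  have M10' : 0 <= 1 + M by rewrite addr_ge0.
  have e20 : 0 <= e ^+ 2 by rewrite sqr_ge0.
  have Mk k : 0 <= M ^+ k by exact: exprn_ge0.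
  apply: addr_ge0; [apply: addr_ge0|]; first exact: mulr_ge0.
    apply: divr_ge0; last exact: exprn_ge0.
    by apply: mulr_ge0 => //; apply: exprn_ge0; exact: mulr_ge0.
  apply: divr_ge0 => //; apply: mulr_ge0; first exact: exprn_ge0.
  apply: addr_ge0; last exact: addr_ge0.
  by apply: mulr_ge0; [exact: exprn_ge0|exact: mulr_ge0].
have rho0 : 0 < delta * alpha / 4 by rewrite divr_gt0.
apply: squeeze_cvge (cvg_cst 0%E) (cvg0_of_negative_power bound0 rho0 b_infty).
near=> n.
have n0 : (0 < n)%N by near: n; exists 1%N.
have [b1 npq pb Dq nb] : [/\ 1 <= b n, n%:R * (p n)%:R * qq n <= b n `^ (alpha + eta),
      (p n)%:R <= b n `^ (alpha + 1),
      Num.sqrt (Num.max n%:R (p n)%:R * (p n)%:R) * qq n <= b n `^ (alpha / 2 + eta) &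
      b n `^ (alpha / 4) <= n%:R].
  by near: n; exact: regime.
have p0 : (0 < p n)%N by near: n.
have /andP[qn0 qn1] := qq01 n n0.
have bn0 := bpos n n0.
set c' := e * b n ^+ 2.
have c'0 : 0 < c' by rewrite mulr_gt0// exprn_gt0.
have setE : [set w | e0 < `|(let S := sample_cov (data_matrix (sigma n) Z (p n) n w) in
       b n ^- 2 * spectral_norm (S - diag_of S)) - 0|] =
   [set w | 4 * c' < spectral_norm (off (sample_cov (data_matrix (sigma n) Z (p n) n w)))].
  have c'E : 4 * c' = e0 * b n ^+ 2 by rewrite /c' /e; field.
  apply/seteqP; split => w /=; rewrite subr0 -/(off _) c'E;
  (rewrite ger0_norm; last by rewrite mulr_ge0 ?invr_ge0 ?sqr_ge0 ?spectral_norm_ge0);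
  by rewrite [b n ^- 2 * _]mulrC ltr_pdivlMr// exprn_gt0.
rewrite setE; apply/andP; split; first exact: measure_ge0.
pose tau := b n `^ (1 - delta).
pose K := b n `^ (1 + delta).
pose D := Num.sqrt (Num.max n%:R (p n)%:R * (p n)%:R : R).
have maxn0 : 0 <= Num.max n%:R (p n)%:R :> R by rewrite le_max ler0n.
have pD : (p n)%:R <= D.
  rewrite -[leLHS]ger0_norm// -sqrtr_sqr ler_sqrt ?mulr_ge0// expr2.
  by apply: ler_wpM2r => //; rewrite le_max lexx orbT.
have npD : n%:R * (p n)%:R <= D ^+ 2.
  by rewrite sqr_sqrtr ?mulr_ge0//; apply: ler_wpM2r => //; rewrite le_max lexx.
have D0 : 0 <= D by rewrite sqrtr_ge0.
have tau1 : 1 <= tau by rewrite -(powRr0 (b n)); apply: ler_powR => //; case/andP: ex0.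
have tauK : tau <= K by apply: ler_powR => //; case/andP: ex0.
have H1 : D * qq n <= tau `^ gamma.
  by apply: (le_trans Dq); rewrite /tau -powRrM; exact: ler_powR.
have H2 : D * qq n <= tau ^+ 2.
  apply: (le_trans Dq); rewrite /tau -powR_mulrn ?powR_ge0// -powRrM; exact: ler_powR.
have H3 : D * qq n <= tau \/ (1 <= gamma /\ ('E_P[Zgen] = 0)%E).
  case/orP: alphaP => /andP[a1 a2].
    by left; apply: (le_trans Dq); apply: ler_powR => //; exact: ex3.
  have g1 := ex4 a1.
  right; split => //; apply: center; exact: (abs_mean_fin g1 momentM).
have := prob_spectral_gt (iidS n n0) iidZ (indepSZ n n0) (proj1 (posS n n0)) smax0
  (prob_volatility_gt_max sincr (vol_law n n0) (sumq n n0))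
  gamma0 M0 momentM tailM p0 n0 tau1 tauK D0 pD npD H1 H2 H3 r c'0.
move=> h; apply: (le_trans h); rewrite lee_fin.
apply: (@error_terms_le _ alpha delta eta M e smax S Cr (b n) n%:R (p n)%:R (qq n)
  gamma tau K c' _ _ N) => //.
- by rewrite al0.
- by rewrite deltaE.
- by rewrite deltaE.
- by rewrite deltaE.
- by rewrite ler1n.
- by apply: le_trans Dq; apply: ler_wpM2r.
Unshelve. all: by end_near. Qed.
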